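(* (i) Let $K_1$ and $F_1$ be symmetric nonnegative measurable functions on $\{(x,y): x,y>0,\ x+y\le 1\}$ such that $(x_i)\mapsto \sum_{i\neq j}K_1(x_i,x_j)\mathbf 1_{\{x_ix_j>0\}}$ and $(x_i)\mapsto\sum_i x_i\int_0^1 F_1(ux_i,(1-u)x_i)\,du$ are bounded functions on $\Omega_1$ (with $K_1(x,y):=0$ whenever $xy=0$), and let $L_1^\sharp$ be the bounded operator on $B(\Omega_1)$ $$L_1^\sharp\Phi(\mathbf x)=\frac12\sum_{i\ne j}K_1(x_i,x_j)\left(\Phi(M_{ij}\mathbf x)-\Phi(\mathbf x)\right)+\frac12\sum_i x_i\int_0^1 du\,F_1(ux_i,(1-u)x_i)\left(\Phi(S_i^u\mathbf x)-\Phi(\mathbf x)\right).$$ Let $X=(X_i)_{i=1}^\infty$ be a random element of $\Omega_1$ and suppose that the first and second correlation functions $q_1$ and $q_2$ of $\xi:=\Xi(X)$ exist and satisfy $$K_1(x_1,x_2)\,q_2(x_1,x_2)\,P_{x_1,x_2}=F_1(x_1,x_2)\,q_1(x_1+x_2)\,P_{x_1+x_2}$$ for a.e. $(x_1,x_2)\in\Delta_2^\circ=\{(x_1,x_2):x_1,x_2>0,\ x_1+x_2<1\}$, where $P_{x_1,x_2}$ and $P_{x_1+x_2}$ are the second-order and first-order reduced Palm distributions of $\xi$ and the equality is between two measures on $\mathcal N$. Then the process generated by $L_1^\sharp$ is reversible with respect to the law of $X$. (ii) Let $\theta>0$ and let $Q$ be a nonzero bounded symmetric nonnegative measurable function on $\{(x,y):x,y>0,\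 x+y\le1\}$. Then the Poisson–Dirichlet distribution ${\rm PD}(\theta)$ is a reversible distribution of the process on $\Omega_1$ generated by the bounded operator $$L_1^{(Q,\theta)}\Phi(\mathbf x)=\frac12\sum_{i\ne j}x_ix_jQ(x_i,x_j)\left(\Phi(M_{ij}\mathbf x)-\Phi(\mathbf x)\right)+\frac\theta2\sum_i x_i^2\int_0^1du\,Q(ux_i,(1-u)x_i)\left(\Phi(S_i^u\mathbf x)-\Phi(\mathbf x)\right).$$
   Context: $\Omega_1=\{\mathbf x=(x_i)_{i\ge1}:x_1\ge x_2\ge\cdots\ge0,\ \sum_ix_i=1\}$ with the product topology; $B(\Omega_1)$ is the Banach space of bounded Borel functions with the sup norm. $M_{ij}\mathbf x$ is the sequence obtained from $\mathbf x$ by merging $x_i$ and $x_j$ into $x_i+x_j$ and then reordering decreasingly; $S_i^{u}\mathbf x$ ($0<u<1$) is obtained by splitting $x_i$ into $ux_i$ and $(1-u)x_i$ and then reordering. Sums over $i\neq j$ (resp. $i$) are over indices with $x_ix_j>0$ (resp. $x_i>0$). The process generated by a bounded operator $A$ of this jump type on $B(\Omega_1)$ is the continuous-time Markov jump process on $\Omega_1$ with semigroup $e^{tA}$. It is reversible with respect to a probability measure $\pi$ ($\pi$ is a reversible distribution) if, when started from $\pi$, $(X(t_1),\dots,X(t_n))$ and $(X(T-t_1),\dots,X(T-t_n))$ have the same law for all $0<t_1<\dots<t_n<T$. $\mathcal N$ is the set of $\{0,1,2,\dots\}$-valued Radon measures on $(0,\infty)$ with the vague topology, and $\Xi(\mathbf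 x)=\sum_i\mathbf 1_{\{x_i>0\}}\delta_{x_i}\in\mathcal N$. For a locally finite point process $\xi=\sum_i\delta_{Z_i}$ on $(0,\infty)$, set $\xi^{[k]}=\sum_{i_1,\dots,i_k\ \text{distinct}}\delta_{(Z_{i_1},\dots,Z_{i_k})}$ (so $\xi^{[1]}=\xi$). The $k$th correlation measure of $\xi$ is the mean measure of $\xi^{[k]}$ on $(0,\infty)^k$; its density, if it exists, is the $k$th correlation function $q_k$. The $k$th-order reduced Palm distributions $P_{z_1,\dots,z_k}$ of $\xi$ are probability measures on $\mathcal N$, measurable in $(z_1,\dots,z_k)$ and determined up to null sets of the $k$th correlation measure $q_k(dz_1\cdots dz_k)$, such that for every bounded nonnegative Borel $G$ on $(0,\infty)^k\times\mathcal N$ $$E\Big[\int\xi^{[k]}(dz_1\cdots dz_k)\,G(z_1,\dots,z_k,\xi)\Big]=\int q_k(dz_1\cdots dz_k)\int_{\mathcal N}P_{z_1,\dots,z_k}(d\eta)\,G(z_1,\dots,z_k,\eta+\delta_{z_1}+\cdots+\delta_{z_k}).$$ ${\rm PD}(\theta)$ is the law on $\Omega_1$ of $(Y_i/\sum_jY_j)_{i\ge1}$, where $Y_1\ge Y_2\ge\cdots$ are the ranked points of a Poisson point process on $(0,\infty)$ with mean measure $\theta y^{-1}e^{-y}dy$. *)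

(* Defs.v *)
From HB Require Import structures.
From mathcomp Require Import all_boot all_order all_algebra.
From mathcomp Require Import all_classical all_reals all_analysis.
From mathcomp Require Import measurable_realfun.

Set Implicit Arguments.
Unset Strict Implicit.
Unset Printing Implicit Defensive.

Import Order.TTheory GRing.Theory Num.Theory.
Import numFieldNormedType.Exports.

Local Open Scope classical_set_scope.
Local Open Scope ring_scope.

Section omega1.
Context (R : realType).

(* Sequences are indexed from 0. *)
Definition omega1_set : set {ptws nat -> R} :=
  [set x | [/\ forall i, 0 <= x i, forall i, x i.+1 <= x i
             & (\sum_(i <oo) (x i)%:E = 1%:E)%E]].

Definition Omega1 : Type := set_type omega1_set.

HB.instance Definition _ := Topological.on Omega1.

Definition omega1_fun (x : Omega1) : nat -> R := set_val x.

Lemma omega1_unit_subproof :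
  ((fun i => (i == 0)%N%:R) : {ptws nat -> R}) \in omega1_set.
Proof.
rewrite inE; split => [i|i|].
- by rewrite ler0n.
- by rewrite eqn0Ngt/= ler0n.
- rewrite (nneseries_split _ 1) ?add0n; last by move=> k _; rewrite lee_fin ler0n.
  rewrite big_nat1 eseries0 ?adde0// => -[|i]//.
Qed.

Definition omega1_unit : Omega1 := @exist _ (fun x => x \in omega1_set) _ omega1_unit_subproof.

HB.instance Definition _ := isPointed.Build Omega1 omega1_unit.

HB.instance Definition _ :=
  Measurable.copy Omega1 (g_sigma_algebraType (@open Omega1)).

End omega1.

Coercion omega1_fun : Omega1 >-> Funclass.

Section merge_split.
Context (R : realType).
Implicit Types (x z : Omega1 R) (y : nat -> R).

(* The positive terms of [y] and [z] agree with multiplicities; zero terms are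
   ignored, since a decreasing rearrangement pushes them to the end. *)
Definition rearrangement y z : Prop :=
  exists2 sigma : nat -> nat,
    set_bij [set i | 0 < z i] [set i | 0 < y i] sigma &
    forall i, 0 < z i -> z i = y (sigma i).

Definition reorder x y : Omega1 R := xget x [set z : Omega1 R | rearrangement y z].

Definition merge_seq (i j : nat) y : nat -> R :=
  fun k => if k == i then y i + y j else if k == j then 0 else y k.

Definition split_seq (i : nat) (u : R) y : nat -> R :=
  fun k => if k is k'.+1 then (if k' == i then u * y i else y k')
           else (1 - u) * y i.

Definition Mij (i j : nat) x : Omega1 R := reorder x (merge_seq i j x).

Definition Siu (i : nat) (u : R) x : Omega1 R := reorder x (split_seq i u x).

End merge_split.

Section operators.
Context (R : realType).

Definition pair_sum (x : Omega1 R) (f : nat -> nat -> \bar R) : \bar R :=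
  (\sum_(i <oo) \sum_(j <oo | (j != i) && (0 < x i * x j)%R) f i j)%E.

Definition point_sum (x : Omega1 R) (f : nat -> \bar R) : \bar R :=
  (\sum_(i <oo | (0 < x i)%R) f i)%E.

Definition int01 (f : R -> R) : \bar R :=
  (\int[lebesgue_measure]_(u in `]0%R, 1%R[) (f u)%:E)%E.

Definition rate_dom : set (R * R) :=
  [set z | [/\ 0 < z.1, 0 < z.2 & z.1 + z.2 <= 1]].

Definition Delta2o : set (R * R) :=
  [set z | [/\ 0 < z.1, 0 < z.2 & z.1 + z.2 < 1]].

Definition symmetric_on (D : set (R * R)) (f : R * R -> R) : Prop :=
  forall x y, D (x, y) -> f (x, y) = f (y, x).

Definition nonneg_on (D : set (R * R)) (f : R * R -> R) : Prop :=
  forall z, D z -> 0 <= f z.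

Definition bounded_merge_rate (K : R * R -> R) : Prop :=
  exists C : R, forall x : Omega1 R,
    (pair_sum x (fun i j => (K (x i, x j))%:E) <= C%:E)%E.

Definition bounded_split_rate (F : R * R -> R) : Prop :=
  exists C : R, forall x : Omega1 R,
    (point_sum x (fun i =>
       (x i)%:E * int01 (fun u => F (u * x i, (1 - u) * x i)%R)) <= C%:E)%E.

Definition Lsharp (K F : R * R -> R) (Phi : Omega1 R -> R) (x : Omega1 R) : R :=
  2^-1 * fine (pair_sum x (fun i j =>
    (K (x i, x j) * (Phi (Mij i j x) - Phi x))%:E)) +
  2^-1 * fine (point_sum x (fun i =>
    (x i)%:E * int01 (fun u =>
      F (u * x i, (1 - u) * x i) * (Phi (Siu i u x) - Phi x))%R)%E).

Definition LQtheta (Q : R * R -> R) (theta : R)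
    (Phi : Omega1 R -> R) (x : Omega1 R) : R :=
  2^-1 * fine (pair_sum x (fun i j =>
    (x i * x j * Q (x i, x j) * (Phi (Mij i j x) - Phi x))%:E)) +
  theta / 2 * fine (point_sum x (fun i =>
    (x i ^+ 2)%:E * int01 (fun u =>
      Q (u * x i, (1 - u) * x i) * (Phi (Siu i u x) - Phi x))%R)%E).

End operators.

Arguments rate_dom R : clear implicits.
Arguments Delta2o R : clear implicits.

Section jump_process.
Context (R : realType).
Implicit Types (A : (Omega1 R -> R) -> (Omega1 R -> R)) (Phi Psi : Omega1 R -> R).

Definition bounded_borel Phi : Prop :=
  measurable_fun [set: Omega1 R] Phi /\ exists C : R, forall x, `|Phi x| <= C.

(* [Psi] is e^{tA} Phi, the sum in sup norm of the exponential series. *)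
Definition is_expop A (t : R) Phi Psi : Prop :=
  {uniform, (fun n x => \sum_(k < n) t ^+ k / k`!%:R * iter k A Phi x) @ \oo
            --> Psi}.

Definition past d (T : measurableType d) (X : R -> T -> Omega1 R) (s : R) :
    set (set T) :=
  <<s [set E | exists u (B : set (Omega1 R)),
         [/\ 0 <= u, u <= s, measurable B & E = X u @^-1` B]] >>.

Definition jump_path (f : R -> Omega1 R) : Prop :=
  exists tau : nat -> R,
    [/\ tau 0%N = 0, forall n, tau n <= tau n.+1, tau @ \oo --> +oo
      & forall n s t, tau n <= s < tau n.+1 -> tau n <= t < tau n.+1 ->
          f s = f t].

(* Processes are indexed by [R], but only their values at times t >= 0 matter. *)
Definition generated_process d (T : measurableType d) (P : probability T R) A
    (X : R -> T -> Omega1 R) : Prop :=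
  [/\ forall t, 0 <= t -> measurable_fun [set: T] (X t),
      {ae P, forall w, jump_path (X ^~ w)}
    & forall s t Phi Psi (E : set T),
        0 <= s -> s <= t -> bounded_borel Phi -> is_expop A (t - s) Phi Psi ->
        past X s E ->
        (\int[P]_(w in E) (Phi (X t w))%:E =
         \int[P]_(w in E) (Psi (X s w))%:E)%E].

Definition started_from d (T : measurableType d) (P : probability T R)
    (X : R -> T -> Omega1 R) (nu : probability (Omega1 R) R) : Prop :=
  forall B : set (Omega1 R), measurable B -> P (X 0 @^-1` B) = nu B.

Definition reversible A (nu : probability (Omega1 R) R) : Prop :=
  forall d (T : measurableType d) (P : probability T R) (X : R -> T -> Omega1 R),
    generated_process P A X -> started_from P X nu ->
    forall (n : nat) (t : 'I_n -> R) (U : R),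
      (forall i, 0 < t i) -> (forall i j : 'I_n, (i < j)%N -> t i < t j) ->
      (forall i, t i < U) ->
    forall B : set (n.-tuple (Omega1 R)), measurable B ->
      P [set w | B [tuple X (t i) w | i < n]] =
      P [set w | B [tuple X (U - t i) w | i < n]].

End jump_process.

Section point_measures.
Context (R : realType).

Definition integer_radon : set {measure set R -> \bar R} :=
  [set m | [/\ m (~` `]0, +oo[) = 0%E,
      forall K : set R, compact K -> K `<=` `]0, +oo[ -> (m K < +oo)%E
    & forall B : set R, measurable B ->
        m B = +oo%E \/ exists n : nat, m B = n%:R%:E]].

(* Measures on (0, +oo) are encoded as measures on the line that do not charge
   the complement of (0, +oo).  Two elements that differ only on non-measurable
   sets have the same neighbourhoods, so that Borel sets do not separate them. *)
Definition Nspace : Type := set_type integer_radon.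

HB.instance Definition _ := gen_eqMixin Nspace.
HB.instance Definition _ := gen_choiceMixin Nspace.

Definition nmeas (eta : Nspace) : {measure set R -> \bar R} := set_val eta.

Definition test_fun : Type :=
  {f : R -> R | continuous f /\
    exists K : set R, [/\ compact K, K `<=` `]0, +oo[
                        & forall x, ~ K x -> f x = 0]}.

Definition vague_eval (eta : Nspace) : {ptws test_fun -> R} :=
  fun f => (\int[nmeas eta]_x (proj1_sig f x))%R.

HB.instance Definition _ := Topological.copy Nspace (initial_topology vague_eval).

Definition pos_dirac (z : R) : {measure set R -> \bar R} :=
  if 0 < z then \d_z : {measure set R -> \bar R} else mzero.

Definition point_measure (y : nat -> R) : {measure set R -> \bar R} :=
  mseries (fun i => pos_dirac (y i)) 0.


Lemma pos_diracE z (A : set R) : pos_dirac z A = ((0 < z) && (z \in A))%:R%:E.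
Proof.
by rewrite /pos_dirac; case: ifPn => _.
Qed.

Lemma point_measureE y (A : set R) : point_measure y A =
  (\sum_(i <oo) ((0 < y i)%R && (y i \in A))%:R%:E)%E.
Proof.
by rewrite /point_measure/= /mseries; apply: eq_eseriesr => i _; exact: pos_diracE.
Qed.

Lemma integer_radon0 : integer_radon mzero.
Proof.
by split => [//|K _ _|B _]; [rewrite /mzero/= ltry|right; exists 0%N].
Qed.

Lemma compact_pos_lb (K : set R) : compact K -> K `<=` `]0, +oo[ ->
  exists2 a : R, 0 < a & forall x, K x -> a <= x.
Proof.
move=> cK K0.
have oK : open (~` K) by apply: closed_openC; exact: compact_closed.
have : nbhs (0 : R) (~` K).
  apply: open_nbhs_nbhs; split => // /K0.
  by rewrite /= in_itv/= ltxx.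
move=> /nbhs_ballP[e/= e0 eK]; exists e => // x Kx.
rewrite leNgt; apply/negP => xe.
have := K0 _ Kx; rewrite /= in_itv/= andbT => x0.
by apply: (eK x) => //; rewrite /ball/= sub0r normrN gtr0_norm.
Qed.

Lemma integer_radon_pos_dirac z : integer_radon (pos_dirac z).
Proof.
split.
- rewrite pos_diracE; case: ltP => //= z0.
  by rewrite memNset//= => -[]; rewrite /= in_itv/= z0.
- by move=> K _ _; rewrite pos_diracE ltry.
- by move=> B _; right; rewrite pos_diracE; eexists.
Qed.

Lemma integer_radon_add (m1 m2 : {measure set R -> \bar R}) : integer_radon m1 -> integer_radon m2 ->
  integer_radon (measure_add m1 m2).
Proof.
move=> [a0 aK aN] [b0 bK bN].
have E (A : set R) : measure_add m1 m2 A = (m1 A + m2 A)%E.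
  exact: measure_addE.
split.
- by rewrite [LHS]E a0 b0 adde0.
- move=> K cK K0; rewrite [X in (X < _)%E]E.
  by rewrite lte_add_pinfty ?aK ?bK.
- move=> B mB; rewrite [X in X = +oo%E \/ _]E.
  under [X in _ \/ X]eq_exists do rewrite [X in X = _]E.
  have [->|[n ->]] := aN _ mB; have [->|[k ->]] := bN _ mB.
  + by left.
  + by left.
  + by left.
  + by right; exists (n + k)%N; rewrite natrD.
Qed.

Lemma integer_radon_points (x : Omega1 R) : integer_radon (point_measure x).
Proof.
have [x0 _ x1] : omega1_set (set_val x) by exact: set_valP.
split.
- rewrite point_measureE eseries0// => i _ _.
  case: ltP => //= xi0.
  by rewrite memNset//= => -[]; rewrite /= in_itv/= xi0.
- move=> K cK K0.
  have [a a0 aK] := compact_pos_lb cK K0.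
  rewrite point_measureE.
  apply: (@le_lt_trans _ _ (\sum_(i <oo) ((a^-1)%:E * (x i)%:E))%E).
    apply: lee_nneseries => [i _ _|i _]; first by rewrite lee_fin ler0n.
    rewrite -EFinM lee_fin; case: (boolP (_ && _)) => [/andP[xi0]|_] /=.
      by rewrite inE => /aK xa; rewrite mulrC ler_pdivlMr// mul1r.
    by rewrite mulr_ge0 ?invr_ge0 ?(ltW a0)//; exact: x0.
  rewrite nneseriesZl; last by move=> i _; rewrite lee_fin; exact: x0.
  by rewrite [X in (_ * X)%E]x1 mule1 ltry.
- move=> B mB; rewrite point_measureE.
  set S := [set i | (0 < x i) && (x i \in B)].
  have -> : (\sum_(i <oo) ((0 < x i)%R && (x i \in B))%:R%:E = \sum_(i <oo) \d_i S :> \bar R)%E.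
    apply: eq_eseriesr => i _; rewrite diracE; congr (_%:R%:E).
    congr nat_of_bool.
    by apply/idP/idP; rewrite inE.
  rewrite -counting_dirac /counting; case: asboolP => _; last by left.
  by right; eexists.
Qed.

Definition Nzero : Nspace :=
  @exist _ (fun m => m \in integer_radon) _ (mem_set integer_radon0).

HB.instance Definition _ := isPointed.Build Nspace Nzero.

HB.instance Definition _ :=
  Measurable.copy Nspace (g_sigma_algebraType (@open Nspace)).

Definition Xi (x : Omega1 R) : Nspace :=
  @exist _ (fun m => m \in integer_radon) _ (mem_set (integer_radon_points x)).

Definition add_point (eta : Nspace) (z : R) : Nspace :=
  @exist _ (fun m => m \in integer_radon) (measure_add (nmeas eta) (pos_dirac z))
    (mem_set (integer_radon_add (set_valP eta) (integer_radon_pos_dirac z))).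

Definition pos_dirac2 (z : R * R) : {measure set (R * R) -> \bar R} :=
  if (0 < z.1) && (0 < z.2) then \d_z : {measure set (R * R) -> \bar R}
  else mzero.

(* [xi^{[2]}] for [xi = sum_i delta_{x_i}]. *)
Definition point_measure2 (x : nat -> R) : {measure set (R * R) -> \bar R} :=
  mseries (fun i => mseries (fun j =>
    if j != i then pos_dirac2 (x i, x j) else mzero) 0) 0.

End point_measures.

Section mean_measure.
Context (R : realType) d (T : measurableType d) (P : probability T R)
  d' (U : measurableType d') (k : R.-ker T ~> U).

Definition mean_measure (A : set U) : \bar R := (\int[P]_w k w A)%E.

Let mean0 : mean_measure set0 = 0%E.
Proof. by rewrite /mean_measure; apply: integral0_eq => w _; rewrite measure0. Qed.

Let mean_ge0 A : (0 <= mean_measure A)%E.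
Proof. by apply: integral_ge0. Qed.

Let mean_sigma_additive : semi_sigma_additive mean_measure.
Proof.
move=> F mF tF mUF; rewrite /mean_measure.
rewrite [X in _ --> X](_ : _ = (\sum_(n <oo) \int[P]_w k w (F n))%E); last first.
  rewrite -integral_nneseries//; last by move=> n; exact: measurable_kernel.
  by apply: eq_integral => w _; rewrite measure_semi_bigcup.
by apply: is_cvg_ereal_nneg_natsum => n _; exact: integral_ge0.
Qed.

HB.instance Definition _ :=
  isMeasure.Build _ _ _ mean_measure mean0 mean_ge0 mean_sigma_additive.

End mean_measure.

Section correlations.
Context (R : realType).

Lemma measurable_omega1_fun i :
  measurable_fun [set: Omega1 R] (fun x : Omega1 R => x i).
Proof.
have ct : continuous (fun x : Omega1 R => x i).
  move=> x; apply: (@continuous_comp _ _ _ (set_val : Omega1 R -> {ptws nat -> R})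
    (fun y : {ptws nat -> R} => y i)).
    exact: initial_continuous.
  exact: proj_continuous.
apply: (measurability _ (RGenOInfty.measurableE R)) => _ [_ [a ->] <-].
rewrite setTI; apply: sub_sigma_algebra.
by move/continuousP : ct; apply; exact: interval_open.
Qed.

Context d (T : measurableType d) (P : probability T R)
  (X : {RV P >-> Omega1 R}).

(* [fact1] and [fact2] are the random measures [xi^{[1]} = xi] and [xi^{[2]}]
   for [xi = Xi(X)]. *)
Definition fact1 (w : T) : {measure set R -> \bar R} := nmeas (Xi (X w)).

Definition fact2 (w : T) : {measure set (R * R) -> \bar R} :=
  point_measure2 (X w : Omega1 R).

Lemma measurable_coord i : measurable_fun [set: T] (fun w => (X w : Omega1 R) i).
Proof. exact: (measurableT_comp (measurable_omega1_fun i)). Qed.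

Lemma measurable_fact1 (A : set R) : measurable A ->
  measurable_fun [set: T] (fact1 ^~ A).
Proof.
move=> mA.
rewrite [X in measurable_fun _ X](_ : _ = fun w =>
  (\sum_(i <oo) (\1_(A `&` `]0, +oo[) ((X w : Omega1 R) i))%:E)%E); last first.
  apply/funext => w; rewrite [LHS]point_measureE.
  apply: eq_eseriesr => i _; rewrite indicE in_setI andbC.
  suff -> : ((X w : Omega1 R) i \in `]0, +oo[%classic) = (0 < (X w : Omega1 R) i).
    by [].
  by apply/idP/idP; rewrite inE/= in_itv/= andbT.
apply: ge0_emeasurable_sum => // i _; apply/measurable_EFinP.
apply: measurableT_comp (measurable_coord i).
exact: measurable_indic (measurableI _ _ mA _).
Qed.

Lemma pos_dirac2E z (A : set (R * R)) :
  pos_dirac2 z A = (\1_(A `&` [set z | 0 < z.1 /\ 0 < z.2]) z)%:E.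
Proof.
have E : (z \in [set z : R * R | 0 < z.1 /\ 0 < z.2]) = (0 < z.1) && (0 < z.2).
  apply/idP/idP => [/set_mem/= [-> ->]//|/andP[z1 z2]].
  by apply/mem_set.
rewrite indicE in_setI E /pos_dirac2.
by case: ifPn => _; rewrite ?andbT ?andbF.
Qed.

Lemma measurable_fact2 (A : set (R * R)) : measurable A ->
  measurable_fun [set: T] (fact2 ^~ A).
Proof.
move=> mA.
have mpos : measurable [set z : R * R | 0 < z.1 /\ 0 < z.2].
  rewrite [X in measurable X](_ : _ = `]0, +oo[ `*` `]0, +oo[).
    exact: measurableX.
  by apply/seteqP; split => z /=; rewrite !in_itv/= !andbT.
apply: ge0_emeasurable_sum => // i _.
apply: ge0_emeasurable_sum => // j _.
case: (j != i); last exact: measurable_cst.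
under [X in measurable_fun _ X]eq_fun => w do rewrite pos_dirac2E.
apply/measurable_EFinP; apply: measurableT_comp.
  exact: measurable_indic (measurableI _ _ mA mpos).
by apply: measurable_fun_pair; exact: measurable_coord.
Qed.

HB.instance Definition _ := isKernel.Build _ _ T R R fact1 measurable_fact1.
HB.instance Definition _ :=
  isKernel.Build _ _ T (R * R)%type R fact2 measurable_fact2.

End correlations.


Section palm.
Context (R : realType) d (T : measurableType d) (P : probability T R)
  (X : {RV P >-> Omega1 R}).

Definition correlation_measure1 : {measure set R -> \bar R} :=
  mean_measure P (fact1 X).

Definition correlation_measure2 : {measure set (R * R) -> \bar R} :=
  mean_measure P (fact2 X).

Definition halfline : set R := `]0, +oo[%classic.

Definition quadrant : set (R * R) := halfline `*` halfline.

Definition correlation_function1 (q : R -> R) : Prop :=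
  [/\ measurable_fun halfline q, forall z, 0 < z -> 0 <= q z
    & forall A : set R, measurable A -> A `<=` halfline ->
        correlation_measure1 A = (\int[lebesgue_measure]_(z in A) (q z)%:E)%E].

Definition correlation_function2 (q : R * R -> R) : Prop :=
  [/\ measurable_fun quadrant q, nonneg_on quadrant q
    & forall A : set (R * R), measurable A -> A `<=` quadrant ->
        correlation_measure2 A =
        (\int[lebesgue_measure \x lebesgue_measure]_(z in A) (q z)%:E)%E].

(* The values of [G] and of the kernels outside (0, +oo) are irrelevant. *)
Definition reduced_palm1 (Q : R.-pker R ~> Nspace R) : Prop :=
  forall G : R * Nspace R -> R,
    measurable_fun [set: R * Nspace R] G -> (forall z, 0 <= G z) ->
    (exists C : R, forall z, G z <= C) ->
    (\int[P]_w \int[fact1 X w]_(z in halfline) (G (z, Xi (X w)))%:E =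
     \int[correlation_measure1]_(z in halfline)
       \int[Q z]_eta (G (z, add_point eta z))%:E)%E.

Definition reduced_palm2 (Q : R.-pker (R * R) ~> Nspace R) : Prop :=
  forall G : (R * R) * Nspace R -> R,
    measurable_fun [set: (R * R) * Nspace R] G -> (forall z, 0 <= G z) ->
    (exists C : R, forall z, G z <= C) ->
    (\int[P]_w \int[fact2 X w]_(z in quadrant) (G (z, Xi (X w)))%:E =
     \int[correlation_measure2]_(z in quadrant)
       \int[Q z]_eta (G (z, add_point (add_point eta z.1) z.2))%:E)%E.

End palm.

Section poisson_dirichlet.
Context (R : realType).

(* The formula below is used instead of [poisson_pmf] because the latter is
   not the Poisson law when the parameter is 0. *)
Definition poisson_weight (r : R) (k : nat) : R := r ^+ k / k`!%:R * expR (- r).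

(* [xi] is a Poisson point process on (0, +oo) with sigma-finite mean measure
   [m]; the sets of infinite mean measure are determined by those of finite
   mean measure. *)
Definition poisson_process d (T : measurableType d) (P : probability T R)
    (xi : T -> {measure set R -> \bar R}) (m : set R -> \bar R) : Prop :=
  forall (n : nat) (B : 'I_n -> set R) (k : 'I_n -> nat),
    (forall i, measurable (B i)) -> (forall i, B i `<=` `]0, +oo[) ->
    trivIset [set: 'I_n] B -> (forall i, (m (B i) < +oo)%E) ->
    P [set w | forall i, xi w (B i) = (k i)%:R%:E] =
    (\prod_(i < n) poisson_weight (fine (m (B i))) (k i))%:E.

Definition gamma_intensity (theta : R) (B : set R) : \bar R :=
  (\int[lebesgue_measure]_(y in B) (theta * y^-1 * expR (- y))%:E)%E.

Definition is_PD (theta : R) (mu : probability (Omega1 R) R) : Prop :=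
  exists d (T : measurableType d) (P : probability T R)
    (Y : nat -> {RV P >-> R}) (Z : {RV P >-> Omega1 R}),
    [/\ {ae P, forall w, forall i, 0 < Y i.+1 w <= Y i w},
        poisson_process P (fun w => point_measure (fun i => Y i w))
          (gamma_intensity theta),
        {ae P, forall w, forall i,
          (Z w : Omega1 R) i = Y i w / limn (series (fun j => Y j w))}
      & forall B : set (Omega1 R), measurable B -> mu B = distribution P Z B].

End poisson_dirichlet.

(* Main.v *)
(** Reversibility of the process with semigroup e^{tA}, A bounded, follows from the
symmetry of A in L^2(nu): the exponential series gives the symmetry of e^{tA}, and the
finite-dimensional laws are then read backwards.  For a merge-split operator, symmetry
reduces to the detailed balance
  int Phi (merging part applied to Psi) d nu = int Psi (splitting part applied to Phi) d nu
for bounded Phi, Psi >= 0.  In (i), the left side is computed with the second-order Palm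
formula and the right side with the first-order one; the change of variables
(s, u) |-> (u s, (1 - u) s), with Jacobian s, turns the latter into an integral over pairs,
where the hypothesis applies almost everywhere.

In (ii), the Palm measures of PD(theta) are not needed: the Mecke formula for the Poisson
process of intensity theta y^{-1} e^{-y} dy is applied, once or twice, to its points
normalized by their sum.  By e^{-z_1} e^{-z_2} = e^{-(z_1 + z_2)} and the same change of
variables, both sides of the balance become the same integral over (z_1, z_2) of an
expectation over the remaining points. *)
Require Import Defs.
From HB Require Import structures.
From mathcomp Require Import all_boot all_order all_algebra.
From mathcomp Require Import all_classical all_reals all_analysis.
From mathcomp Require Import measurable_realfun kernel.
From mathcomp Require Import ring lra.

Set Implicit Arguments.
Unset Strict Implicit.
Unset Printing Implicit Defensive.

Import Order.TTheory GRing.Theory Num.Theory.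
Import numFieldNormedType.Exports.

Local Open Scope classical_set_scope.
Local Open Scope ring_scope.

(** * Measurable maps into the space of ranked sequences *)

(** [Mij] and [Siu] sort a sequence, which is awkward both for measurability and for comparison with
    Palm measures. A state is therefore handled through its counts a |-> #{i : x_i > a} at positive
    levels: merging removes two indicators and adds one, splitting does the converse, adding an atom
    adds one indicator. Hence merging two freshly added points gives the same state as adding their
    sum, and both sides of the balance carry the same product: Phi of the state with z_1, z_2 added
    times Psi of the state with z_1 + z_2 added. Two obstacles shape the rest. Palm formulas are
    given for bounded integrands, the rates are not bounded; both are cut along the integer part of
    their maximum, which keeps the pointwise balance. The Mecke formula must be derived from the
    joint law of counts on disjoint sets: on a grid of levels it is (k + 1) p_r(k + 1) = r p_r(k)
    for the Poisson weights p_r, and uniqueness of measures extends it. Its integrands must be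
    measurable in the configuration, so points are read back from counts by the generalized inverse
    that also sorts states. *)

Lemma measurable_set_bool d (T : measurableType d) (b : T -> bool) :
  measurable_fun [set: T] b -> measurable [set t | b t].
Proof.
move=> mb; have /(_ I) := mb measurableT [set true].
by rewrite setTI.
Qed.

Lemma measurable_split_pair d (U : measurableType d) (R : realType) (u s : U -> R) :
  measurable_fun [set: U] u -> measurable_fun [set: U] s ->
  measurable_fun [set: U] (fun t => (u t * s t, (1 - u t) * s t)).
Proof.
move=> mu ms; apply: measurable_fun_pair; first exact: measurable_funM.
by apply: measurable_funM => //; exact: measurable_funB.
Qed.

Section omega1_measurability.
Context (R : realType).

(** Otherwise each n gives a point outside [U] within 1/(n+1) of [x] on the coordinates 0, ..., n;
    these points converge coordinatewise to [x], against openness. One integer controls both the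
    number of coordinates and the radius. *)
Lemma open_omega1_box (U : set (Omega1 R)) (x : Omega1 R) : open U -> U x ->
  exists n, forall y : Omega1 R,
    (forall i, (i <= n)%N -> `|x i - y i| < n.+1%:R^-1) -> U y.
Proof.
move=> [V oV VU] Ux; apply: contrapT => /forallNP noU.
have {}noU n : exists y : Omega1 R,
    (forall i, (i <= n)%N -> `|x i - y i| < n.+1%:R^-1) /\ ~ U y.
  have /existsNP[y /not_implyP[yn Uy]] := noU n.
  by exists y.
have [y yP] := choice noU.
have yx : {ptws, (fun n => set_val (y n)) @ \oo --> set_val x}.
  apply/pointwise_cvgP => t; apply/cvgrPdist_lt => e e0.
  suff : \forall n \near \oo, `|x t - y n t| < e by [].
  near=> n; have [+ _] := yP n => /(_ t) xy.
  apply: (@lt_trans _ _ n.+1%:R^-1); last by near: n; exact: near_infty_natSinv_lt (PosNum e0).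
  by apply: xy; near: n; exists t.
have : nbhs (set_val x : {ptws nat -> R}) V.
  by apply: open_nbhs_nbhs; split => //; rewrite -VU in Ux.
move=> /yx [n _ /(_ n (leqnn n))/= Vy].
by have [_] := yP n; apply; rewrite -VU.
Unshelve. all: by end_near. Qed.

(** The product topology is second countable: an open set is the union of the boxes inside it taken
    from a countable list with rational centres, and the preimage of a box involves finitely many
    coordinates. *)
Lemma measurable_omega1P d (T : measurableType d) (f : T -> Omega1 R) :
  (forall i, measurable_fun [set: T] (fun t => f t i)) ->
  measurable_fun [set: T] f.
Proof.
move=> mf; apply: (@measurability _ _ _ _ _ _ (@open (Omega1 R))) => //.
move=> _ [U oU <-]; rewrite setTI.
(* The radius is half of that in [open_omega1_box]: a box of this radius that contains x lies, by
   the triangle inequality, in the larger box centred at x. *)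
pose bx (p : seq rat * nat) : set (Omega1 R) := [set y : Omega1 R |
  forall i, (i <= p.2)%N -> `|ratr (nth 0 p.1 i) - y i| < (2 * p.2.+1%:R)^-1].
pose V (p : seq rat * nat) := [set y | bx p y /\ bx p `<=` U].
have -> : U = \bigcup_p V p.
  apply/seteqP; split=> [|x [p _ [px pU]]]; last exact: pU.
  move=> /= x' Ux'; pose x : Omega1 R := x'; have Ux : U x by [].
  have [n nU] := open_omega1_box oU Ux.
  pose r : R := (2 * n.+1%:R)^-1; have r0 : 0 < r by rewrite invr_gt0 mulr_gt0.
  have nr : n.+1%:R^-1 = r + r by rewrite /r; field.
  have /choice[c cP] i : exists q : rat, `|ratr q - x i| < r.
    have /rat_in_itvoo[q] : x i - r < x i + r by lra.
    rewrite in_itv/= => /andP[q1 q2]; exists q; rewrite ltr_distl.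
    by apply/andP; split; lra.
  exists (mkseq c n.+1, n) => //; split=> [i /= ?|y yb]; first by rewrite nth_mkseq ?ltnS//; exact: cP.
  apply: nU => i ni; have := yb i ni; rewrite /= nth_mkseq ?ltnS// => h.
  rewrite (_ : _ - _ = (ratr (c i) - y i) - (ratr (c i) - x i)); last by lra.
  rewrite (le_lt_trans (ler_normB _ _))//.
  by rewrite nr; apply: ltrD.
rewrite preimage_bigcup; apply: countable_bigcupT_measurable => // p.
have [pU|pU] := pselect (bx p `<=` U); last first.
  by rewrite (_ : _ @^-1` _ = set0)//; apply/seteqP; split => t // -[].
have -> : f @^-1` V p = \bigcap_(i < p.2.+1) [set t |
   `|ratr (nth 0 p.1 i) - f t i| < (2 * p.2.+1%:R)^-1].
  by apply/seteqP; split=> [t [ftp _] i /= ip|t ft]; [apply: ftp|split=> // i ip; apply: ft].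
apply: bigcap_measurableType => // i _; apply: measurable_set_bool.
apply: measurable_fun_ltr => //; apply: measurableT_comp => //.
exact: measurable_funB.
Qed.

End omega1_measurability.

Lemma measurable_fun_mem d (T : measurableType d) (A : set T) : measurable A ->
  measurable_fun [set: T] (fun t => t \in A).
Proof.
move=> mA; apply: (measurable_fun_bool true); rewrite setTI.
by rewrite (_ : _ @^-1` _ = A)//; apply/seteqP; split => t /= => [/set_mem//|/mem_set].
Qed.

Lemma rat_enumeration : {e : nat -> rat | forall q, exists n, e n = q}.
Proof.
exists (fun n => odflt 0 (unpickle n)) => q; exists (pickle q).
by rewrite pickleK.
Qed.

Section counting.
Context (R : realType).
Implicit Types (x : Omega1 R) (y : nat -> R) (a : R).

Definition cnt y a : \bar R := (\sum_(i <oo) (a < y i)%R%:R%:E)%E.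

Lemma cnt_ge0 y a : (0 <= cnt y a)%E.
Proof. by apply: nneseries_ge0 => i _ _; rewrite lee_fin ler0n. Qed.

(** This duality makes [y] the generalized inverse of its counting function: a nonincreasing
    sequence can be read off from its counts. *)
Lemma lt_cnt_nonincreasing y a k : (forall i, y i.+1 <= y i) ->
  (k%:R%:E < cnt y a)%E = (a < y k).
Proof.
move=> yi.
have dy : nonincreasing_seq y by apply/nonincreasing_seqP.
have c0 i : (0 <= ((a < y i)%R%:R%:E : \bar R))%E by rewrite lee_fin ler0n.
have [ak|ak] := ltP a (y k).
  apply: (@lt_le_trans _ _ (\sum_(0 <= i < k.+1) (a < y i)%R%:R%:E)%E).
    rewrite (eq_big_nat _ _ (F2 := fun=> 1%:E)); last first.
      move=> i /andP[_ ik]; rewrite (lt_le_trans ak)//.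
      by apply: dy; rewrite -ltnS.
    by rewrite sumEFin sumr_const_nat subn0 lte_fin ltr_nat.
  by apply: nneseries_lim_ge => i _ _.
apply/negbTE; rewrite -leNgt /cnt (nneseries_split _ k)//.
rewrite add0n [X in (_ + X)%E]eseries0 ?adde0; last first.
  by move=> i ki _; rewrite ltNge (le_trans (dy _ _ ki) ak).
apply: (@le_trans _ _ (\sum_(0 <= i < k) 1%:E)%E).
  by apply: lee_sum => i _; rewrite lee_fin; case: (_ < _).
by rewrite sumEFin sumr_const_nat subn0.
Qed.

Lemma omega1_ge0 x i : 0 <= x i.
Proof. by have [/(_ i)] : omega1_set (set_val x) by exact: set_valP. Qed.

Lemma omega1_nincr x i : x i.+1 <= x i.
Proof. by have [_ /(_ i)] : omega1_set (set_val x) by exact: set_valP. Qed.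

Lemma omega1_sum x : (\sum_(i <oo) (x i)%:E = 1%:E)%E.
Proof. by have [_ _] : omega1_set (set_val x) by exact: set_valP. Qed.

Lemma lt_cnt_omega1 x a k : (k%:R%:E < cnt x a)%E = (a < x k).
Proof. exact/lt_cnt_nonincreasing/omega1_nincr. Qed.

Lemma omega1_ext x x' : (forall i, x i = x' i) -> x = x'.
Proof. by move=> xx'; apply: val_inj; apply/funext. Qed.

Lemma omega1_ex y : omega1_set y -> exists x, forall i, x i = y i.
Proof.
move=> hy.
by exists (@exist _ (fun z => z \in @omega1_set R) (y : {ptws nat -> R}) (mem_set hy)).
Qed.

(* Omega1 is described by counting functions, which make the rearrangements in [Mij] and
   [Siu] additive; rational levels suffice and keep measurability countable. *)
Definition represents x (N : R -> \bar R) : Prop :=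
  forall q : rat, 0 < q -> cnt x (ratr q) = N (ratr q).

(** A left inverse of [cnt]. The default value for functions that count no point of Omega1 makes
    merging and splitting total, at arbitrary real sizes. *)
Definition ranked (N : R -> \bar R) : Omega1 R :=
  xget (omega1_unit R) [set x | represents x N].

(** A rational level strictly between two different k-th entries would be exceeded by more than k
    entries of only one of the sequences. *)
Lemma represents_inj x x' N : represents x N -> represents x' N -> x = x'.
Proof.
suff H k z z' : represents z N -> represents z' N -> z k <= z' k.
  by move=> xN x'N; apply: omega1_ext => k; apply: le_anti; rewrite !H.
move=> zN z'N; rewrite leNgt; apply/negP => /rat_in_itvoo[q].
rewrite in_itv/= => /andP[q1 q2].
have q0 : 0 < q by rewrite -(@ltr0q R) (le_lt_trans (omega1_ge0 _ _) q1).
by move: q2; rewrite -lt_cnt_omega1 zN// -z'N// lt_cnt_omega1 ltNge (ltW q1).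
Qed.

Lemma ranked_eq x N : represents x N -> ranked N = x.
Proof.
move=> xN; rewrite /ranked; case: xgetP => [x' _ x'N|/(_ x)//].
exact: represents_inj x'N xN.
Qed.

Lemma eq_ranked N N' : (forall q : rat, 0 < q -> N (ratr q) = N' (ratr q)) ->
  ranked N = ranked N'.
Proof.
move=> NN'; rewrite /ranked; congr xget; apply/seteqP; split=> x xN q q0.
  by rewrite xN// NN'.
by rewrite xN// NN'.
Qed.

Lemma ranked_cnt x : ranked (cnt x) = x.
Proof. exact: ranked_eq. Qed.

Section measurable_ranked.
Context d (T : measurableType d) (N : T -> R -> \bar R).
Hypothesis mN : forall q : rat, 0 < q -> measurable_fun [set: T] (fun t => N t (ratr q)).

Let e := sval rat_enumeration.

(** The candidate for the k-th entry: the supremum of the positive rational levels exceeded by more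
    than k points, taken along an enumeration so that it is a countable supremum. The value 0 at the
    other rationals is harmless, since entries are nonnegative. *)
Let u k t : \bar R := esups (fun n =>
  if (0 < e n) && (k%:R%:E < N t (ratr (e n)))%E then (ratr (e n))%:E else 0%E) 0.

Let mu k : measurable_fun [set: T] (u k).
Proof.
apply: measurable_fun_esups => n; have [q0|_] := ltP 0 (e n); last exact: measurable_cst.
apply: measurable_fun_ifT; [|exact: measurable_cst..].
apply: (measurable_fun_bool true); rewrite setTI.
by rewrite -[X in measurable X]setTI; apply: measurable_lte => //; exact: mN.
Qed.

Let u_ge0 k t : (0 <= u k t)%E.
Proof.
have [n en] := svalP rat_enumeration 0.
apply: ereal_sup_ubound; exists n; first by [].
by rewrite -/e in en *; rewrite en ltxx.
Qed.

Let u_ge k t q : 0 < q -> (k%:R%:E < N t (ratr q))%E -> ((ratr q)%:E <= u k t)%E.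
Proof.
move=> q0 kN; have [n en] := svalP rat_enumeration q.
apply: ereal_sup_ubound; exists n; first by [].
by rewrite -/e in en *; rewrite en q0 kN.
Qed.

Let u_le k t (b : R) : 0 <= b ->
  (forall q : rat, 0 < q -> (k%:R%:E < N t (ratr q))%E -> ratr q <= b) -> (u k t <= b%:E)%E.
Proof.
move=> b0 bN; apply: ge_ereal_sup => _ [n _ <-].
by case: ifPn => [/andP[q0 /(bN _ q0)]|_]; rewrite lee_fin.
Qed.

Let u_nincr k t : (u k.+1 t <= u k t)%E.
Proof.
apply: ge_ereal_sup => _ [n _ <-].
case: ifPn => [/andP[q0 kN]|_]; last exact: u_ge0.
by apply: u_ge => //; apply: le_lt_trans kN; rewrite lee_fin ler_nat.
Qed.

Let u_repr x t k : represents x (N t) -> u k t = (x k)%:E.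
Proof.
move=> xN; apply/eqP; rewrite eq_le; apply/andP; split.
  apply: u_le => [|q q0]; first exact: omega1_ge0.
  by rewrite -xN// lt_cnt_omega1 => /ltW.
rewrite leNgt; apply/negP; case E : (u k t) (u_ge0 k t) => [r||]//; rewrite lee_fin lte_fin => r0.
move=> /rat_in_itvoo[q]; rewrite in_itv/= => /andP[q1 q2].
have q0 : 0 < q by rewrite -(@ltr0q R) (le_lt_trans r0 q1).
have : ((ratr q)%:E <= u k t)%E by apply: u_ge => //; rewrite -xN// lt_cnt_omega1.
by rewrite E lee_fin leNgt q1.
Qed.

(** The parameters at which [N t] really counts a point of Omega1: the candidates have sum 1 and
    counting them gives [N t] back. These are countably many equations between measurable
    functions. *)
Let good : set T := [set t | (\sum_(k <oo) u k t = 1%:E)%E] `&`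
  \bigcap_(q in [set q : rat | 0 < q])
    [set t | (\sum_(k <oo) ((ratr q)%:E < u k t)%E%:R%:E)%E = N t (ratr q)].

Let goodP t : good t <-> exists x, represents x (N t).
Proof.
split=> [[/= u1 uN]|[x xN]]; last first.
  have ux k : u k t = (x k)%:E by exact: u_repr.
  split=> [|q q0] /=; first by rewrite -(omega1_sum x); apply: eq_eseriesr => k _.
  by rewrite -xN//; apply: eq_eseriesr => k _; rewrite ux lte_fin.
have ufin k : u k t \is a fin_num.
  rewrite ge0_fin_numE; last exact: u_ge0.
  apply: (@le_lt_trans _ _ 1%:E); last by rewrite ltry.
  rewrite -u1 (@nneseriesD1 _ _ k)//.
  by rewrite leeDl// nneseries_ge0.
have [x xu] : exists x, forall i, x i = fine (u i t).
  apply: omega1_ex; split => [i|i|].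
  - by rewrite fine_ge0// u_ge0.
  - by rewrite -lee_fin !fineK.
  - by rewrite -u1; apply: eq_eseriesr => i _; rewrite fineK.
exists x => q q0; rewrite -(uN q q0).
by apply: eq_eseriesr => i _; rewrite xu -lte_fin fineK.
Qed.

Let mgood : measurable good.
Proof.
apply: measurableI.
  have mu1 : measurable_fun [set: T] (fun t => \sum_(k <oo) u k t)%E.
    by apply: ge0_emeasurable_sum => // *; exact: u_ge0.
  rewrite -[X in measurable X]setTI; exact: measurable_eqe.
rewrite bigcap_mkcond.
rewrite -[X in measurable X]setCK setC_bigcap; apply: measurableC.
apply: bigcupT_measurable_rat => q; apply: measurableC; case: ifPn => // /set_mem /= q0.
rewrite -[X in measurable X]setTI; apply: measurable_eqe => //; last exact: mN.
apply: ge0_emeasurable_sum => [k t _ _|k _]; first by rewrite lee_fin ler0n.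
apply/measurable_EFinP; apply: measurableT_comp => //.
apply: (measurable_fun_bool true); rewrite setTI.
by rewrite -[X in measurable X]setTI; apply: measurable_lte.
Qed.

(** On the measurable set [good] the entries are the measurable candidates [u]; off it [ranked] is
    constant. *)
Lemma measurable_ranked : measurable_fun [set: T] (fun t => ranked (N t)).
Proof.
apply: measurable_omega1P => i.
rewrite (_ : (fun t => _) = (fun t => if t \in good then fine (u i t) else omega1_unit R i)).
  apply: measurable_fun_ifT; last exact: measurable_cst.
    exact: measurable_fun_mem.
  exact: measurableT_comp.
apply/funext => t; case: ifPn => [/set_mem/goodP[x xN]|].
  by rewrite (ranked_eq xN) (u_repr _ xN).
rewrite notin_setE => /goodP tN; rewrite /ranked; case: xgetP => // x _ xN.
by exfalso; apply: tN; exists x.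
Qed.

End measurable_ranked.

End counting.

(** * Rearrangements *)

Lemma bump_homo h k l : (k <= l)%N -> (bump h k <= bump h l)%N.
Proof. by rewrite leq_bump2. Qed.

Section sorting.
Context (R : realType).
Implicit Types (x z : Omega1 R) (y w v : nat -> R).

Definition nonincreasing_to0 y : Prop :=
  (forall k l, (k <= l)%N -> y l <= y k) /\ (forall e, 0 < e -> exists k, y k < e).

(** Unlike [rearrangement], this is a bijection between all indices, those of zero entries
    included. *)
Definition permutes y w : Prop :=
  exists tau tau' : nat -> nat,
    [/\ cancel tau tau', cancel tau' tau & forall k, w k = y (tau k)].

Definition scons (c : R) y : nat -> R := fun k => if k is k'.+1 then y k' else c.

Lemma permutes_trans y w v : permutes y w -> permutes w v -> permutes y v.
Proof.
move=> [s [s' [sK s'K sy]]] [t [t' [tK t'K tw]]].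
exists (s \o t), (t' \o s'); split => [||k]; [exact: can_comp..|].
by rewrite tw sy.
Qed.

Lemma permutes_scons c y w : permutes y w -> permutes (scons c y) (scons c w).
Proof.
move=> [t [t' [tK t'K ty]]].
exists (fun k => if k is k'.+1 then (t k').+1 else 0%N).
exists (fun k => if k is k'.+1 then (t' k').+1 else 0%N).
by split => -[|k] //=; rewrite ?tK ?t'K.
Qed.

(** The entry [y i] moves to the first place p where the other entries are below it; p exists
    because [y i] is positive and the others become arbitrarily small. [bump] and [unbump] skip the
    index that is taken out. *)
Lemma insert_sorted y i : 0 < y i -> nonincreasing_to0 (y \o bump i) ->
  exists2 w, permutes y w & nonincreasing_to0 w.
Proof.
move=> c0 [vi v0]; have /ex_minnP[p vp pmin] := v0 _ c0.
have vlt k : (k < p)%N -> y i <= y (bump i k).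
  by move=> kp; rewrite leNgt; apply/negP => /pmin; rewrite leqNgt kp.
have vge k : (p <= k)%N -> y (bump i k) < y i.
  by move=> pk; exact: le_lt_trans (vi _ _ pk) vp.
pose tau k := if k == p then i else bump i (unbump p k).
pose tau' k := if k == i then p else bump p (unbump i k).
exists (y \o tau).
  exists tau, tau'; split => // k; rewrite /tau /tau'.
    case: (eqVneq k p) => [->|kp]; first by rewrite eqxx.
    by rewrite eq_sym (negbTE (neq_bump _ _)) bumpK unbumpK.
  case: (eqVneq k i) => [->|ki]; first by rewrite eqxx.
  by rewrite eq_sym (negbTE (neq_bump _ _)) bumpK unbumpK.
have tau_lt k : (k < p)%N -> tau k = bump i k.
  by move=> kp; rewrite /tau ltn_eqF// /unbump ltnNge (ltnW kp) subn0.
have tau_gt k : (p < k)%N -> tau k = bump i k.-1.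
  by move=> kp; rewrite /tau gtn_eqF// /unbump kp subn1.
have tau_p : tau p = i by rewrite /tau eqxx.
split=> [k l kl|e e0] /=.
  case: (ltngtP k p) => [kp|pk|kp].
  - rewrite (tau_lt _ kp); case: (ltngtP l p) => [lp|pl|->].
    + by rewrite (tau_lt _ lp); exact: vi.
    + rewrite (tau_gt _ pl); apply: vi; rewrite -ltnS prednK ?(leq_ltn_trans _ pl)//.
      exact: ltnW.
    + by rewrite tau_p; exact: vlt.
  - have pl : (p < l)%N by exact: leq_trans pk kl.
    by rewrite (tau_gt _ pk) (tau_gt _ pl); apply: vi; rewrite -!subn1 leq_sub2r.
  - move: kl; rewrite kp leq_eqVlt => /orP[/eqP<-//|pl].
    rewrite tau_p (tau_gt _ pl); apply/ltW/vge; rewrite -ltnS prednK//.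
    exact: leq_ltn_trans pl.
have [k vk] := v0 _ e0; exists (maxn p k).+1.
rewrite tau_gt ?ltnS ?leq_maxl//=.
exact: le_lt_trans (vi _ _ (leq_maxr p k)) vk.
Qed.

(** If all entries were at least e > 0, more than 1/e of them would already sum to more than 1. *)
Lemma omega1_nonincreasing_to0 x : nonincreasing_to0 x.
Proof.
split=> [k l kl|e e0].
  by move: k l kl; apply/nonincreasing_seqP; exact: omega1_nincr.
apply: contrapT => /forallNP h.
have {}h k : e <= x k by rewrite leNgt; exact/negP/h.
have [n en] : exists n : nat, 1 < n%:R * e.
  exists (Num.truncn e^-1).+1; rewrite -ltr_pdivrMr// mul1r.
  by rewrite truncnS_gt.
have : (\sum_(0 <= i < n) (x i)%:E <= 1%:E)%E.
  rewrite -(omega1_sum x); apply: nneseries_lim_ge => i _ _.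
  by rewrite lee_fin omega1_ge0.
rewrite sumEFin lee_fin leNgt => /negP; apply.
apply: lt_le_trans en _.
rewrite mulr_natl -[X in (_ *+ X)]subn0 -sumr_const_nat.
by apply: ler_sum => i _.
Qed.

Lemma rearrangement_sum y z (f : R -> \bar R) : (forall r, (0 <= f r)%E) ->
  (forall r, r <= 0 -> f r = 0%E) -> rearrangement y z ->
  (\sum_(i <oo) f (z i) = \sum_(i <oo) f (y i))%E.
Proof.
move=> f0 fN [s sb zy].
have E (v : nat -> R) : (\sum_(i <oo) f (v i) = \esum_(i in [set i | (0 < v i)%R]) f (v i))%E.
  rewrite nneseries_esumT// [RHS]esum_mkcond; apply: eq_esum => i _.
  case: ifPn => // /negP; rewrite inE/= => /negP; rewrite -leNgt; exact: fN.
rewrite !E [RHS](reindex_esum [set i | 0 < z i] _ s)//.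
by apply: eq_esum => i zi; rewrite zy.
Qed.

Lemma rearrangement_cnt y z (a : R) : 0 <= a -> rearrangement y z ->
  cnt z a = cnt y a.
Proof.
move=> a0; apply: (@rearrangement_sum _ _ (fun r => (a < r)%R%:R%:E)) => r.
  by rewrite lee_fin.
by move=> r0; rewrite ltNge (le_trans r0 a0).
Qed.

(** A rearrangement has the same counts at positive levels, hence is unique: the choice made by
    [xget] in [reorder] does not matter as soon as one rearrangement exists. *)
Lemma reorder_ranked x y : (exists z, rearrangement y z) ->
  reorder x y = ranked (cnt y).
Proof.
have H z : rearrangement y z -> z = ranked (cnt y).
  move=> yz; apply/esym/ranked_eq => q q0; apply: rearrangement_cnt => //.
  by rewrite ler0q ltW.
by move=> [z yz]; rewrite /reorder; case: xgetP => [z' _ /H//|/(_ z)].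
Qed.

(** The map [s] only has to reach the positive entries of [y], since a merge leaves an empty place
    that is to be skipped. The mass is written with positive parts because [merge_seq_sum] and
    [split_seq_sum] ask for a function that is nonnegative on the whole line. *)
Lemma rearrangement_omega1 y w (s s' : nat -> nat) : (forall k, 0 <= w k) ->
  (forall k, w k.+1 <= w k) -> cancel s s' -> (forall k, 0 < y k -> s (s' k) = k) ->
  (forall k, w k = y (s k)) ->
  (\sum_(i <oo) (Num.max (y i) 0)%:E = 1%:E)%E ->
  exists z, rearrangement y z.
Proof.
move=> w0 wi sK s'K wy y1.
have b : set_bij [set i | 0 < w i] [set i | 0 < y i] s.
  split=> [i /=|i j _ _ /(can_inj sK)//|k /= yk]; first by rewrite wy.
  by exists (s' k); rewrite /= ?wy s'K.
suff [z zw] : exists z, forall k, z k = w k.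
  exists z; exists s => [|i _]; last by rewrite zw wy.
  by rewrite (_ : [set i | 0 < z i] = [set i | 0 < w i])//; apply/seteqP; split=> i /=; rewrite zw.
apply: omega1_ex; split => //; rewrite -y1.
pose f r : \bar R := (Num.max r 0)%:E.
have E (v : nat -> R) : (\sum_(i <oo) f (v i) = \esum_(i in [set i | (0 < v i)%R]) f (v i))%E.
  rewrite nneseries_esumT; last by move=> *; rewrite lee_fin le_max lexx orbT.
  rewrite [RHS]esum_mkcond; apply: eq_esum => i _.
  by case: ifPn => // /negP; rewrite inE/= => /negP; rewrite -leNgt /f => /max_idPr ->.
rewrite [RHS]E [RHS](reindex_esum [set i | 0 < w i] _ s)//.
  under eq_esum do rewrite -wy.
  by rewrite -E; apply: eq_eseriesr => i _; rewrite /f; have /max_idPl -> := w0 i.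
Qed.

Section merge_split_sums.
Context (x : Omega1 R) (f : R -> \bar R).
Hypotheses (f0 : forall r, (0 <= f r)%E) (fz : f 0 = 0%E).

(** The terms that disappear are added on the left instead of being subtracted on the right, because
    the sums may be infinite. *)
Lemma merge_seq_sum i j : i != j ->
  (\sum_(k <oo) f (merge_seq i j x k) + f (x i) + f (x j) =
   \sum_(k <oo) f (x k) + f (x i + x j)%R)%E.
Proof.
move=> ij.
rewrite (@nneseriesD1 _ _ i)// (@nneseriesD1 _ _ j)//; last by rewrite eq_sym.
rewrite [in RHS](@nneseriesD1 _ _ i)// [in RHS](@nneseriesD1 _ _ j)//; last by rewrite eq_sym.
rewrite /merge_seq eqxx eq_sym (negbTE ij) eqxx fz add0e.
rewrite (@eq_eseriesr _ _ (fun k => f (x k))); last first.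
  by move=> k /andP[/= ki kj]; rewrite (negbTE ki) (negbTE kj).
by rewrite [RHS]addeC -!addeA [X in (_ + X)%E]addeC -!addeA.
Qed.

Lemma split_seq_sum i u :
  (\sum_(k <oo) f (split_seq i u x k) + f (x i) =
   \sum_(k <oo) f (x k) + f (u * x i)%R + f ((1 - u) * x i)%R)%E.
Proof.
rewrite nneseries_recl// /split_seq -(nneseries_addn 1)//.
under eq_eseriesr do rewrite addn1.
rewrite [in LHS](@nneseriesD1 _ _ i)// [in RHS](@nneseriesD1 _ _ i)//.
rewrite eqxx (@eq_eseriesr _ _ (fun k => f (x k))); last first.
  by move=> k /= ki; rewrite (negbTE ki).
rewrite [RHS]addeC -addeA; congr (_ + _)%E.
by rewrite addeC [X in (_ + X)%E]addeC addeA.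
Qed.

End merge_split_sums.

End sorting.

Section merge_split_ranked.
Context (R : realType).
Implicit Types (x : Omega1 R).

Definition ind (a z : R) : \bar R := (a < z)%R%:R%:E.

Definition merge_count (z1 z2 : R) (N : R -> \bar R) (a : R) : \bar R :=
  (N a - ind a z1 - ind a z2 + ind a (z1 + z2)%R)%E.

Definition split_count (z1 z2 : R) (N : R -> \bar R) (a : R) : \bar R :=
  (N a - ind a (z1 + z2)%R + ind a z1 + ind a z2)%E.

Let pos_part (r : R) : \bar R := (Num.max r 0)%:E.

Let pos_part0 r : (0 <= pos_part r)%E.
Proof. by rewrite lee_fin le_max lexx orbT. Qed.

Let pos_partE r : 0 <= r -> pos_part r = r%:E.
Proof. by move=> /max_idPl; rewrite /pos_part => ->. Qed.

Let pos_part00 : pos_part 0 = 0%E.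
Proof. by rewrite pos_partE. Qed.

Let pos_part_sum x : (\sum_(i <oo) pos_part (x i) = 1%:E)%E.
Proof.
rewrite -(omega1_sum x); apply: eq_eseriesr => i _.
by rewrite pos_partE// omega1_ge0.
Qed.

Let ind0 (q : rat) : 0 < q -> ind (ratr q) 0 = 0%E.
Proof. by move=> q0; rewrite /ind ltNge ler0q (ltW q0). Qed.

Let adde_cancel (A B : \bar R) (a b : R) :
  (0 <= A)%E -> (A + a%:E = B + b%:E -> A = B - a%:E + b%:E)%E.
Proof. by move=> A0 AB; rewrite addeAC -AB addeK. Qed.

Lemma Mij_ranked x i j : i != j -> 0 < x i -> 0 < x j ->
  Mij i j x = ranked (merge_count (x i) (x j) (cnt x)).
Proof.
move=> ij xi xj; rewrite /Mij reorder_ranked; last first.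
  have [xs x0] := omega1_nonincreasing_to0 x.
  set y := merge_seq i j x.
  (* The place of i once j is deleted. Without both places the sequence is a subsequence of [x],
     still sorted, and the merged entry is inserted into it. *)
  pose i0 := unbump j i.
  have bi0 : bump j i0 = i by rewrite unbumpK.
  have yb k : y (bump j (bump i0 k)) = x (bump j (bump i0 k)).
    rewrite /y /merge_seq -bi0 (inj_eq (can_inj (bumpK _))).
    by rewrite eq_sym (negbTE (neq_bump _ _)) eq_sym (negbTE (neq_bump _ _)).
  have [||w [t [t' [tK t'K wt]]] [wi _]] := @insert_sorted R (y \o bump j) i0.
  - by rewrite /= bi0 /y /merge_seq eqxx addr_gt0.
  - split=> [k l kl|e e0]; rewrite /=.
      by rewrite !yb xs// !bump_homo.
    have [k xk] := x0 _ e0; exists k; rewrite yb; apply: le_lt_trans xk; apply: xs.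
    exact: leq_trans (leq_addl _ k) (leq_addl _ (bump i0 k)).
  apply: (@rearrangement_omega1 _ y w (bump j \o t) (t' \o unbump j)).
  - move=> k; rewrite wt /= /y /merge_seq.
    by case: ifP => _; [rewrite addr_ge0 ?omega1_ge0|case: ifP; rewrite ?omega1_ge0].
  - by move=> k; exact: wi.
  - exact: can_comp (bumpK j) tK.
  - move=> k yk; rewrite /= t'K unbumpK//.
    by apply/eqP => kj; move: yk; rewrite kj /y /merge_seq eq_sym (negbTE ij) eqxx ltxx.
  - by move=> k; rewrite wt.
  - have := @merge_seq_sum _ x _ pos_part0 pos_part00 i j ij.
    rewrite pos_part_sum !pos_partE ?addr_ge0 ?omega1_ge0// -addeA => /adde_cancel ->.
      by rewrite -!EFinD; congr EFin; ring.
    exact: nneseries_ge0.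
apply: eq_ranked => q q0.
have := @merge_seq_sum _ x (ind (ratr q)) _ (ind0 q0) i j ij.
rewrite -/(cnt _ _) -/(cnt _ _) -addeA => /(_ _)/adde_cancel ->; last 2 first.
- exact: cnt_ge0.
- by move=> r; rewrite lee_fin.
by rewrite /merge_count EFinD fin_num_oppeD// addeA.
Qed.

Lemma Siu_ranked x i u : 0 < x i -> 0 < u -> u < 1 ->
  Siu i u x = ranked (split_count (u * x i) ((1 - u) * x i) (cnt x)).
Proof.
move=> xi u0 u1; rewrite /Siu reorder_ranked; last first.
  have [xs x0] := omega1_nonincreasing_to0 x.
  (* Two insertions: the reduced entry u x_i is moved to its place among the other entries, then (1
     - u) x_i, put in front, is moved to its own. *)
  pose w k := if k == i then u * x i else x k.
  have wb k : w (bump i k) = x (bump i k).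
    by rewrite /w eq_sym (negbTE (neq_bump _ _)).
  have [||v wv [vi v0]] := @insert_sorted R w i.
  - by rewrite /w eqxx mulr_gt0.
  - split=> [k l kl|e e0]; rewrite /=.
      by rewrite !wb xs// bump_homo.
    have [k xk] := x0 _ e0; exists k; rewrite wb; apply: le_lt_trans xk; apply: xs.
    exact: leq_addl.
  pose c := (1 - u) * x i.
  have c0 : 0 < c by rewrite mulr_gt0// subr_gt0.
  have [||v' vv' [v'i _]] := @insert_sorted R (scons c v) 0.
  - exact: c0.
  - by split=> [k l kl|e /v0[k vk]]; [exact: vi|exists k].
  have [t [t' [tK t'K v't]]] : permutes (split_seq i u x) v'.
    exact: permutes_trans (permutes_scons c wv) vv'.
  apply: (@rearrangement_omega1 _ _ v' t t') => //.
  - move=> k; rewrite v't; case: (t k) => [|l]; first exact: ltW.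
    by rewrite /split_seq; case: ifP => _; rewrite ?omega1_ge0// mulr_ge0 ?omega1_ge0// ltW.
  - by move=> k; exact: v'i.
  - have := @split_seq_sum _ x _ pos_part0 i u.
    rewrite pos_part_sum !pos_partE ?omega1_ge0 ?(ltW c0)//; last first.
      by rewrite mulr_ge0 ?omega1_ge0// ltW.
    rewrite -addeA => /adde_cancel ->.
      by rewrite -!EFinD; congr EFin; ring.
    exact: nneseries_ge0.
apply: eq_ranked => q q0.
have := @split_seq_sum _ x (ind (ratr q)) _ i u.
rewrite -/(cnt _ _) -/(cnt _ _) -addeA => /(_ _)/adde_cancel ->; last 2 first.
- exact: cnt_ge0.
- by move=> r; rewrite lee_fin.
by rewrite /split_count EFinD addeA -[X in ind _ X]mulrDl [X in ind _ (X * _)]addrC subrK mul1r.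
Qed.

End merge_split_ranked.

(** * Reversibility from a symmetric bounded generator *)

(** The M-test, recording besides uniform convergence a bound on all partial sums, which later
    serves as the dominating constant. *)
Lemma weierstrass_M (X : choiceType) (R : realType) (a : nat -> X -> R) (M : nat -> R) :
  (forall k x, `|a k x| <= M k) -> cvgn (series M) ->
  exists S : X -> R, [/\ {uniform, (fun n x => \sum_(k < n) a k x) @ \oo --> S},
    forall x, (fun n => \sum_(k < n) a k x) @ \oo --> S x,
    forall n x, `|\sum_(k < n) a k x| <= limn (series M)
    & forall x, `|S x| <= limn (series M)].
Proof.
move=> aM cM.
have M0 k : X -> 0 <= M k by move=> x; exact: le_trans (aM k x).
have serE x : (fun n => \sum_(k < n) a k x) = series (fun k => a k x).
  by apply/funext => n; rewrite /series/= big_mkord.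
have cN x : cvgn [normed series (fun k => a k x)].
  by apply: (series_le_cvg _ _ _ cM) => n; [exact: normr_ge0|exact: M0|exact: aM].
have c x : cvgn (series (fun k => a k x)) by exact: normed_cvg.
have diff x n m : (n <= m)%N ->
    `|series (fun k => a k x) m - series (fun k => a k x) n| <= series M m - series M n.
  move=> nm; rewrite !sub_series_geq//.
  by apply: le_trans (ler_norm_sum _ _ _) _; exact: ler_sum.
have tail x n : `|limn (series (fun k => a k x)) - series (fun k => a k x) n| <=
    limn (series M) - series M n.
  have h1 : (fun m => `|series (fun k => a k x) m - series (fun k => a k x) n|) @ \oo -->
      `|limn (series (fun k => a k x)) - series (fun k => a k x) n|.
    by apply: cvg_norm; apply: cvgB; [exact: c|exact: cvg_cst].
  have h2 : (fun m => series M m - series M n) @ \oo --> limn (series M) - series M n.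
    by apply: cvgB; [exact: cM|exact: cvg_cst].
  by apply: (ler_cvg_to h1 h2); near=> m; apply: diff; near: m; exact: nbhs_infty_ge.
exists (fun x => limn (series (fun k => a k x))); split.
- move=> P /uniform_nbhs[E [entE EP]].
  move: entE; rewrite -entourage_ballE => -[e /= e0 eE].
  have /cvgrPdist_lt/(_ _ e0)[N _ NM] := cM.
  exists N => // n /= Nn; apply: EP => x _; apply: eE.
  have := congr1 (fun f => f n) (serE x); rewrite /= /ball/= => ->.
  apply: le_lt_trans (tail x n) _.
  by apply: le_lt_trans (NM n Nn); exact: ler_norm.
- by move=> x; rewrite serE; exact: c.
- move=> n x; apply: (@le_trans _ _ (series M n)).
    rewrite /series/= big_mkord.
    by apply: le_trans (ler_norm_sum _ _ _) _; exact: ler_sum.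
  apply: nondecreasing_cvgn_le => //.
  by apply/nondecreasing_seqP => k; rewrite !seriesEnat/= big_nat_recr//= lerDl (M0 _ x).
- move=> x; have := tail x 0; rewrite /series/= !big_geq//.
  by rewrite !subr0.
Unshelve. all: by end_near. Qed.

Section semigroup.
Context (R : realType) (A : (Omega1 R -> R) -> (Omega1 R -> R)) (c : R)
  (nu : probability (Omega1 R) R).
Hypothesis c0 : 0 <= c.
Implicit Types Phi Psi : Omega1 R -> R.

Definition bounded_by (C : R) (Phi : Omega1 R -> R) : Prop :=
  measurable_fun [set: Omega1 R] Phi /\ forall x, `|Phi x| <= C.

Definition pairing (Phi Psi : Omega1 R -> R) : \bar R :=
  (\int[nu]_x (Phi x * Psi x)%:E)%E.

Hypothesis A_bounded : forall C Phi, bounded_by C Phi -> bounded_by (c * C) (A Phi).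
Hypothesis A_sym : forall Phi Psi, bounded_borel Phi -> bounded_borel Psi ->
  pairing Phi (A Psi) = pairing (A Phi) Psi.
Hypothesis A1 : A (cst 1) = cst 0.

Lemma bounded_borelP Phi : bounded_borel Phi <-> exists C, bounded_by C Phi.
Proof. by split=> [[mP [C PC]]|[C [mP PC]]]; [exists C|split=> //; exists C]. Qed.

Let iterA C Phi k : bounded_by C Phi -> bounded_by (c ^+ k * C) (iter k A Phi).
Proof.
by move=> PC; elim: k => [|k ih]; rewrite ?expr0 ?mul1r//= exprS -mulrA; exact: A_bounded.
Qed.

Definition expsum t n Phi : Omega1 R -> R :=
  fun x => \sum_(k < n) t ^+ k / k`!%:R * iter k A Phi x.

Lemma bounded_borelM Phi Psi : bounded_borel Phi -> bounded_borel Psi ->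
  bounded_borel (fun x => Phi x * Psi x).
Proof.
move=> [mP [C PC]] [mQ [D QD]]; split; first exact: measurable_funM.
by exists (C * D) => x; rewrite normrM ler_pM.
Qed.

Lemma bounded_borel_integrable d (T : measurableType d) (P : probability T R)
    (X : T -> Omega1 R) (E : set T) Phi : measurable E -> measurable_fun [set: T] X ->
  bounded_borel Phi -> P.-integrable E (EFin \o (Phi \o X)).
Proof.
move=> mE mX [mP [C PC]]; apply: measurable_bounded_integrable => //.
- by apply: le_lt_trans (probability_le1 _ _) _ => //; rewrite ltry.
- by apply: measurable_funTS; exact: measurableT_comp.
- exists C; split; first exact: num_real.
  by move=> M CM x _ /=; apply: le_trans (PC _) (ltW CM).
Qed.

Lemma pairing_integrable Phi Psi : bounded_borel Phi -> bounded_borel Psi ->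
  nu.-integrable setT (fun x => (Phi x * Psi x)%:E).
Proof.
move=> bP bQ.
exact: (@bounded_borel_integrable _ _ nu id setT _ _ _ (bounded_borelM bP bQ)).
Qed.

Lemma pairingC Phi Psi : pairing Phi Psi = pairing Psi Phi.
Proof. by apply: eq_integral => x _; rewrite mulrC. Qed.

Lemma pairing1 Phi : pairing (cst 1) Phi = (\int[nu]_x (Phi x)%:E)%E.
Proof. by apply: eq_integral => x _; rewrite mul1r. Qed.

Lemma pairingDZ Phi Psi Psi' r : bounded_borel Phi -> bounded_borel Psi -> bounded_borel Psi' ->
  pairing Phi (fun x => Psi x + r * Psi' x) = (pairing Phi Psi + r%:E * pairing Phi Psi')%E.
Proof.
move=> bP bQ bQ'; rewrite /pairing.
have iQ' := pairing_integrable bP bQ'.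
transitivity (\int[nu]_x ((Phi x * Psi x)%:E + r%:E * (Phi x * Psi' x)%:E))%E.
  by apply: eq_integral => x _; rewrite -EFinM -EFinD; congr EFin; ring.
rewrite integralD//; last 2 first.
- exact: pairing_integrable.
- exact: integrableZl.
by rewrite integralZl.
Qed.

Let iter_bb Phi k : bounded_borel Phi -> bounded_borel (iter k A Phi).
Proof. by move=> /bounded_borelP[C PC]; apply/bounded_borelP; eexists; exact: iterA PC. Qed.

Let iter_sym k Phi Psi : bounded_borel Phi -> bounded_borel Psi ->
  pairing Phi (iter k A Psi) = pairing (iter k A Phi) Psi.
Proof.
move=> bP; elim: k Psi => [//|k ih] Psi bQ.
by rewrite iterSr ih ?A_sym//; [exact: iter_bb|exact: (iter_bb 1%N bQ)].
Qed.

Let expsum_bb t n Phi : bounded_borel Phi -> bounded_borel (expsum t n Phi).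
Proof.
move=> bP; elim: n => [|n [mS [D SD]]].
  rewrite (_ : expsum t 0 Phi = cst 0); last by apply/funext => x; rewrite /expsum big_ord0.
  by split => //; exists 0 => x; rewrite normr0.
have [mA [D' AD']] := iter_bb n bP.
split.
  rewrite (_ : expsum t n.+1 Phi = (fun x => expsum t n Phi x + t ^+ n / n`!%:R * iter n A Phi x)).
    by apply: measurable_funD => //; apply: measurable_funM.
  by apply/funext => x; rewrite /expsum big_ord_recr.
exists (D + `|t ^+ n / n`!%:R| * D') => x.
rewrite /expsum big_ord_recr/= (le_trans (ler_normD _ _))// lerD ?SD//.
by rewrite normrM ler_wpM2l.
Qed.

Let expsum_sym t n Phi Psi : bounded_borel Phi -> bounded_borel Psi ->
  pairing Phi (expsum t n Psi) = pairing (expsum t n Phi) Psi.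
Proof.
move=> bP bQ.
have S x (F : Omega1 R -> R) m : expsum t m.+1 F x = expsum t m F x + t ^+ m / m`!%:R * iter m A F x.
  by rewrite /expsum big_ord_recr.
elim: n => [|n ih].
  by congr integral; apply/funext => x; rewrite /expsum !big_ord0 mul0r mulr0.
have SE F : expsum t n.+1 F = fun x => expsum t n F x + t ^+ n / n`!%:R * iter n A F x.
  exact/funext.
rewrite !SE pairingDZ//; [|exact: expsum_bb|exact: iter_bb].
rewrite [RHS]pairingC pairingDZ//; [|exact: expsum_bb|exact: iter_bb].
by rewrite ih iter_sym// ![pairing Psi _]pairingC.
Qed.

(** The k-th term is at most C (|t| c)^k / k! in modulus, the terms of an exponential series. *)
Lemma expop_ex t Phi : bounded_borel Phi -> exists Psi,
  [/\ is_expop A t Phi Psi, bounded_borel Psi,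
      forall x, expsum t ^~ Phi ^~ x @ \oo --> Psi x
    & exists D, forall n x, `|expsum t n Phi x| <= D].
Proof.
move=> /bounded_borelP[C PC].
pose M k := C * exp_coeff (`|t| * c) k.
have aM k x : `|t ^+ k / k`!%:R * iter k A Phi x| <= M k.
  have [_ /(_ x) h] := iterA k PC.
  rewrite normrM /M mulrC.
  apply: (@le_trans _ _ (c ^+ k * C * `|t ^+ k / k`!%:R|)); first by rewrite ler_wpM2r.
  rewrite normrM normrX normfV normr_nat /exp_coeff/= exprMn.
  by rewrite le_eqVlt; apply/orP; left; apply/eqP; ring.
have cM : cvgn (series M).
  by apply: is_cvg_seriesZ; exact: is_cvg_series_exp_coeff.
have [S [Su Sc Sb Sl]] := weierstrass_M aM cM.
exists S; split=> //; last by exists (limn (series M)).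
split; last by exists (limn (series M)).
apply: (measurable_fun_cvg (h := fun n => expsum t n Phi)) => // [n|x _]; last exact: Sc.
have /(expsum_bb t n)[]// : bounded_borel Phi by apply/bounded_borelP; exists C.
Qed.

Definition expop t Phi : Omega1 R -> R := xget (cst 0) [set Psi |
  [/\ is_expop A t Phi Psi, bounded_borel Psi,
      forall x, expsum t ^~ Phi ^~ x @ \oo --> Psi x
    & exists D, forall n x, `|expsum t n Phi x| <= D]].

Lemma expopP t Phi : bounded_borel Phi ->
  [/\ is_expop A t Phi (expop t Phi), bounded_borel (expop t Phi),
      forall x, expsum t ^~ Phi ^~ x @ \oo --> expop t Phi x
    & exists D, forall n x, `|expsum t n Phi x| <= D].
Proof.
move=> bP; rewrite /expop; case: xgetP => // h.
by have [Psi PsiP] := expop_ex t bP; have := h Psi.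
Qed.

Lemma bounded_borel_expop t Phi : bounded_borel Phi -> bounded_borel (expop t Phi).
Proof. by case/(expopP t). Qed.

Let pairing_expop t Phi Psi : bounded_borel Phi -> bounded_borel Psi ->
  pairing Phi (expsum t n Psi) @[n --> \oo] --> pairing Phi (expop t Psi).
Proof.
move=> bP bQ; have [_ bE cE [D SD]] := expopP t bQ.
have [mP [C PC]] := bP.
apply: (@dominated_cvg _ _ _ _ _ _ _ _ (cst (C * D)%:E)) => //.
- move=> n; apply/measurable_EFinP; apply: measurable_funM => //.
  by have [] := expsum_bb t n bQ.
- move=> x _; apply: cvg_EFin; first exact: nearW.
  by apply: cvgMr; exact: cE.
- exact: finite_measure_integrable_cst.
- by move=> n x _; rewrite lee_fin normrM ler_pM.
Qed.

Lemma expop_sym t Phi Psi : bounded_borel Phi -> bounded_borel Psi ->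
  pairing Phi (expop t Psi) = pairing (expop t Phi) Psi.
Proof.
move=> bP bQ; have h := pairing_expop (t := t) bP bQ.
have h' := pairing_expop (t := t) bQ bP.
rewrite [RHS]pairingC.
rewrite -(cvg_lim _ h)// -(cvg_lim _ h')//; congr (lim (_ @ \oo)).
by apply/funext => n; rewrite expsum_sym// pairingC.
Qed.

(** Only the term of order 0 survives: [A] kills 1, and it kills 0 by its bound applied with C =
    0. *)
Lemma expop1 t : expop t (cst 1) = cst 1.
Proof.
have b1 : bounded_borel (cst 1 : Omega1 R -> R) by split=> //; exists 1 => x; rewrite normr1.
have [_ _ h _] := expopP t b1; apply/funext => x.
rewrite -(cvg_lim _ (h x))//.
have A0 : A (cst 0) = cst 0.
  have b0 : bounded_by 0 (cst 0 : Omega1 R -> R) by split=> // y; rewrite normr0.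
  have [_ A0] := A_bounded b0; apply/funext => y; have := A0 y.
  by rewrite mulr0 normr_le0 => /eqP.
have i0 k : iter k.+1 A (cst 1) = cst 0.
  by elim: k => [|k ih]; [exact: A1|rewrite iterS ih].
apply: cvg_lim => //; rewrite -(cvg_shiftn 1)/= (_ : (fun n => _) = cst 1); first exact: cvg_cst.
apply/funext => n; rewrite addn1 /expsum big_ord_recl/= expr0 fact0 invr1 !mul1r.
by rewrite big1 ?addr0// => i _; rewrite add0n -iterS i0 mulr0.
Qed.

Section finite_dimensional.
Context (n : nat) (B : 'I_n -> set (Omega1 R)).
Hypothesis mB : forall i, measurable (B i).

Lemma bounded_borel_indic E : measurable E -> bounded_borel (\1_E : Omega1 R -> R).
Proof.
move=> mE; split; first exact: measurable_indic.
by exists 1 => x; rewrite indicE normr_nat lern1; case: (_ \in _).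
Qed.

(** For a process with semigroup e^{tA}, the conditional probability, given the state x at time s,
    of being in [B i] at time [t i] for all i in the list. [fdd_head] is the same quantity seen at
    the first of these times, before the semigroup acts. *)
Fixpoint fdd_fun (t : 'I_n -> R) (s : R) (r : seq 'I_n) : Omega1 R -> R :=
  if r is i :: r' then
    expop (t i - s) (fun x => \1_(B i) x * fdd_fun t (t i) r' x)
  else cst 1.

Definition fdd_head (t : 'I_n -> R) (r : seq 'I_n) : Omega1 R -> R :=
  if r is i :: r' then fun x => \1_(B i) x * fdd_fun t (t i) r' x else cst 1.

Lemma bounded_borel_fdd t s r : bounded_borel (fdd_fun t s r).
Proof.
elim: r s => [|i r ih] s /=; first by split=> //; exists 1 => x; rewrite normr1.
by apply: bounded_borel_expop; apply: bounded_borelM; [exact: bounded_borel_indic|].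
Qed.

(* The indices already visited are stored, in reverse order, in the first
   argument of the pairing; symmetry of the semigroup moves one more index at each step. *)
Lemma fdd_reverse (t : 'I_n -> R) (U : R) i r a :
  pairing (fdd_fun (fun j => U - t j) (U - t i) a) (fdd_head t (i :: r)) =
  pairing (cst 1) (fdd_head (fun j => U - t j) (catrev r (i :: a))).
Proof.
elim: r i a => [|j r ih] i a.
  rewrite pairing1; apply: eq_integral => x _ /=.
  by rewrite mulr1 mulrC.
rewrite [RHS]/= -ih /=.
have -> : U - t i - (U - t j) = t j - t i by ring.
rewrite -expop_sym; last 2 first.
- apply: bounded_borelM; [exact: bounded_borel_indic|exact: bounded_borel_fdd].
- apply: bounded_borelM; [exact: bounded_borel_indic|exact: bounded_borel_fdd].
by apply: eq_integral => x _; congr EFin; ring.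
Qed.

Context d (T : measurableType d) (P : probability T R) (X : R -> T -> Omega1 R).
Hypothesis genX : generated_process P A X.

Let mX t : 0 <= t -> measurable_fun [set: T] (X t).
Proof. by case: genX => + _ _; apply. Qed.

Lemma measurable_past s E : past X s E -> measurable E.
Proof.
apply: smallest_sub; first exact: sigma_algebra_measurable.
move=> _ [u [C [u0 _ mC ->]]]; rewrite -[X in measurable X]setTI.
exact: mX.
Qed.

Lemma past_le s t E : s <= t -> past X s E -> past X t E.
Proof.
move=> st; apply: sub_sigma_algebra2 => F [u [C [u0 us mC ->]]].
by exists u, C; split => //; exact: le_trans st.
Qed.

(** The Markov property, one time after the other: the event of being in [B i] at time [t i] joins
    the past, and the induction hypothesis is applied with this larger event at the later time. *)
Lemma fddE (t : 'I_n -> R) s r E : 0 <= s -> path (fun u v => u <= v) s (map t r) ->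
  past X s E ->
  P (E `&` [set w | forall i, i \in r -> B i (X (t i) w)]) =
  (\int[P]_(w in E) (fdd_fun t s r (X s w))%:E)%E.
Proof.
elim: r s E => [|i r ih] s E s0 /= rt pE.
  rewrite (_ : _ `&` _ = E); last by apply/seteqP; split => [w []|w].
  by rewrite integral_cst ?mul1e//; exact: measurable_past pE.
move: rt => /andP[sti rt].
have t0 : 0 <= t i by exact: le_trans sti.
have pE' : past X (t i) (E `&` X (t i) @^-1` B i).
  apply: (@measurableI _ (g_sigma_algebraType _)); first exact: past_le pE.
  by apply: sub_sigma_algebra; exists (t i), (B i).
have bb : bounded_borel (fun x => \1_(B i) x * fdd_fun t (t i) r x).
  by apply: bounded_borelM; [exact: bounded_borel_indic|exact: bounded_borel_fdd].
have [_ _ gX] := genX.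
have [ex _ _ _] := expopP (t i - s) bb.
rewrite -(gX s (t i) _ _ E s0 sti bb ex pE).
have mE := measurable_past pE.
have -> : E `&` [set w | forall j, j \in i :: r -> B j (X (t j) w)] =
   (E `&` X (t i) @^-1` B i) `&` [set w | forall j, j \in r -> B j (X (t j) w)].
  apply/seteqP; split=> [w [Ew h]|w [[Ew Bi] h]] /=.
    split; first by split=> //; apply: h; rewrite mem_head.
    by move=> j jr; apply: h; rewrite in_cons jr orbT.
  by split=> // j; rewrite in_cons => /predU1P[->//|/h].
rewrite (ih _ _ t0 rt pE').
rewrite integral_mkcondr; apply: eq_integral => w _.
rewrite patchE indicE (_ : (w \in _ @^-1` _) = (X (t i) w \in B i)).
  by case: (_ \in _); rewrite ?mul1r ?mul0r.
by apply/idP/idP; rewrite !inE.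
Qed.

Hypothesis started : started_from P X nu.

(** The semigroup over the initial interval disappears: by symmetry it moves to the constant 1,
    which it fixes. This is the invariance of [nu], so that only the gaps between the times
    remain. *)
Lemma fdd_law (t : 'I_n -> R) r : (forall i, 0 < t i) ->
  sorted (fun i j => t i < t j) r ->
  P [set w | forall i, i \in r -> B i (X (t i) w)] = pairing (cst 1) (fdd_head t r).
Proof.
move=> t0 rs.
have p0 : path (fun u v => u <= v) 0 (map t r).
  case: r rs => //= i r; rewrite (ltW (t0 i))/= path_map.
  by apply: sub_path => j k /= /ltW.
have pT : past X 0 [set: T].
  exact: (@measurableT _ (g_sigma_algebraType _)).
have := fddE (lexx 0) p0 pT; rewrite setTI => ->.
have m0 := mX (lexx 0).
transitivity (\int[nu]_x (fdd_fun t 0 r x)%:E)%E.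
  have [mW _] := bounded_borel_fdd t 0 r.
  have := @integral_pushforward _ _ _ _ _ _ m0 P setT (fun x => (fdd_fun t 0 r x)%:E).
  rewrite preimage_setT => <- //.
  - by apply: eq_measure_integral => C mC _; exact: started.
  - exact/measurable_EFinP.
  - exact: bounded_borel_integrable (bounded_borel_fdd t 0 r).
case: r {rs p0} => [|i r] /=; first by rewrite pairing1.
rewrite -pairing1 expop_sym ?expop1//.
  by split=> //; exists 1 => x; rewrite normr1.
by apply: bounded_borelM; [exact: bounded_borel_indic|exact: bounded_borel_fdd].
Qed.

End finite_dimensional.

Lemma reversible_of_symmetric : reversible A nu.
Proof.
move=> d T P X genX started n t U t0 tinc tU B mB.
pose tp (s : 'I_n -> R) w := [tuple X (s i) w | i < n].
have mtp s : (forall i, 0 <= s i) -> measurable_fun [set: T] (tp s).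
  move=> s0; apply/measurable_fun_tnthP => i.
  rewrite (_ : _ \o _ = X (s i)); first by case: genX => + _ _; apply.
  by apply/funext => w; rewrite /= tnth_mktuple.
have m1 := mtp t (fun i => ltW (t0 i)).
have t'0 i : 0 < U - t i by rewrite subr_gt0.
have m2 := mtp (fun i => U - t i) (fun i => ltW (t'0 i)).
(* Measurable rectangles form a generating family stable under intersection, so the two laws need to
   be compared only there. *)
pose G : set (set (n.-tuple (Omega1 R))) := [set C | exists2 b : 'I_n -> set (Omega1 R),
  (forall i, measurable (b i)) & C = [set v | forall i, b i (tnth v i)]].
have GT : G setT by exists (fun=> setT) => //; apply/seteqP; split.
change (pushforward P (tp t) B = pushforward P (tp (fun i => U - t i)) B).
apply: (@measure_unique _ _ _ G (fun=> setT)) => //.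
- apply/seteqP; split.
    apply: smallest_sub; first exact: smallest_sigma_algebra.
    move=> C; rewrite -bigcup_seq => -[i _ [D mD <-]]; apply: sub_sigma_algebra.
    exists (fun j => if j == i then D else setT) => [j|]; first by case: ifP.
    apply/seteqP; split=> [v [_ Dv] j|v /(_ i)] /=; last by rewrite eqxx.
    by case: eqP => [->|].
  apply: smallest_sub; first exact: sigma_algebra_measurable.
  move=> _ [b mb ->].
  rewrite (_ : mkset _ = \bigcap_(i in [set: 'I_n]) ((@tnth n _)^~ i @^-1` b i)).
    apply: fin_bigcap_measurable => // i _; rewrite -[X in measurable X]setTI.
    exact: measurable_tnth.
  by apply/seteqP; split=> v h i => [_|]; exact: h.
- move=> _ _ [b mb ->] [b' mb' ->]; exists (fun i => b i `&` b' i).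
    by move=> i; exact: measurableI.
  by apply/seteqP; split=> [v [h h'] i|v h]; [|split=> i; case: (h i)].
- by rewrite bigcup_const.
- move=> _ [b mb ->].
  have tpE s : tp s @^-1` [set v | forall i, b i (tnth v i)] =
      [set w | forall i, i \in enum 'I_n -> b i (X (s i) w)].
    apply/seteqP; split=> w h i; first by have := h i; rewrite tnth_mktuple.
    by rewrite tnth_mktuple; apply: h; rewrite mem_enum.
  change (P (tp t @^-1` [set v | forall i, b i (tnth v i)]) =
    P (tp (fun i => U - t i) @^-1` [set v | forall i, b i (tnth v i)])).
  rewrite !tpE.
  have srt : sorted (fun i j : 'I_n => t i < t j) (enum 'I_n).
    apply: (@sub_sorted _ (fun i j : 'I_n => (i < j)%N)).
      by move=> i j; exact: tinc.
    by have := iota_ltn_sorted 0 n; rewrite -val_enum_ord sorted_map.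
  rewrite (fdd_law mb genX started)//.
  have -> : [set w | forall i, i \in enum 'I_n -> b i (X (U - t i) w)] =
            [set w | forall i, i \in rev (enum 'I_n) -> b i (X (U - t i) w)].
    by apply/seteqP; split=> w h i; [rewrite mem_rev; exact: h|rewrite -mem_rev; exact: h].
  rewrite (fdd_law mb genX started)//; last first.
    rewrite rev_sorted; apply: sub_sorted srt => i j /=.
    by rewrite ltrD2l ltrN2.
  (* An empty list occurs when n = 0. Otherwise reversing the list starts with its first index and
     no visited index, the case of an empty first list in [fdd_reverse]. *)
  case: (enum 'I_n) => [//|i r].
  by rewrite /rev /= -(fdd_reverse mb).
- move=> _; change (P (tp t @^-1` setT) < +oo)%E.
  by rewrite preimage_setT probability_setT ltry.
Qed.

End semigroup.

(** * Detailed balance for merging and splitting *)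

(** Two numbers in [0, A] differ by at most A; bounding each modulus separately would lose a factor
    2. *)
Lemma norm_half_diff (R : realFieldType) (a k b l A B : R) :
  0 <= a <= A -> 0 <= k <= A -> 0 <= b <= B -> 0 <= l <= B ->
  `|2^-1 * (a - k) + 2^-1 * (b - l)| <= 2^-1 * A + 2^-1 * B.
Proof.
move=> /andP[a0 aA] /andP[k0 kA] /andP[b0 bB] /andP[l0 lB].
by rewrite ler_norml; apply/andP; split; lra.
Qed.

Section nonnegative_series_difference.
Context (R : realType).

Lemma nneseriesB (a b : nat -> \bar R) (P : pred nat) :
  (forall i, P i -> 0 <= a i)%E -> (forall i, P i -> 0 <= b i)%E ->
  (\sum_(i <oo | P i) a i < +oo)%E -> (\sum_(i <oo | P i) b i < +oo)%E ->
  (\sum_(i <oo | P i) (a i - b i) = \sum_(i <oo | P i) a i - \sum_(i <oo | P i) b i)%E.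
Proof.
move=> a0 b0 aoo boo.
have fin (c : nat -> \bar R) : (forall i, P i -> 0 <= c i)%E ->
    (\sum_(i <oo | P i) c i < +oo)%E -> forall i, P i -> c i \is a fin_num.
  move=> c0 coo i Pi; rewrite ge0_fin_numE ?c0//; apply: le_lt_trans coo.
  rewrite (@nneseriesD1 _ _ i)// leeDl//.
  by apply: nneseries_ge0 => j _ /andP[Pj _]; exact: c0.
apply: cvg_lim => //.
have -> : (fun n => \sum_(0 <= i < n | P i) (a i - b i))%E =
    (fun n => \sum_(0 <= i < n | P i) a i - \sum_(0 <= i < n | P i) b i)%E.
  apply/funext => n; elim: n => [|n ih]; first by rewrite !big_geq// sube0.
  have S (c : nat -> \bar R) : (\sum_(0 <= i < n.+1 | P i) c i =
      \sum_(0 <= i < n | P i) c i + if P n then c n else 0)%E.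
    by rewrite big_mkcond/= big_nat_recr//= -big_mkcond.
  rewrite !S ih; case: ifPn => [Pn|_]; last by rewrite !adde0.
  rewrite oppeD; last by rewrite fin_num_adde_defl// fin// .
  by rewrite addeACA.
apply: cvgeB.
- rewrite fin_num_adde_defl// fin_numN ge0_fin_numE//.
  by apply: nneseries_ge0 => i _; exact: b0.
- by apply: is_cvg_nneseries => i _; exact: a0.
- by apply: is_cvg_nneseries => i _; exact: b0.
Qed.

End nonnegative_series_difference.

Section rates.
Context (R : realType) (K F : R * R -> R).
Hypotheses (K0 : forall z, 0 <= K z) (F0 : forall z, 0 <= F z).
Hypotheses (mK : measurable_fun [set: R * R] K) (mF : measurable_fun [set: R * R] F).
Implicit Types (x : Omega1 R) (Phi Psi : Omega1 R -> R).

(** By [Mij_ranked], this is [Mij] when the sizes are two positive entries of [x] at different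
    indices; but it is defined for all sizes and jointly measurable in sizes and state. [split]
    plays the same role for [Siu]. *)
Definition merge (z1 z2 : R) x : Omega1 R := ranked (merge_count z1 z2 (cnt x)).

Definition split (z1 z2 : R) x : Omega1 R := ranked (split_count z1 z2 (cnt x)).

Section measurability.
Context d (T : measurableType d).

Lemma measurable_cnt (X : T -> Omega1 R) (f : T -> R) :
  measurable_fun [set: T] X -> measurable_fun [set: T] f ->
  measurable_fun [set: T] (fun t => cnt (X t) (f t)).
Proof.
move=> mX mf; apply: ge0_emeasurable_sum => [i t _ _|i _]; first by rewrite lee_fin.
apply/measurable_EFinP; apply: measurableT_comp => //.
apply: measurable_fun_ltr => //.
exact: (measurableT_comp (measurable_omega1_fun i)).
Qed.

Lemma measurable_ind (f g : T -> R) : measurable_fun [set: T] f -> measurable_fun [set: T] g ->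
  measurable_fun [set: T] (fun t => ind (f t) (g t)).
Proof.
move=> mf mg; apply/measurable_EFinP; apply: measurableT_comp => //.
exact: measurable_fun_ltr.
Qed.

Lemma measurable_merge_count (N : T -> R -> \bar R) (f g a : T -> R) :
  measurable_fun [set: T] (fun t => N t (a t)) ->
  measurable_fun [set: T] a ->
  measurable_fun [set: T] f -> measurable_fun [set: T] g ->
  measurable_fun [set: T] (fun t => merge_count (f t) (g t) (N t) (a t)).
Proof.
move=> mN ma mf mg; apply: emeasurable_funD; last first.
  by apply: measurable_ind => //; exact: measurable_funD.
apply: emeasurable_funB; last exact: measurable_ind.
by apply: emeasurable_funB => //; exact: measurable_ind.
Qed.

Lemma measurable_split_count (N : T -> R -> \bar R) (f g a : T -> R) :
  measurable_fun [set: T] (fun t => N t (a t)) ->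
  measurable_fun [set: T] a ->
  measurable_fun [set: T] f -> measurable_fun [set: T] g ->
  measurable_fun [set: T] (fun t => split_count (f t) (g t) (N t) (a t)).
Proof.
move=> mN ma mf mg; apply: emeasurable_funD; last exact: measurable_ind.
apply: emeasurable_funD; last exact: measurable_ind.
apply: emeasurable_funB => //.
by apply: measurable_ind => //; exact: measurable_funD.
Qed.

Lemma measurable_merge (X : T -> Omega1 R) (f g : T -> R) :
  measurable_fun [set: T] X -> measurable_fun [set: T] f -> measurable_fun [set: T] g ->
  measurable_fun [set: T] (fun t => merge (f t) (g t) (X t)).
Proof.
move=> mX mf mg; apply: measurable_ranked => q q0.
by apply: measurable_merge_count => //; apply: measurable_cnt.
Qed.

Lemma measurable_split (X : T -> Omega1 R) (f g : T -> R) :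
  measurable_fun [set: T] X -> measurable_fun [set: T] f -> measurable_fun [set: T] g ->
  measurable_fun [set: T] (fun t => split (f t) (g t) (X t)).
Proof.
move=> mX mf mg; apply: measurable_ranked => q q0.
by apply: measurable_split_count => //; apply: measurable_cnt.
Qed.

End measurability.

Definition merge_part Phi x : \bar R :=
  pair_sum x (fun i j => (K (x i, x j) * Phi (merge (x i) (x j) x))%:E).

Definition split_part Phi x : \bar R :=
  point_sum x (fun i => (x i)%:E * int01 (fun u =>
    F (u * x i, (1 - u) * x i) * Phi (split (u * x i) ((1 - u) * x i) x))%R)%E.

Lemma merge_part_ge0 Phi x : (forall y, 0 <= Phi y) -> (0 <= merge_part Phi x)%E.
Proof.
move=> P0; apply: nneseries_ge0 => i _ _; apply: nneseries_ge0 => j _ _.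
by rewrite lee_fin mulr_ge0.
Qed.

Lemma split_part_ge0 Phi x : (forall y, 0 <= Phi y) -> (0 <= split_part Phi x)%E.
Proof.
move=> P0; apply: nneseries_ge0 => i _ xi; rewrite mule_ge0 ?lee_fin ?(ltW xi)//.
by apply: integral_ge0 => u _; rewrite lee_fin mulr_ge0.
Qed.

Lemma measurable_pair_sum d (T : measurableType d) (X : T -> Omega1 R)
    (f : T -> nat -> nat -> \bar R) : measurable_fun [set: T] X ->
  (forall t i j, (0 <= f t i j)%E) ->
  (forall i j, measurable_fun [set: T] (fun t => f t i j)) ->
  measurable_fun [set: T] (fun t => pair_sum (X t) (f t)).
Proof.
move=> mX f0 mf; apply: ge0_emeasurable_sum => [i t _ _|i _]; first exact: nneseries_ge0.
under eq_fun do rewrite eseries_mkcond.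
apply: ge0_emeasurable_sum => [j t _ _|j _]; first by case: ifP.
apply: measurable_fun_ifT => //; apply: measurable_and => //.
have mi k := measurableT_comp (measurable_omega1_fun k) mX.
by apply: measurable_fun_ltr => //; apply: measurable_funM; exact: mi.
Qed.

Lemma measurable_point_sum d (T : measurableType d) (X : T -> Omega1 R)
    (f : T -> nat -> \bar R) : measurable_fun [set: T] X ->
  (forall t i, 0 < X t i -> (0 <= f t i)%E) ->
  (forall i, measurable_fun [set: T] (fun t => f t i)) ->
  measurable_fun [set: T] (fun t => point_sum (X t) (f t)).
Proof.
move=> mX f0 mf; under eq_fun do rewrite /point_sum eseries_mkcond.
apply: ge0_emeasurable_sum => [i t _ _|i _]; first by case: ifP => //; exact: f0.
apply: measurable_fun_ifT => //; apply: measurable_fun_ltr => //.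
exact: (measurableT_comp (measurable_omega1_fun i) mX).
Qed.

Lemma measurable_int01 d (T : measurableType d) (f : T * R -> R) :
  (forall z, 0 <= f z) -> measurable_fun [set: T * R] f ->
  measurable_fun [set: T] (fun t => int01 (fun u => f (t, u))).
Proof.
move=> f0 mf.
pose g (z : T * R) : \bar R := (\1_(`]0, 1[%classic : set R) z.2 * f z)%:E.
rewrite (_ : (fun t => _) = (fun t => \int[lebesgue_measure]_u g (t, u))%E).
  apply: (@measurable_fun_fubini_tonelli_F _ _ _ _ _ lebesgue_measure g) => //.
    apply/measurable_EFinP; apply: measurable_funM => //.
    by apply: measurableT_comp => //; exact: measurable_indic.
  by move=> z; rewrite /g lee_fin mulr_ge0.
apply/funext => t; rewrite /int01 integral_mkcond; apply: eq_integral => u _.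
by rewrite patchE /g indicE/=; case: ifP => _; rewrite ?mul1r ?mul0r.
Qed.

Lemma measurable_merge_part Phi : measurable_fun [set: Omega1 R] Phi ->
  (forall x, 0 <= Phi x) -> measurable_fun [set: Omega1 R] (merge_part Phi).
Proof.
move=> mP P0; apply: (measurable_pair_sum (X := id)) => //.
  by move=> x i j; rewrite lee_fin mulr_ge0.
move=> i j; apply/measurable_EFinP; apply: measurable_funM.
  apply: measurableT_comp => //.
  by apply: measurable_fun_pair; exact: measurable_omega1_fun.
apply: measurableT_comp => //.
by apply: measurable_merge => //; exact: measurable_omega1_fun.
Qed.

Lemma measurable_split_part Phi : measurable_fun [set: Omega1 R] Phi ->
  (forall x, 0 <= Phi x) -> measurable_fun [set: Omega1 R] (split_part Phi).
Proof.
move=> mP P0; apply: (measurable_point_sum (X := id)) => //.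
  move=> x i xi; apply: mule_ge0; first by rewrite lee_fin ltW.
  by apply: integral_ge0 => u _; rewrite lee_fin mulr_ge0.
move=> i; apply: emeasurable_funM.
  by apply/measurable_EFinP; exact: measurable_omega1_fun.
pose f (z : Omega1 R * R) := F (z.2 * z.1 i, (1 - z.2) * z.1 i) *
  Phi (split (z.2 * z.1 i) ((1 - z.2) * z.1 i) z.1).
have m1 : measurable_fun [set: Omega1 R * R] (fun z : Omega1 R * R => (z.1 : Omega1 R) i).
  exact: (measurableT_comp (measurable_omega1_fun i)).
have mu : measurable_fun [set: Omega1 R * R] (fun z : Omega1 R * R => z.2 * (z.1 : Omega1 R) i) by exact: measurable_funM.
have mv : measurable_fun [set: Omega1 R * R] (fun z : Omega1 R * R => (1 - z.2) * (z.1 : Omega1 R) i).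
  by apply: measurable_funM => //; exact: measurable_funB.
apply: (@measurable_int01 _ _ f) => [z|]; first by rewrite mulr_ge0.
apply: measurable_funM; first by apply: measurableT_comp => //; exact: measurable_fun_pair.
by apply: measurableT_comp => //; exact: measurable_split.
Qed.

(** By linearity, a constant added to the second argument contributes a multiple of the integral of
    the first one. *)
Lemma pairing_shift (nu : probability (Omega1 R) R) (U V Phi Psi : Omega1 R -> R) (r : R) :
  bounded_borel U -> bounded_borel V -> bounded_borel Phi -> bounded_borel Psi ->
  pairing nu U (cst 1) = 0%E -> pairing nu V (cst 1) = 0%E ->
  pairing nu U (fun x => Phi x + r * (cst 1 : Omega1 R -> R) x) =
  pairing nu V (fun x => Psi x + r * (cst 1 : Omega1 R -> R) x) ->
  pairing nu U Phi = pairing nu V Psi.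
Proof.
move=> bU bV bP bQ U0 V0.
have b1 : bounded_borel (cst 1 : Omega1 R -> R) by split => //; exists 1 => x; rewrite normr1.
by rewrite !pairingDZ// U0 V0 mule0 !adde0.
Qed.

Section reversibility.
Context (C D : R) (nu : probability (Omega1 R) R).
Hypothesis K_bounded :
  forall x, (pair_sum x (fun i j => (K (x i, x j))%:E) <= C%:E)%E.
Hypothesis F_bounded : forall x, (point_sum x (fun i =>
  (x i)%:E * int01 (fun u => F (u * x i, (1 - u) * x i)%R)) <= D%:E)%E.

Lemma pair_sum_ge0 x (f : nat -> nat -> \bar R) : (forall i j, 0 <= f i j)%E ->
  (0 <= pair_sum x f)%E.
Proof. by move=> f0; apply: nneseries_ge0 => i _ _; exact: nneseries_ge0. Qed.

Lemma le_pair_sum x (f g : nat -> nat -> \bar R) : (forall i j, 0 <= f i j)%E ->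
  (forall i j, f i j <= g i j)%E -> (pair_sum x f <= pair_sum x g)%E.
Proof.
move=> f0 fg; apply: lee_nneseries => [i _ _|i _]; first exact: nneseries_ge0.
by apply: lee_nneseries => [j _ _|j _].
Qed.

Lemma pair_sumZ x (f : nat -> nat -> \bar R) (r : R) : (forall i j, 0 <= f i j)%E ->
  (pair_sum x (fun i j => r%:E * f i j) = r%:E * pair_sum x f)%E.
Proof.
move=> f0; rewrite /pair_sum -nneseriesZl; last by move=> i _; exact: nneseries_ge0.
by apply: eq_eseriesr => i _; rewrite nneseriesZl.
Qed.

Lemma pair_sumB x (f g : nat -> nat -> \bar R) :
  (forall i j, 0 <= f i j)%E -> (forall i j, 0 <= g i j)%E ->
  (pair_sum x f < +oo)%E -> (pair_sum x g < +oo)%E ->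
  (pair_sum x (fun i j => f i j - g i j) = pair_sum x f - pair_sum x g)%E.
Proof.
move=> f0 g0 foo goo.
have fin (h : nat -> nat -> \bar R) i : (forall i j, 0 <= h i j)%E -> (pair_sum x h < +oo)%E ->
    (\sum_(j <oo | (j != i) && (0 < x i * x j)%R) h i j < +oo)%E.
  move=> h0; apply: le_lt_trans; rewrite /pair_sum [leRHS](@nneseriesD1 _ _ i)//; last first.
    by move=> k _; exact: nneseries_ge0.
  by rewrite leeDl// nneseries_ge0// => k _ _; exact: nneseries_ge0.
rewrite /pair_sum -nneseriesB//; [|by move=> i _; exact: nneseries_ge0..].
by apply: eq_eseriesr => i _; rewrite nneseriesB//; exact: fin.
Qed.

Let K0' x i j : (0 <= (K (x i, x j))%:E)%E. Proof. by rewrite lee_fin. Qed.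

Lemma merge_part_bounded Phi M x : 0 <= M -> (forall y, 0 <= Phi y <= M) ->
  (0 <= merge_part Phi x <= (M * C)%:E)%E.
Proof.
move=> M0 PM; apply/andP; split.
  apply: pair_sum_ge0 => i j; rewrite lee_fin mulr_ge0//.
  by have /andP[] := PM (merge (x i) (x j) x).
apply: (@le_trans _ _ (pair_sum x (fun i j => M%:E * (K (x i, x j))%:E)))%E.
  apply: le_pair_sum => i j; have /andP[P0 PleM] := PM (merge (x i) (x j) x).
    by rewrite lee_fin mulr_ge0.
  by rewrite -EFinM lee_fin mulrC ler_wpM2r.
by rewrite pair_sumZ// EFinM lee_wpmul2l// lee_fin.
Qed.

(** The series of differences separates into gain and loss because both are nonnegative series with
    a finite sum; this is where [Mij] is replaced by [merge]. *)
Lemma merge_part_generator Phi M x : 0 <= M -> (forall y, 0 <= Phi y <= M) ->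
  fine (pair_sum x (fun i j => (K (x i, x j) * (Phi (Mij i j x) - Phi x))%:E)) =
  fine (merge_part Phi x) - fine (merge_part (cst 1) x) * Phi x.
Proof.
move=> M0 PM.
have /andP[m0 mM] := merge_part_bounded x M0 PM.
have /andP[k0 kC] : (0 <= merge_part (cst 1%R) x <= (1 * C)%:E)%E.
  by apply: merge_part_bounded => // y; rewrite ler01 lexx.
have kE : merge_part (cst 1) x = pair_sum x (fun i j => (K (x i, x j))%:E).
  by apply: eq_eseriesr => i _; apply: eq_eseriesr => j _; rewrite mulr1.
have /andP[P0 PleM] := PM x.
transitivity (fine (merge_part Phi x - (Phi x)%:E * merge_part (cst 1%R) x)%E).
  rewrite kE -pair_sumZ// /merge_part -pair_sumB; first 1 last.
  - by move=> i j; rewrite lee_fin mulr_ge0//; have /andP[] := PM (merge (x i) (x j) x).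
  - by move=> i j; rewrite -EFinM lee_fin mulr_ge0.
  - by apply: le_lt_trans mM _; rewrite ltry.
  - rewrite pair_sumZ// -kE lte_mul_pinfty//.
    by apply: le_lt_trans kC _; rewrite ltry.
  congr fine; apply: eq_eseriesr => i _; apply: eq_eseriesr => j /andP[ji xij].
  have xi0 := omega1_ge0 x i; have xj0 := omega1_ge0 x j.
  have xi : 0 < x i by rewrite lt0r xi0 andbT; apply: contraTneq xij => ->; rewrite mul0r ltxx.
  have xj : 0 < x j by rewrite lt0r xj0 andbT; apply: contraTneq xij => ->; rewrite mulr0 ltxx.
  rewrite Mij_ranked//; last by rewrite eq_sym.
  by rewrite -EFinM -EFinB mulrBr [Phi x * _]mulrC.
rewrite fineB ?fineM//.
- by rewrite mulrC.
- by rewrite ge0_fin_numE//; apply: le_lt_trans kC _; rewrite ltry.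
- by rewrite ge0_fin_numE//; apply: le_lt_trans mM _; rewrite ltry.
- rewrite fin_numM// ge0_fin_numE//; apply: le_lt_trans kC _; by rewrite ltry.
Qed.

Definition split_rate x i (u : R) : R := F (u * x i, (1 - u) * x i).

Definition split_state x i (u : R) : Omega1 R := split (u * x i) ((1 - u) * x i) x.

Lemma split_rate_ge0 x i u : 0 <= split_rate x i u. Proof. exact: F0. Qed.

#[local] Hint Resolve split_rate_ge0 : core.

Section fixed_point.
Context (x : Omega1 R) (i : nat).

Let mpair : measurable_fun [set: R] (fun u => (u * x i, (1 - u) * x i)).
Proof.
exact: measurable_split_pair.
Qed.

Let msplit Phi : measurable_fun [set: Omega1 R] Phi ->
  measurable_fun [set: R] (fun u => Phi (split_state x i u)).
Proof.
move=> mP; apply: measurableT_comp => //; apply: measurable_split => //.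
  exact: measurable_funM.
by apply: measurable_funM => //; exact: measurable_funB.
Qed.

Let mFu : measurable_fun [set: R] (split_rate x i).
Proof. exact: measurableT_comp. Qed.

Lemma int01_le_bound Phi M : measurable_fun [set: Omega1 R] Phi ->
  0 <= M -> (forall y, 0 <= Phi y <= M) ->
  (0 <= int01 (fun u => split_rate x i u * Phi (split_state x i u))%R
   <= M%:E * int01 (split_rate x i))%E.
Proof.
move=> mP M0 PM; apply/andP; split.
  apply: integral_ge0 => u _; rewrite lee_fin mulr_ge0//.
  by have /andP[] := PM (split_state x i u).
rewrite /int01 -ge0_integralZl//; first 1 last.
- by apply/measurable_EFinP; exact: measurable_funTS.
- by move=> u _; rewrite lee_fin.
apply: ge0_le_integral => //.
- move=> u _; rewrite lee_fin mulr_ge0//.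
  by have /andP[] := PM (split_state x i u).
- by apply/measurable_EFinP; apply: measurable_funTS; apply: measurable_funM => //; exact: msplit.
- by apply: measurable_funeM; apply/measurable_EFinP; exact: measurable_funTS.
- move=> u _; rewrite -EFinM lee_fin mulrC ler_wpM2r//.
  by have /andP[] := PM (split_state x i u).
Qed.

(** The bound holds for the whole sum, hence for one term, and a positive weight [x i] cannot hide
    an infinite integral. *)
Lemma int01_fin : 0 < x i -> (int01 (split_rate x i) < +oo)%E.
Proof.
move=> xi; have int0 k : (0 <= int01 (split_rate x k))%E.
  by apply: integral_ge0 => u _; rewrite lee_fin.
have Fb : (point_sum x (fun k => (x k)%:E * int01 (split_rate x k)) <= D%:E)%E by exact: F_bounded.
have t0 k : (0 <= (x k)%:E * int01 (split_rate x k))%E by rewrite mule_ge0// lee_fin omega1_ge0.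
have : ((x i)%:E * int01 (split_rate x i) <= D%:E)%E.
  apply: le_trans Fb; rewrite /point_sum [leRHS](@nneseriesD1 _ _ i)//.
  by rewrite leeDl// nneseries_ge0.
case: int01 (int0 i) => [r _ _||]; rewrite ?ltry// => _.
by rewrite gt0_muley ?lte_fin.
Qed.

Lemma int01_generator Phi M : measurable_fun [set: Omega1 R] Phi ->
  0 <= M -> (forall y, 0 <= Phi y <= M) -> 0 < x i ->
  int01 (fun u => F (u * x i, (1 - u) * x i) * (Phi (Siu i u x) - Phi x))%R =
  (int01 (fun u => split_rate x i u * Phi (split_state x i u))%R -
   (Phi x)%:E * int01 (split_rate x i))%E.
Proof.
move=> mP M0 PM xi; have /andP[I0 IM] := int01_le_bound mP M0 PM.
have Ffin := int01_fin xi.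
have F00 : (0 <= int01 (split_rate x i))%E.
  by apply: integral_ge0 => u _; rewrite lee_fin.
have iF : lebesgue_measure.-integrable `]0%R, 1%R[
    (fun u => (split_rate x i u)%:E).
  apply/integrableP; split; first by apply/measurable_EFinP; exact: measurable_funTS.
  by under eq_integral do rewrite gee0_abs ?lee_fin//.
have iG : lebesgue_measure.-integrable `]0%R, 1%R[
    (fun u => (split_rate x i u * Phi (split_state x i u))%:E).
  apply/integrableP; split.
    by apply/measurable_EFinP; apply: measurable_funTS; apply: measurable_funM => //; exact: msplit.
  have E0 u : 0 <= split_rate x i u * Phi (split_state x i u).
    by rewrite mulr_ge0//; have /andP[] := PM (split_state x i u).
  under eq_integral do rewrite gee0_abs ?lee_fin//.
  by apply: le_lt_trans IM _; rewrite lte_mul_pinfty.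
rewrite /int01 -integralZl// -integralB//; last exact: integrableZl.
apply: eq_integral => u; rewrite inE/= in_itv/= => /andP[u0 u1].
rewrite Siu_ranked// -EFinD; congr EFin.
by rewrite mulrBr [X in _ = _ - X]mulrC.
Qed.

End fixed_point.

Lemma split_part_bounded Phi M x : measurable_fun [set: Omega1 R] Phi ->
  0 <= M -> (forall y, 0 <= Phi y <= M) ->
  (0 <= split_part Phi x <= (M * D)%:E)%E.
Proof.
move=> mP M0 PM; have h i := int01_le_bound x i mP M0 PM.
have F00 i : (0 <= int01 (split_rate x i))%E.
  by apply: integral_ge0 => u _; rewrite lee_fin.
have x0 i : (0 <= (x i)%:E)%E by rewrite lee_fin omega1_ge0.
apply/andP; split.
  by apply: nneseries_ge0 => i _ xi; rewrite mule_ge0//; have /andP[] := h i.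
apply: (@le_trans _ _ (point_sum x (fun i =>
    M%:E * ((x i)%:E * int01 (split_rate x i)))))%E.
  apply: lee_nneseries => [i _ _|i _]; have /andP[h0 hM] := h i.
    by rewrite mule_ge0.
  by rewrite muleCA lee_wpmul2l.
rewrite /point_sum nneseriesZl; last by move=> i _; rewrite mule_ge0.
by rewrite EFinM lee_wpmul2l//; exact: F_bounded.
Qed.

Lemma split_part_generator Phi M x : measurable_fun [set: Omega1 R] Phi ->
  0 <= M -> (forall y, 0 <= Phi y <= M) ->
  fine (point_sum x (fun i => (x i)%:E * int01 (fun u =>
     F (u * x i, (1 - u) * x i) * (Phi (Siu i u x) - Phi x))%R)%E) =
  fine (split_part Phi x) - fine (split_part (cst 1) x) * Phi x.
Proof.
move=> mP M0 PM.
have /andP[m0 mM] := split_part_bounded x mP M0 PM.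
have /andP[k0 kC] : (0 <= split_part (cst 1%R) x <= (1 * D)%:E)%E.
  by apply: split_part_bounded => // y; rewrite ler01 lexx.
have kE : split_part (cst 1) x =
    point_sum x (fun i => (x i)%:E * int01 (split_rate x i))%E.
  apply: eq_eseriesr => i _; congr (_ * _)%E.
  by apply: eq_integral => u _; rewrite mulr1.
have /andP[P0 PleM] := PM x.
have F00 i : (0 <= int01 (split_rate x i))%E.
  by apply: integral_ge0 => u _; rewrite lee_fin.
have x0 i : (0 <= (x i)%:E)%E by rewrite lee_fin omega1_ge0.
have I0 i := int01_le_bound x i mP M0 PM.
transitivity (fine (split_part Phi x - (Phi x)%:E * split_part (cst 1%R) x)%E).
  have kZ : ((Phi x)%:E * split_part (cst 1%R) x = point_sum x (fun i =>
     (Phi x)%:E * ((x i)%:E * int01 (split_rate x i))))%E.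
    by rewrite kE /point_sum nneseriesZl// => i _; rewrite mule_ge0.
  rewrite kZ /split_part /point_sum -nneseriesB; first 1 last.
  - by move=> i xi; rewrite mule_ge0//; have /andP[] := I0 i.
  - by move=> i xi; rewrite mule_ge0// ?mule_ge0.
  - by apply: le_lt_trans mM _; rewrite ltry.
  - rewrite -/(point_sum x _) -kZ lte_mul_pinfty//.
    by apply: le_lt_trans kC _; rewrite ltry.
  congr fine; apply: eq_eseriesr => i xi.
  rewrite (int01_generator mP M0 PM xi) muleBr//; first by rewrite [in RHS]muleCA.
  apply: fin_num_adde_defl; rewrite fin_numN fin_numM// ge0_fin_numE//.
  exact: int01_fin.
rewrite fineB ?fineM//.
- by rewrite mulrC.
- by rewrite ge0_fin_numE//; apply: le_lt_trans kC _; rewrite ltry.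
- by rewrite ge0_fin_numE//; apply: le_lt_trans mM _; rewrite ltry.
- by rewrite fin_numM// ge0_fin_numE//; apply: le_lt_trans kC _; rewrite ltry.
Qed.

Lemma Lsharp_nonneg Phi M x : measurable_fun [set: Omega1 R] Phi ->
  0 <= M -> (forall y, 0 <= Phi y <= M) ->
  Lsharp K F Phi x = 2^-1 * (fine (merge_part Phi x) - fine (merge_part (cst 1) x) * Phi x) +
     2^-1 * (fine (split_part Phi x) - fine (split_part (cst 1) x) * Phi x).
Proof.
move=> mP M0 PM; rewrite /Lsharp (merge_part_generator x M0 PM).
by rewrite (split_part_generator x mP M0 PM).
Qed.

Lemma Lsharp_shift Phi r : Lsharp K F (fun x => Phi x + r) = Lsharp K F Phi.
Proof.
have E y x : Phi y + r - (Phi x + r) = Phi y - Phi x by ring.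
rewrite /Lsharp; apply/funext => x; congr (_ * fine _ + _ * fine _).
  by apply: eq_eseriesr => i _; apply: eq_eseriesr => j _; rewrite E.
apply: eq_eseriesr => i _; congr (_ * _)%E.
by apply: eq_integral => u _; rewrite E.
Qed.

Lemma Lsharp1 : Lsharp K F (cst 1) = cst 0.
Proof.
apply/funext => x; rewrite /Lsharp /pair_sum /point_sum.
rewrite eseries0; last by move=> i _ _; apply: eseries0 => j _ _; rewrite subrr mulr0.
rewrite eseries0 ?mulr0 ?addr0//.
move=> i _ _; rewrite /int01 (_ : integral _ _ _ = 0%E) ?mule0//.
by apply: integral0_eq => u _; rewrite subrr mulr0.
Qed.

Definition merge_fun Phi x : R := fine (merge_part Phi x).
Definition split_fun Phi x : R := fine (split_part Phi x).

Let bounded_borel_fine (f : Omega1 R -> \bar R) r : measurable_fun [set: Omega1 R] f ->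
  (forall x, 0 <= f x <= r%:E)%E -> bounded_borel (fun x => fine (f x)).
Proof.
move=> mf fr; split; first exact: measurableT_comp.
exists r => x; have /andP[f0 fx] := fr x.
have ff : f x \is a fin_num by rewrite ge0_fin_numE//; apply: le_lt_trans fx _; rewrite ltry.
by rewrite ger0_norm ?fine_ge0// -lee_fin fineK.
Qed.

Lemma bounded_borel_merge_fun Phi M : measurable_fun [set: Omega1 R] Phi ->
  0 <= M -> (forall y, 0 <= Phi y <= M) -> bounded_borel (merge_fun Phi).
Proof.
move=> mP M0 PM; apply: (@bounded_borel_fine _ (M * C)); last first.
  by move=> x; exact: merge_part_bounded.
by apply: measurable_merge_part => // x; have /andP[] := PM x.
Qed.

Lemma bounded_borel_split_fun Phi M : measurable_fun [set: Omega1 R] Phi ->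
  0 <= M -> (forall y, 0 <= Phi y <= M) -> bounded_borel (split_fun Phi).
Proof.
move=> mP M0 PM; apply: (@bounded_borel_fine _ (M * D)); last first.
  by move=> x; exact: split_part_bounded.
by apply: measurable_split_part => // x; have /andP[] := PM x.
Qed.

Let one01 (y : Omega1 R) : 0 <= (cst 1 : Omega1 R -> R) y <= 1.
Proof. by rewrite ler01 lexx. Qed.

Let rate x : R := merge_fun (cst 1) x + 1 * split_fun (cst 1) x.

Let bb_rate : bounded_borel rate.
Proof.
have [m1 [c1 h1]] : bounded_borel (merge_fun (cst 1)) by exact: bounded_borel_merge_fun one01.
have [m2 [c2 h2]] : bounded_borel (split_fun (cst 1)) by exact: bounded_borel_split_fun one01.
split; first by apply: measurable_funD => //; exact: measurable_funM.
by exists (c1 + c2) => x; rewrite /rate mul1r; apply: le_trans (ler_normD _ _) _; exact: lerD.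
Qed.

Let LsharpE Phi M : measurable_fun [set: Omega1 R] Phi ->
  0 <= M -> (forall y, 0 <= Phi y <= M) ->
  Lsharp K F Phi = (fun x => - (2^-1 * (rate x * Phi x)) + 2^-1 * merge_fun Phi x + 2^-1 * split_fun Phi x).
Proof.
move=> mP M0 PM; apply/funext => x; rewrite (Lsharp_nonneg x mP M0 PM).
by rewrite /rate /merge_fun /split_fun; ring.
Qed.

(** Adding M brings [Phi] into [0, 2M] and leaves the operator unchanged. Gain and loss of each kind
    lie between 0 and 2MC, respectively 2MD, and the factors 1/2 of the generator absorb the 2. *)
Lemma Lsharp_bounded Phi M : bounded_by M Phi -> bounded_by ((C + D) * M) (Lsharp K F Phi).
Proof.
move=> [mP PM]; rewrite -(Lsharp_shift _ M).
have M0 : 0 <= M by apply: le_trans (PM (omega1_unit R)).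
have mP' : measurable_fun [set: Omega1 R] (fun x => Phi x + M) by exact: measurable_funD.
have PM' y : 0 <= Phi y + M <= 2 * M.
  by have := PM y; rewrite ler_norml => /andP[h1 h2]; apply/andP; split; lra.
have M20 : 0 <= 2 * M by rewrite mulr_ge0.
split.
  rewrite (LsharpE mP' M20 PM').
  have [m1 _] := bounded_borel_merge_fun mP' M20 PM'.
  have [m2 _] := bounded_borel_split_fun mP' M20 PM'.
  have [m3 _] := bb_rate.
  apply: measurable_funD; last exact: measurable_funM.
  apply: measurable_funD; last exact: measurable_funM.
  by apply: measurableT_comp => //; apply: measurable_funM => //; exact: measurable_funM.
move=> x; rewrite (Lsharp_nonneg x mP' M20 PM').
have bnd (f : \bar R) r : (0 <= f <= r%:E)%E -> 0 <= fine f <= r.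
  move=> /andP[f0 fr].
  have ff : f \is a fin_num by rewrite ge0_fin_numE//; apply: le_lt_trans fr _; rewrite ltry.
  by rewrite fine_ge0//= -lee_fin fineK.
have /andP[a0 a1] := bnd _ _ (merge_part_bounded x M20 PM').
have /andP[b0 b1] := bnd _ _ (merge_part_bounded x ler01 one01).
have /andP[c0 c1] := bnd _ _ (split_part_bounded x mP' M20 PM').
have /andP[d0 d1] := bnd _ _ (split_part_bounded x (measurable_cst _) ler01 one01).
have /andP[p0 p1] := PM' x.
have e1 : fine (merge_part (cst 1) x) * (Phi x + M) <= 2 * M * C.
  by rewrite [leRHS]mulrC ler_pM// -[C]mul1r.
have e2 : fine (split_part (cst 1) x) * (Phi x + M) <= 2 * M * D.
  by rewrite [leRHS]mulrC ler_pM// -[D]mul1r.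
have e3 : 0 <= fine (merge_part (cst 1) x) * (Phi x + M) by rewrite mulr_ge0.
have e4 : 0 <= fine (split_part (cst 1) x) * (Phi x + M) by rewrite mulr_ge0.
have -> : (C + D) * M = 2^-1 * (2 * M * C) + 2^-1 * (2 * M * D) by field.
by apply: norm_half_diff; apply/andP; split.
Qed.

Hypothesis detailed_balance : forall Phi Psi M,
  measurable_fun [set: Omega1 R] Phi -> measurable_fun [set: Omega1 R] Psi ->
  (forall y, 0 <= Phi y <= M) -> (forall y, 0 <= Psi y <= M) ->
  (\int[nu]_x ((Phi x)%:E * merge_part Psi x) = \int[nu]_x ((Psi x)%:E * split_part Phi x))%E.

(** The balance is used twice, with the roles of the functions exchanged: each merging gain on one
    side is a splitting gain on the other. The loss terms are multiplications by the total rate and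
    are symmetric by themselves. *)
Let sym_nonneg Phi Psi M : measurable_fun [set: Omega1 R] Phi -> measurable_fun [set: Omega1 R] Psi ->
  0 <= M -> (forall y, 0 <= Phi y <= M) -> (forall y, 0 <= Psi y <= M) ->
  pairing nu Phi (Lsharp K F Psi) = pairing nu (Lsharp K F Phi) Psi.
Proof.
have fin_ (f : \bar R) r : (0 <= f <= r%:E)%E -> (fine f)%:E = f.
  move=> /andP[f0 fr]; rewrite fineK// ge0_fin_numE//.
  by apply: le_lt_trans fr _; rewrite ltry.
move=> mP mQ M0 PM QM.
have db (f g : Omega1 R -> R) : measurable_fun [set: Omega1 R] f -> measurable_fun [set: Omega1 R] g ->
    (forall y, 0 <= f y <= M) -> (forall y, 0 <= g y <= M) ->
    pairing nu f (merge_fun g) = pairing nu g (split_fun f).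
  move=> mf mg fM gM; transitivity (\int[nu]_x ((f x)%:E * merge_part g x))%E.
    apply: eq_integral => x _; rewrite EFinM /merge_fun (fin_ _ (M * C))//.
    exact: merge_part_bounded.
  rewrite (detailed_balance mf mg fM gM).
  apply: eq_integral => x _; rewrite EFinM /split_fun (fin_ _ (M * D))//.
  exact: split_part_bounded.
have bbP : bounded_borel Phi.
  by split=> //; exists M => x; have /andP[p0 pM] := PM x; rewrite ger0_norm.
have bbQ : bounded_borel Psi.
  by split=> //; exists M => x; have /andP[p0 pM] := QM x; rewrite ger0_norm.
have expand (f g : Omega1 R -> R) : bounded_borel f -> bounded_borel g ->
    measurable_fun [set: Omega1 R] g -> (forall y, 0 <= g y <= M) ->
    pairing nu f (Lsharp K F g) = (pairing nu f (fun x => - (2^-1 * (rate x * g x)))%R +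
      (2^-1)%:E * pairing nu f (merge_fun g) + (2^-1)%:E * pairing nu f (split_fun g))%E.
  move=> bf bg mg gM; rewrite (LsharpE mg M0 gM).
  have bm := bounded_borel_merge_fun mg M0 gM.
  have bs := bounded_borel_split_fun mg M0 gM.
  have br : bounded_borel (fun x => - (2^-1 * (rate x * g x))).
    have [mr [c cr]] := bounded_borelM bb_rate bg; split.
      by apply: measurableT_comp => //; exact: measurable_funM.
    by exists (2^-1 * c) => x; rewrite normrN normrM ger0_norm// ler_wpM2l.
  rewrite pairingDZ//; first by rewrite pairingDZ.
  have [mr [c cr]] := br; have [mm [c' cm]] := bm; split.
    by apply: measurable_funD => //; exact: measurable_funM.
  exists (c + 2^-1 * c') => x; apply: le_trans (ler_normD _ _) _; rewrite lerD//.
  by rewrite normrM ger0_norm// ler_wpM2l.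
have E1 : pairing nu Phi (fun x => - (2^-1 * (rate x * Psi x))) =
    pairing nu Psi (fun x => - (2^-1 * (rate x * Phi x))).
  by apply: eq_integral => x _; congr EFin; ring.
rewrite (expand _ _ bbP bbQ mQ QM) [RHS]pairingC (expand _ _ bbQ bbP mP PM) E1.
rewrite (db _ _ mP mQ PM QM) (db _ _ mQ mP QM PM).
exact: addeAC.
Qed.

(* The operator kills constants, so that adding a constant reduces the symmetry to
   nonnegative functions, for which no integrability question arises. *)
Lemma Lsharp_sym Phi Psi : bounded_borel Phi -> bounded_borel Psi ->
  pairing nu Phi (Lsharp K F Psi) = pairing nu (Lsharp K F Phi) Psi.
Proof.
have H f g : bounded_borel f -> bounded_borel g -> exists M, exists f' g' : Omega1 R -> R,
  [/\ measurable_fun [set: Omega1 R] f', measurable_fun [set: Omega1 R] g', 1 <= M,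
     (forall y, 0 <= f' y <= M) & (forall y, 0 <= g' y <= M)] /\
  [/\ forall x, f' x = f x + M / 2 * 1 & forall x, g' x = g x + M / 2 * 1].
  move=> [mf [c cf]] [mg [c' cg]].
  have c0 : 0 <= c by apply: le_trans (cf (omega1_unit R)).
  have c'0 : 0 <= c' by apply: le_trans (cg (omega1_unit R)).
  (* Shifting by c + c' + 1 makes both functions nonnegative; the extra 1 gives M >= 1, so that the
     constant 1 is also an admissible function for [sym_nonneg]. *)
  exists (2 * (c + c' + 1)), (fun x => f x + (c + c' + 1)), (fun x => g x + (c + c' + 1)).
  split; last by split => x; field.
  split; [exact: measurable_funD|exact: measurable_funD|lra|move=> y..].
    by have := cf y; rewrite ler_norml => /andP[]; lra.
  by have := cg y; rewrite ler_norml => /andP[]; lra.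
have b1 : bounded_borel (cst 1 : Omega1 R -> R) by split => //; exists 1 => x; rewrite normr1.
have LE f (f' : Omega1 R -> R) r : (forall x, f' x = f x + r * 1) -> Lsharp K F f' = Lsharp K F f.
  by move=> /funext ->; exact: Lsharp_shift.
have bbL f : bounded_borel f -> bounded_borel (Lsharp K F f).
  by move=> /bounded_borelP[c bc]; apply/bounded_borelP; eexists; exact: Lsharp_bounded bc.
(* Symmetry against the constant 1, which the operator kills: the integral of [Lsharp K F f]
   vanishes. This is what removes the constants added to both functions. *)
have L0 f : bounded_borel f -> pairing nu (Lsharp K F f) (cst 1) = 0%E.
  move=> bf; have [M [f' [g' [[mf' mg' M1 fM gM] [ff gg]]]]] := H f (cst 1) bf b1.
  rewrite -(LE _ _ _ ff) -(@sym_nonneg _ _ M)// ?Lsharp1; [|exact: le_trans M1|].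
    by apply: integral0_eq => x _; rewrite mulr0.
  by move=> y; rewrite ler01.
move=> bP bQ; have [M [f' [g' [[mf' mg' M1 fM gM] [ff gg]]]]] := H Phi Psi bP bQ.
have := sym_nonneg mf' mg' (le_trans ler01 M1) fM gM.
rewrite (LE _ _ _ ff) (LE _ _ _ gg) pairingC.
have -> : f' = (fun x => Phi x + M / 2 * (cst 1 : Omega1 R -> R) x) by apply/funext => x; rewrite ff.
have -> : g' = (fun x => Psi x + M / 2 * (cst 1 : Omega1 R -> R) x) by apply/funext => x; rewrite gg.
have bLP := bbL _ bP; have bLQ := bbL _ bQ.
by move=> h; rewrite pairingC; exact: pairing_shift bLQ bLP bP bQ (L0 _ bQ) (L0 _ bP) h.
Qed.

Lemma reversible_Lsharp : reversible (Lsharp K F) nu.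
Proof.
apply: (@reversible_of_symmetric _ _ (C + D)).
- by move=> M Phi; exact: Lsharp_bounded.
- by move=> Phi Psi; exact: Lsharp_sym.
- exact: Lsharp1.
Qed.

End reversibility.

End rates.

(** * Points and Palm measures *)

Section vague_measurability.
Context (R : realType) (q : R).
Hypothesis q0 : 0 < q.

(** Continuous functions with values in [0, 1], supported in [q, n+1], rising from q with slope n
    and reaching 0 again at n+1; they increase with n to the indicator of ]q, +oo[. *)
Definition trapezoid (n : nat) (x : R) : R :=
  Num.max 0 (Num.min 1 (Num.min (n%:R * (x - q)) (n.+1%:R - x))).

Lemma trapezoid_ge0 n x : 0 <= trapezoid n x.
Proof. by rewrite /trapezoid le_max lexx. Qed.

Lemma trapezoid_le1 n x : trapezoid n x <= 1.
Proof. by rewrite /trapezoid ge_max ler01 ge_min lexx. Qed.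

Lemma trapezoid_le n x : x <= q -> trapezoid n x = 0.
Proof.
move=> xq; apply/max_idPl; rewrite !ge_min; apply/orP; right; apply/orP; left.
by rewrite mulr_ge0_le0// subr_le0.
Qed.

Lemma trapezoid_supp n x : ~ (`[q, n.+1%:R]%classic : set R) x -> trapezoid n x = 0.
Proof.
rewrite /= in_itv/= => /negP; rewrite negb_and -!ltNge => /orP[/ltW/trapezoid_le//|nx].
apply/max_idPl; rewrite !ge_min; apply/orP; right; apply/orP; right.
by rewrite subr_le0 ltW.
Qed.

Lemma trapezoid_nd x : nondecreasing_seq (trapezoid ^~ x).
Proof.
apply/nondecreasing_seqP => n; have [xq|qx] := leP x q.
  by rewrite !trapezoid_le.
rewrite /trapezoid ge_max le_max lexx/= le_max; apply/orP; right.
rewrite le_min ge_min lexx/= le_min; apply/andP; split.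
  rewrite !ge_min; apply/orP; right; apply/orP; left.
  by rewrite ler_wpM2r ?subr_ge0 ?ler_nat// ltW.
by rewrite !ge_min; apply/orP; right; apply/orP; right; rewrite lerD2r ler_nat.
Qed.

Lemma trapezoid_cvg x : (trapezoid n x)%:E @[n --> \oo] --> (\1_(`]q, +oo[%classic : set R) x)%:E.
Proof.
apply: cvg_EFin; first exact: nearW.
rewrite indicE; case: (boolP (x \in _)) => [|]; last first.
  rewrite notin_setE/= in_itv/= andbT => /negP; rewrite -leNgt => xq.
  rewrite (_ : _ \o _ = cst 0); first exact: cvg_cst.
  by apply/funext => n /=; exact: trapezoid_le.
rewrite inE/= in_itv/= andbT => qx.
apply: cvg_near_cst; near=> n => /=.
have n1 : 1 <= n%:R * (x - q).
  rewrite -ler_pdivrMr ?subr_gt0// mul1r; near: n; exact: nbhs_infty_ger.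
have n2 : 1 <= n.+1%:R - x.
  by rewrite -natr1 addrAC lerDr subr_ge0; near: n; exact: nbhs_infty_ger.
rewrite /trapezoid.
have -> : Num.min 1 (Num.min (n%:R * (x - q)) (n.+1%:R - x)) = 1.
  by apply/min_idPl; rewrite le_min n1 n2.
by apply/max_idPr.
Unshelve. all: by end_near. Qed.

Lemma continuous_trapezoid n : continuous (trapezoid n).
Proof.
move=> x; pose f (y : R) : R^o := n%:R * (y - q); pose g (y : R) : R^o := n.+1%:R - y.
rewrite (_ : trapezoid n = (cst 0 : R -> R^o) \max ((cst 1 : R -> R^o) \min (f \min g)))//.
have cf : {for x, continuous f} by apply: cvgMr; apply: cvgB => //; exact: cvg_cst.
have cg : {for x, continuous g} by apply: cvgB => //; exact: cvg_cst.
apply: continuous_max; first exact: cvg_cst.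
by apply: continuous_min; [exact: cvg_cst|exact: continuous_min].
Qed.

Lemma trapezoid_test n : continuous (trapezoid n) /\
  exists K : set R, [/\ compact K, K `<=` `]0, +oo[ & forall x, ~ K x -> trapezoid n x = 0].
Proof.
split; first exact: continuous_trapezoid.
exists `[q, n.+1%:R]%classic; split; first exact: segment_compact.
  by move=> x /=; rewrite !in_itv/= andbT => /andP[+ _]; apply: lt_le_trans.
exact: trapezoid_supp.
Qed.

Definition trapezoid_fun n : test_fun R := exist _ (trapezoid n) (trapezoid_test n).

(** The support is a compact subset of the open half-line, of finite mass. Finiteness matters
    because [vague_eval] takes a real-valued integral, which reads an infinite one as 0. *)
Lemma trapezoid_integral_fin (eta : Nspace R) n :
  (\int[nmeas eta]_x (trapezoid n x)%:E < +oo)%E.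
Proof.
have [_ etaK _] : integer_radon (nmeas eta) by exact: (set_valP eta).
have mt : measurable_fun [set: R] (trapezoid n).
  by apply: continuous_measurable_fun; exact: continuous_trapezoid.
apply: (@le_lt_trans _ _ (\int[nmeas eta]_x (\1_(`[q, n.+1%:R]%classic : set R) x)%:E)%E).
  apply: ge0_le_integral => //.
  - by move=> x _; rewrite lee_fin trapezoid_ge0.
  - exact/measurable_EFinP.
  - by apply/measurable_EFinP; exact: measurable_indic.
  - move=> x _; rewrite lee_fin indicE; case: (boolP (x \in _)) => [_|]; first exact: trapezoid_le1.
    by rewrite notin_setE => /trapezoid_supp ->.
rewrite integral_indic// setIT; apply: etaK; first exact: segment_compact.
by move=> x /=; rewrite !in_itv/= andbT => /andP[+ _]; apply: lt_le_trans.
Qed.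

(** Evaluation at a test function is vaguely continuous, and the mass of the ray is the monotone
    limit of the evaluations at the trapezoids. Since states are handled through their counts above
    positive levels, rays are the only sets for which this is required. *)
Lemma measurable_nmeas_ray : measurable_fun [set: Nspace R] (fun eta => nmeas eta `]q, +oo[%classic).
Proof.
pose h n (eta : Nspace R) : \bar R := (vague_eval eta (trapezoid_fun n))%:E.
have hE n eta : h n eta = (\int[nmeas eta]_x (trapezoid n x)%:E)%E.
  rewrite /h /vague_eval /Rintegral/= fineK// ge0_fin_numE ?trapezoid_integral_fin//.
  by apply: integral_ge0 => x _; rewrite lee_fin trapezoid_ge0.
apply: (@emeasurable_fun_cvg _ _ _ _ h) => [n|eta _]; last first.
  under eq_fun do rewrite hE.
  rewrite -[X in nmeas eta X]setIT -integral_indic//.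
  have := @cvg_monotone_convergence _ _ _ (nmeas eta) setT measurableT
    (fun n x => (trapezoid n x)%:E).
  move=> /(_ _ _ _)/=; set L := (X in _ --> X) => H.
  have -> : (\int[nmeas eta]_x (\1_`]q, +oo[ x)%:E)%E = L.
    apply: eq_integral => x _; apply/esym/cvg_lim => //; exact: trapezoid_cvg.
  apply: H.
  - by move=> n; apply/measurable_EFinP; apply: continuous_measurable_fun; exact: continuous_trapezoid.
  - by move=> n x _; rewrite lee_fin trapezoid_ge0.
  - by move=> x _ n m nm; rewrite lee_fin; exact: trapezoid_nd.
apply/measurable_EFinP.
have ct : continuous (fun eta : Nspace R => vague_eval eta (trapezoid_fun n)).
  move=> eta; apply: (@continuous_comp _ _ _ (@vague_eval R : Nspace R -> {ptws test_fun R -> R})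
    (fun y : {ptws test_fun R -> R} => y (trapezoid_fun n))).
    exact: initial_continuous.
  exact: (@proj_continuous {classic test_fun R} (fun=> R) (trapezoid_fun n)).
apply: (measurability _ (RGenOInfty.measurableE R)) => _ [_ [a ->] <-].
rewrite setTI; apply: sub_sigma_algebra.
by move/continuousP : ct; apply; exact: interval_open.
Qed.

End vague_measurability.

(** * Densities and changes of variables *)

Section density.
Import HBNNSimple.
Context d (T : measurableType d) (R : realType) (mu rho : {measure set T -> \bar R}).
Context (E : set T) (h : T -> R).
Hypotheses (mE : measurable E) (mh : measurable_fun E h) (h0 : forall x, E x -> 0 <= h x).
Hypothesis rhoE : forall A, measurable A -> A `<=` E -> rho A = (\int[mu]_(x in A) (h x)%:E)%E.

(** Passage from sets to functions by increasing simple functions. The density is assumed on subsets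
    of [E] only, as correlation functions are given on the half-line or the quadrant. *)
Lemma ge0_integral_density (f : T -> \bar R) : measurable_fun E f ->
  (forall x, E x -> (0 <= f x)%E) ->
  (\int[rho]_(x in E) f x = \int[mu]_(x in E) (f x * (h x)%:E))%E.
Proof.
move=> mf f0.
pose g := nnsfun_approx mE mf.
have mhE : measurable_fun E (EFin \o h) by exact/measurable_EFinP.
have -> : (\int[rho]_(x in E) f x = lim (\int[rho]_(x in E) (EFin \o g n) x @[n --> \oo]))%E.
  have fE x : E x -> f x = lim ((EFin \o g n) x @[n --> \oo]).
    by move=> Ex; apply/esym/cvg_lim => //; exact: cvg_nnsfun_approx.
  under eq_integral => x /[!inE] /fE -> //.
  apply: monotone_convergence => //.
  - by move=> n; apply/measurable_EFinP; exact: (measurable_funS measurableT).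
  - by move=> n x Ex //=; rewrite lee_fin.
  - by move=> x Ex a b ab; rewrite lee_fin; exact/lefP/nd_nnsfun_approx.
have -> : (\int[mu]_(x in E) (f x * (h x)%:E) =
    lim (\int[mu]_(x in E) ((g n x)%:E * (h x)%:E) @[n --> \oo]))%E.
  have fE x : E x -> (f x * (h x)%:E = lim ((g n x)%:E * (h x)%:E @[n --> \oo]))%E.
    by move=> Ex; apply/esym/cvg_lim => //; apply: cvgeZr => //; exact: cvg_nnsfun_approx.
  under eq_integral => x /[!inE] /fE -> //.
  apply: monotone_convergence => //.
  - move=> n; apply: emeasurable_funM => //.
    by apply/measurable_EFinP; exact: (measurable_funS measurableT).
  - by move=> n x Ex //=; rewrite mule_ge0// lee_fin// h0.
  - move=> x Ex a b ab; rewrite lee_wpmul2r// ?lee_fin ?h0//.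
    exact/lefP/nd_nnsfun_approx.
congr (lim (_ @ \oo)); apply/funext => n.
have mI r : measurable (g n @^-1` [set r] `&` E) by exact: measurableI.
transitivity (\int[rho]_(x in E) (\sum_(y \in range (g n)) (y * \1_(g n @^-1` [set y]) x)%:E))%E.
  by apply: eq_integral => x _; rewrite /= fimfunE -fsumEFin.
rewrite ge0_integral_fsum//; last 2 first.
- by move=> y; apply/measurable_EFinP; apply: measurable_funM => //.
- by move=> y x _; exact: nnfun_muleindic_ge0.
transitivity (\int[mu]_(x in E) (\sum_(y \in range (g n)) (y * \1_(g n @^-1` [set y]) x)%:E * (h x)%:E))%E; last first.
  apply: eq_integral => x /[!inE] Ex; rewrite -ge0_mule_fsuml; last by move=> y; exact: nnfun_muleindic_ge0.
  by rewrite fsumEFin// -(fimfunE _ x).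
rewrite ge0_integral_fsum//; last 2 first.
- by move=> y; apply: emeasurable_funM => //; apply/measurable_EFinP; exact: measurable_funM.
- by move=> y x Ex; rewrite mule_ge0 ?lee_fin ?h0//; exact: nnfun_muleindic_ge0.
apply: eq_fsbigr => r _; rewrite integralZl_indic_nnsfun// integral_indic//=.
have [r0|r0] := ltP r 0.
  rewrite preimage_nnfun0// set0I measure0 mule0.
  by rewrite integral0_eq// => x _; rewrite indicE in_set0 mulr0 mul0e.
under eq_integral do rewrite EFinM -muleA.
rewrite ge0_integralZl//; last 2 first.
- by apply: emeasurable_funM => //; exact/measurable_EFinP.
- by move=> x Ex; rewrite mule_ge0 ?lee_fin ?h0.
congr (_ * _)%E; rewrite (rhoE (mI r) (@subIsetr _ _ _)).
rewrite setIC integral_mkcondr; apply: eq_integral => x _.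
by rewrite patchE indicE; case: (x \in _); rewrite ?mul1e ?mul0e.
Qed.

End density.

(** Applied with [phi] the identity, it bridges two measurable structures on the real line: Lebesgue
    measure lives on [measurableTypeR R], the correlation measures on [R]. *)
Lemma ge0_integral_density_comp d1 d2 (T1 : measurableType d1) (T2 : measurableType d2)
    (R : realType) (mu : {measure set T1 -> \bar R}) (rho : {measure set T2 -> \bar R})
    (phi : T1 -> T2) (E : set T2) (h : T2 -> R) (f : T2 -> \bar R) :
  measurable_fun [set: T1] phi ->
  measurable E -> measurable_fun E h -> (forall x, E x -> 0 <= h x) ->
  (forall A, measurable A -> A `<=` E ->
    rho A = (\int[mu]_(x in phi @^-1` A) (h (phi x))%:E)%E) ->
  measurable_fun E f -> (forall x, E x -> (0 <= f x)%E) ->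
  (\int[rho]_(x in E) f x = \int[mu]_(x in phi @^-1` E) (f (phi x) * (h (phi x))%:E))%E.
Proof.
move=> mphi mE mh h0 rhoE mf f0.
rewrite -(@ge0_integral_pushforward _ _ _ _ _ _ mphi mu E (fun x => f x * (h x)%:E)%E)//.
- apply: ge0_integral_density => // A mA AE.
  rewrite rhoE// (@ge0_integral_pushforward _ _ _ _ _ _ mphi mu A (fun x => (h x)%:E))//.
    by apply/measurable_EFinP; exact: measurable_funS mh.
  by move=> x; rewrite inE => /AE Ex; rewrite lee_fin h0.
- by apply: emeasurable_funM => //; exact/measurable_EFinP.
- by move=> x; rewrite inE => Ex; rewrite mule_ge0 ?f0 ?lee_fin ?h0.
Qed.

Section affine_change_of_variables.
Context (R : realType).
Local Notation leb := (@lebesgue_measure R).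

(** The image of Lebesgue measure, multiplied by a, gives half-open intervals their length, so
    uniqueness of Lebesgue measure applies. *)
Lemma lebesgue_measure_affine (a b : R) (m : {measure set (measurableTypeR R) -> \bar R}) :
  0 < a -> (forall A, m A = leb ((fun u => a * u + b)%R @^-1` A)) ->
  forall A, measurable A -> leb A = (a%:E * m A)%E.
Proof.
move=> a0 mE A mA.
apply: (@lebesgue_measure_unique R (mscale (NngNum (ltW a0)) m)) => // _ [[x y]] _ <-.
change (leb `]x, y]%classic = (a%:E * m `]x, y]%classic)%E); rewrite mE.
rewrite (_ : _ @^-1` _ = `](x - b) / a, (y - b) / a]%classic); last first.
  apply/seteqP; split => u /=; rewrite !in_itv/= ltr_pdivrMr// ler_pdivlMr// mulrC;
    by rewrite ltrBlDr lerBrDr.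
rewrite !lebesgue_measure_itv/= !lte_fin ltr_pM2r ?invr_gt0// ltrD2r.
case: ifPn => xy; last by rewrite mule0.
by rewrite -!EFinB -EFinM; congr EFin; field; rewrite gt_eqF.
Qed.

Lemma ge0_integral_affine (a b : R) (f : R -> \bar R) : 0 < a ->
  measurable_fun [set: R] f -> (forall x, 0 <= f x)%E ->
  (\int[leb]_x f x = a%:E * \int[leb]_u f (a * u + b)%R)%E.
Proof.
move=> a0 mf f0.
have mphi : measurable_fun [set: measurableTypeR R] ((fun u => a * u + b) : _ -> measurableTypeR R).
  by apply: measurable_funD => //; exact: measurable_funM.
have := @ge0_integral_pushforward _ _ _ _ _ _ mphi leb setT f measurableT mf.
rewrite preimage_setT => <-; last by move=> y _; exact: f0.
rewrite -(@ge0_integral_mscale _ _ _ _ setT measurableT (NngNum (ltW a0)))//.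
apply: eq_measure_integral => A mA _.
exact: (lebesgue_measure_affine a0).
Qed.

Lemma measurable_int01e d (U : measurableType d) (a : U * R -> \bar R) :
  measurable_fun [set: U * R] a -> (forall t, 0 <= a t)%E ->
  measurable_fun [set: U] (fun x => \int[leb]_(u in `]0%R, 1%R[) a (x, u))%E.
Proof.
move=> ma a0; pose c (t : U * R) := ((\1_(`]0%R, 1%R[%classic : set R) t.2)%:E * a t)%E.
rewrite (_ : (fun x => _) = (fun x => \int[leb]_u c (x, u))%E).
  apply: (@measurable_fun_fubini_tonelli_F _ _ _ _ _ leb c) => [|t].
    apply: emeasurable_funM => //; apply/measurable_EFinP.
    by apply: measurableT_comp => //; exact: measurable_indic.
  by rewrite /c mule_ge0// lee_fin.
apply/funext => x; rewrite integral_mkcond; apply: eq_integral => u _.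
by rewrite patchE /c/= indicE; case: (u \in _); rewrite ?mul1e ?mul0e.
Qed.

Lemma tonelli_int01 d (U : measurableType d) (m : {sigma_finite_measure set U -> \bar R})
    (a : U * R -> \bar R) : measurable_fun [set: U * R] a -> (forall t, 0 <= a t)%E ->
  (\int[m]_x \int[leb]_(u in `]0%R, 1%R[) a (x, u) =
   \int[leb]_(u in `]0%R, 1%R[) \int[m]_x a (x, u))%E.
Proof.
move=> ma a0; pose c (t : U * R) := ((\1_(`]0%R, 1%R[%classic : set R) t.2)%:E * a t)%E.
have cE (f : R -> \bar R) : (\int[leb]_(u in `]0%R, 1%R[) f u =
    \int[leb]_u ((\1_(`]0%R, 1%R[%classic : set R) u)%:E * f u))%E.
  rewrite integral_mkcond; apply: eq_integral => u _.
  by rewrite patchE indicE; case: (u \in _); rewrite ?mul1e ?mul0e.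
transitivity (\int[m]_x \int[leb]_u c (x, u))%E.
  by apply: eq_integral => x _; rewrite cE.
rewrite fubini_tonelli//; last 2 first.
- apply: emeasurable_funM => //; apply/measurable_EFinP.
  by apply: measurableT_comp => //; exact: measurable_indic.
- by move=> t; rewrite mule_ge0// lee_fin.
rewrite [RHS]cE; apply: eq_integral => u _; rewrite /c/= ge0_integralZl//.
exact: measurableT_comp.
Qed.

(** Two affine substitutions in one variable replace a planar one: s - x for the second coordinate
    at fixed x, then, after Tonelli, x = s u at fixed s, which produces the factor s. *)
Lemma integral_polar (h : R * R -> \bar R) : measurable_fun [set: R * R] h ->
  (forall z, 0 <= h z)%E ->
  (\int[leb]_(s in @halfline R) (s%:E * \int[leb]_(u in `]0%R, 1%R[) h (u * s, (1 - u) * s)%R) =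
   \int[leb \x leb]_(z in @quadrant R) h z)%E.
Proof.
move=> mh h0.
have mq : measurable (@quadrant R) by apply: measurableX; exact: measurable_itv.
pose k := h \_ (@quadrant R).
have mk : measurable_fun [set: R * R] k.
  by apply/(measurable_restrictT _ _).1 => //; exact: measurable_funTS.
have k0 z : (0 <= k z)%E by rewrite /k patchE; case: ifP.
rewrite [RHS]integral_mkcond -/k fubini_tonelli1// /fubini_F.
(* The integrand in the coordinates (first point, sum), extended by zero: positivity of both points
   becomes 0 < x < s, that is 0 < u < 1. *)
pose k' (z : R * R) := k (z.1, z.2 - z.1).
have mk' : measurable_fun [set: R * R] k'.
  apply: measurableT_comp => //; apply: measurable_fun_pair => //.
  exact: measurable_funB.
transitivity (\int[leb]_x \int[leb]_s k' (x, s))%E; last first.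
  apply: eq_integral => x _.
  rewrite (@ge0_integral_affine 1 (- x) (fun y => k (x, y)))//.
    by rewrite mul1e; apply: eq_integral => s _; rewrite mul1r.
  exact: measurableT_comp.
rewrite fubini_tonelli//; last by move=> z; exact: k0.
rewrite integral_mkcond; apply: eq_integral => s _.
rewrite patchE; case: ifPn => [|]; last first.
  rewrite notin_setE /halfline/= in_itv/= andbT => /negP; rewrite -leNgt => s0.
  apply/esym/integral0_eq => x _; rewrite /k' /k patchE ifF//.
  apply/negbTE; rewrite notin_setE /quadrant /halfline/= !in_itv/= !andbT => -[x0].
  by rewrite subr_gt0 => xs; have := lt_trans x0 xs; rewrite ltNge s0.
rewrite inE /halfline/= in_itv/= andbT => s0.
rewrite (@ge0_integral_affine s 0 (fun x => k' (x, s)))//; first last.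
- by move=> x; exact: k0.
- by apply: measurableT_comp => //; exact: measurable_fun_pair.
congr (_ * _)%E; rewrite integral_mkcond; apply: eq_integral => u _.
rewrite !patchE /k' /k patchE /= addr0 mulrBl mul1r [u * s]mulrC.
suff -> : ((s * u, s - s * u) \in @quadrant R) = (u \in `]0, 1[%classic) by [].
apply/idP/idP; rewrite !inE /quadrant /halfline/= !in_itv/= !andbT.
  by rewrite pmulr_rgt0// subr_gt0 gtr_pMr// => -[-> ->].
by move=> /andP[u0 u1]; split; [exact: mulr_gt0|rewrite subr_gt0 gtr_pMr].
Qed.

End affine_change_of_variables.

(** * Points, counts and the effect of adding atoms *)

Section points.
Context (R : realType).
Implicit Types (x : Omega1 R) (eta : Nspace R).

Lemma measurable_halfline : measurable (@halfline R).
Proof. exact: measurable_itv. Qed.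

Lemma measurable_quadrant : measurable (@quadrant R).
Proof. by apply: measurableX; exact: measurable_halfline. Qed.

Lemma halflineE (z : R) : halfline z = (0 < z) :> Prop.
Proof. by rewrite /halfline/= in_itv/= andbT. Qed.

Lemma quadrantE (z : R * R) : quadrant z = (0 < z.1 /\ 0 < z.2) :> Prop.
Proof. by rewrite /quadrant /= !halflineE. Qed.

Lemma integral_pos_dirac (a : R) (f : R -> \bar R) : measurable_fun (@halfline R) f ->
  (\int[pos_dirac a]_(z in @halfline R) f z = if (0 < a)%R then f a else 0)%E.
Proof.
move=> mf; rewrite /pos_dirac; case: ifPn => a0; last by rewrite integral_measure_zero.
rewrite integral_dirac//; last exact: measurable_halfline.
by rewrite diracE mem_set ?mul1e// halflineE.
Qed.

Lemma integral_point_measure (y : nat -> R) (f : R -> \bar R) : measurable_fun (@halfline R) f ->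
  (forall z, 0 < z -> (0 <= f z)%E) ->
  (\int[point_measure y]_(z in @halfline R) f z = \sum_(i <oo | (0 < y i)%R) f (y i))%E.
Proof.
move=> mf f0; rewrite ge0_integral_measure_series//; last 2 first.
- exact: measurable_halfline.
- by move=> z; rewrite halflineE; exact: f0.
by rewrite [RHS]eseries_mkcond; apply: eq_eseriesr => i _; rewrite integral_pos_dirac.
Qed.

Lemma integral_Xi x (f : R -> \bar R) : measurable_fun (@halfline R) f ->
  (forall z, 0 < z -> (0 <= f z)%E) ->
  (\int[nmeas (Xi x)]_(z in @halfline R) f z = point_sum x (fun i => f (x i)))%E.
Proof. exact: integral_point_measure. Qed.

Lemma integral_pos_dirac2 (a : R * R) (f : R * R -> \bar R) : measurable_fun (@quadrant R) f ->
  (\int[pos_dirac2 a]_(z in @quadrant R) f z = if (0 < a.1)%R && (0 < a.2)%R then f a else 0)%E.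
Proof.
move=> mf; rewrite /pos_dirac2; case: ifPn => a0; last by rewrite integral_measure_zero.
rewrite integral_dirac//; last exact: measurable_quadrant.
rewrite diracE mem_set ?mul1e// quadrantE; exact/andP.
Qed.

Lemma integral_point_measure2 x (f : R * R -> \bar R) : measurable_fun (@quadrant R) f ->
  (forall z, quadrant z -> (0 <= f z)%E) ->
  (\int[point_measure2 x]_(z in @quadrant R) f z = pair_sum x (fun i j => f (x i, x j)))%E.
Proof.
move=> mf f0; have mq := measurable_quadrant.
rewrite ge0_integral_measure_series//; apply: eq_eseriesr => i _.
rewrite ge0_integral_measure_series// [RHS]eseries_mkcond.
apply: eq_eseriesr => j _.
case: ifPn => ji /=; last by rewrite integral_measure_zero.
rewrite integral_pos_dirac2//=; congr (if _ then _ else _).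
have := omega1_ge0 x i; have := omega1_ge0 x j.
rewrite !le_eqVlt => /predU1P[<-|xj] /predU1P[<-|xi]; rewrite ?mul0r ?mulr0 ?ltxx ?andbF//.
by rewrite xi xj mulr_gt0.
Qed.

Definition ray_count eta (a : R) : \bar R := nmeas eta `]a, +oo[%classic.

Lemma ray_count_Xi x (a : R) : 0 <= a -> ray_count (Xi x) a = cnt x a.
Proof.
move=> a0; rewrite /ray_count /nmeas /= point_measureE.
apply: eq_eseriesr => i _; congr (_%:R%:E).
rewrite (_ : (x i \in `]a, +oo[%classic) = (a < x i)); last first.
  by apply/idP/idP; rewrite inE/= in_itv/= andbT.
by congr nat_of_bool; apply/andP/idP => [[]//|ax]; split=> //; exact: le_lt_trans ax.
Qed.

Lemma ray_count_add_point eta (z a : R) : 0 < z ->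
  ray_count (add_point eta z) a = (ray_count eta a + ind a z)%E.
Proof.
move=> z0.
have -> : (ray_count (add_point eta z) a = ray_count eta a + pos_dirac z `]a, +oo[%classic)%E.
  exact: measure_addE.
congr (_ + _)%E.
rewrite pos_diracE z0/= /ind; congr (_%:R%:E); congr nat_of_bool.
by apply/idP/idP; rewrite inE/= in_itv/= andbT.
Qed.

(** The state is a measurable function of its point measure, so functions of the state are
    admissible integrands in the Palm formulas. *)
Lemma ranked_Xi x : ranked (ray_count (Xi x)) = x.
Proof.
rewrite -[RHS]ranked_cnt; apply: eq_ranked => q q0.
by rewrite ray_count_Xi// ler0q ltW.
Qed.

Lemma merge_count_Xi x (z1 z2 : R) :
  ranked (merge_count z1 z2 (ray_count (Xi x))) = merge z1 z2 x.
Proof.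
apply: eq_ranked => q q0; rewrite /merge_count ray_count_Xi// ler0q; exact: ltW.
Qed.

Lemma split_count_Xi x (z1 z2 : R) :
  ranked (split_count z1 z2 (ray_count (Xi x))) = split z1 z2 x.
Proof.
apply: eq_ranked => q q0; rewrite /split_count ray_count_Xi// ler0q; exact: ltW.
Qed.

Definition add2_count (z1 z2 : R) (N : R -> \bar R) (a : R) : \bar R := (N a + ind a z1 + ind a z2)%E.

Definition add1_count (z : R) (N : R -> \bar R) (a : R) : \bar R := (N a + ind a z)%E.

Let addK (u : \bar R) (r : R) : (u + r%:E - r%:E = u)%E.
Proof. by rewrite addeK. Qed.

(** Merging removes exactly the two indicators just added. They are finite, so the cancellation is
    valid even where [N] is infinite. *)
Lemma merge_add2_count z1 z2 N a :
  merge_count z1 z2 (add2_count z1 z2 N) a = add1_count (z1 + z2) N a.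
Proof.
rewrite /merge_count /add2_count /add1_count; congr (_ + _)%E.
by rewrite (addeAC (N a)) /ind !addK.
Qed.

Lemma split_add1_count z1 z2 N a :
  split_count z1 z2 (add1_count (z1 + z2) N) a = add2_count z1 z2 N a.
Proof. by rewrite /split_count /add2_count /add1_count /ind addK. Qed.

(** The rates live on x + y <= 1, the balance is assumed on x + y < 1; the difference is a null
    set. *)
Lemma antidiagonal_null :
  (lebesgue_measure \x lebesgue_measure)%E [set z : R * R | z.1 + z.2 = 1] = 0%E.
Proof.
rewrite /product_measure1; apply: integral0_eq => x _ /=.
rewrite (_ : xsection _ _ = [set 1 - x]); first exact: lebesgue_measure_set1.
apply/seteqP; split=> y; rewrite /xsection/= inE/=.
  by move=> <-; rewrite addrAC subrr add0r.
by move=> ->; rewrite addrCA subrr addr0.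
Qed.

End points.

Section sum_kernel.
Context (R : realType) (k : R.-pker R ~> Nspace R).

(** First-order Palm measures seen as a kernel of pairs, so that integrals against them are
    measurable in the pair. *)
Definition sum_kernel (z : R * R) : {measure set Nspace R -> \bar R} := k (z.1 + z.2).

Let measurable_sum_kernel U : measurable U -> measurable_fun [set: R * R] (sum_kernel ^~ U).
Proof.
move=> mU; apply: (measurableT_comp (measurable_kernel k U mU)).
exact: measurable_funD.
Qed.

HB.instance Definition _ := isKernel.Build _ _ _ _ R sum_kernel measurable_sum_kernel.

Let sum_kernel_uub : measure_fam_uub sum_kernel.
Proof. by exists 2 => z; rewrite prob_kernel lte_fin ltr1n. Qed.

HB.instance Definition _ := Kernel_isFinite.Build _ _ _ _ R sum_kernel sum_kernel_uub.

(** A copy of [k z] carrying the structure of a probability measure, in particular sigma-finite, as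
    Tonelli requires. *)
Definition kernel_at (z : R) : set (Nspace R) -> \bar R := k z.

HB.instance Definition _ z := Measure.copy (kernel_at z) (k z).

Let kernel_atT z : kernel_at z setT = 1%E. Proof. exact: prob_kernel. Qed.

HB.instance Definition _ z :=
  Measure_isProbability.Build _ _ _ (kernel_at z) (kernel_atT z).

End sum_kernel.

(** * Detailed balance from Palm formulas, bounded rates *)

Section bounded_rates.
Context (R : realType) (K F : R * R -> R).
Hypotheses (K0 : forall z, 0 <= K z) (F0 : forall z, 0 <= F z).
Hypotheses (mK : measurable_fun [set: R * R] K) (mF : measurable_fun [set: R * R] F).
Hypotheses (KD : forall z, ~ rate_dom R z -> K z = 0) (FD : forall z, ~ rate_dom R z -> F z = 0).
Context (b : R) (b0 : 0 <= b) (Kb : forall z, K z <= b) (Fb : forall z, F z <= b).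
Context d (T : measurableType d) (P : probability T R)
     (X : {RV P >-> Omega1 R}) (q1 : R -> R) (q2 : R * R -> R)
     (P1 : R.-pker R ~> Nspace R) (P2 : R.-pker (R * R) ~> Nspace R).
Hypotheses (q1P : correlation_function1 X q1) (q2P : correlation_function2 X q2).
Hypotheses (palm1 : reduced_palm1 X P1) (palm2 : reduced_palm2 X P2).
Hypothesis balance : {ae (lebesgue_measure \x lebesgue_measure)%E, forall z : R * R,
        Delta2o R z ->
        forall B : set (Nspace R), measurable B ->
          ((K z * q2 z)%:E * P2 z B =
           (F z * q1 (z.1 + z.2))%:E * P1 (z.1 + z.2)%R B)%E}.
Context (Phi Psi : Omega1 R -> R) (M : R).
Hypotheses (mPhi : measurable_fun [set: Omega1 R] Phi) (mPsi : measurable_fun [set: Omega1 R] Psi).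
Hypotheses (PhiM : forall x, 0 <= Phi x <= M) (PsiM : forall x, 0 <= Psi x <= M).
Local Notation leb := (@lebesgue_measure R).

Let Phi0 x : 0 <= Phi x. Proof. by have /andP[] := PhiM x. Qed.
Let Psi0 x : 0 <= Psi x. Proof. by have /andP[] := PsiM x. Qed.
Let M0 : 0 <= M. Proof. by have /andP[] := PhiM (omega1_unit R); exact: le_trans. Qed.

Lemma measurable_ray_count_comp d' (U : measurableType d') (eta : U -> Nspace R) (q : rat) :
  0 < q -> measurable_fun [set: U] eta ->
  measurable_fun [set: U] (fun t => ray_count (eta t) (ratr q)).
Proof.
move=> q0 meta; have r0 : 0 < (ratr q : R) by rewrite ltr0q.
exact: (measurableT_comp (measurable_nmeas_ray r0) meta).
Qed.

(** The integrand common to both sides: for a merge, the state before and the state after; for a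
    split, the same two states in the reverse order. *)
Definition palm_fun (z : R * R) (eta : Nspace R) : R :=
  Phi (ranked (add2_count z.1 z.2 (ray_count eta))) *
  Psi (ranked (add1_count (z.1 + z.2) (ray_count eta))).

Let palm_fun0 z eta : 0 <= palm_fun z eta. Proof. by rewrite mulr_ge0. Qed.

Lemma measurable_palm_fun d' (U : measurableType d') (z : U -> R * R) (eta : U -> Nspace R) :
  measurable_fun [set: U] z -> measurable_fun [set: U] eta ->
  measurable_fun [set: U] (fun t => palm_fun (z t) (eta t)).
Proof.
move=> mz meta.
have m1 : measurable_fun [set: U] (fun t => (z t).1) by exact: (measurableT_comp measurable_fst).
have m2 : measurable_fun [set: U] (fun t => (z t).2) by exact: (measurableT_comp measurable_snd).
apply: measurable_funM; apply: measurableT_comp => //; apply: measurable_ranked => q q0.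
  apply: emeasurable_funD; last exact: measurable_ind.
  apply: emeasurable_funD; last exact: measurable_ind.
  exact: measurable_ray_count_comp.
apply: emeasurable_funD; last by apply: measurable_ind => //; exact: measurable_funD.
exact: measurable_ray_count_comp.
Qed.

Definition palm_int2 (z : R * R) : \bar R := (\int[P2 z]_eta (palm_fun z eta)%:E)%E.
Definition palm_int1 (z : R * R) : \bar R := (\int[P1 (z.1 + z.2)%R]_eta (palm_fun z eta)%:E)%E.

Let palm_int2_ge0 z : (0 <= palm_int2 z)%E.
Proof. by apply: integral_ge0 => eta _; rewrite lee_fin. Qed.

Let palm_int1_ge0 z : (0 <= palm_int1 z)%E.
Proof. by apply: integral_ge0 => eta _; rewrite lee_fin. Qed.

Let mpalm : measurable_fun [set: (R * R) * Nspace R] (fun t => (palm_fun t.1 t.2)%:E).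
Proof. by apply/measurable_EFinP; exact: measurable_palm_fun. Qed.

Lemma measurable_palm_int2 : measurable_fun [set: R * R] palm_int2.
Proof.
apply: (@measurable_fun_integral_sfinite_kernel _ _ _ _ _
  (fun t => (palm_fun t.1 t.2)%:E) P2) => //.
by move=> t; rewrite lee_fin.
Qed.

Lemma measurable_palm_int1 : measurable_fun [set: R * R] palm_int1.
Proof.
apply: (@measurable_fun_integral_sfinite_kernel _ _ _ _ _
  (fun t => (palm_fun t.1 t.2)%:E) (sum_kernel P1)) => //.
by move=> t; rewrite lee_fin.
Qed.

(** Second-order Palm formula: once z_1 and z_2 are added, [Phi] sees both of them and [Psi],
    evaluated after the merge, sees only their sum. *)
Lemma merge_side : (\int[distribution P X]_x ((Phi x)%:E * merge_part K Psi x) =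
  \int[leb \x leb]_(z in @quadrant R) ((K z)%:E * palm_int2 z * (q2 z)%:E))%E.
Proof.
have [mq2 q20 q2E] := q2P.
(* Here the second component is the full point measure, the points z_1 and z_2 included. *)
pose g (t : (R * R) * Nspace R) : R := K t.1 * (Phi (ranked (ray_count t.2)) *
  Psi (ranked (merge_count t.1.1 t.1.2 (ray_count t.2)))).
have g0 t : 0 <= g t by rewrite mulr_ge0// mulr_ge0.
have mg : measurable_fun [set: (R * R) * Nspace R] g.
  have m1 : measurable_fun [set: (R * R) * Nspace R] (fun t => t.1.1).
    exact: (measurableT_comp measurable_fst).
  have m2 : measurable_fun [set: (R * R) * Nspace R] (fun t => t.1.2).
    exact: (measurableT_comp measurable_snd).
  apply: measurable_funM; first exact: measurableT_comp.
  apply: measurable_funM; apply: measurableT_comp => //; apply: measurable_ranked => q q0.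
    exact: measurable_ray_count_comp.
  by apply: measurable_merge_count => //; exact: measurable_ray_count_comp.
have gb t : g t <= b * (M * M).
  have /andP[p0 pM] := PhiM (ranked (ray_count t.2)).
  have /andP[r0 rM] := PsiM (ranked (merge_count t.1.1 t.1.2 (ray_count t.2))).
  by rewrite ler_pM// ?mulr_ge0// ler_pM.
have := palm2 mg g0 (ex_intro _ _ gb).
set L := (X in X = _ -> _); set Rt := (X in _ = X -> _) => LR.
transitivity L.
  have mf : measurable_fun [set: Omega1 R] (fun x => (Phi x)%:E * merge_part K Psi x)%E.
    apply: emeasurable_funM; first exact/measurable_EFinP.
    exact: measurable_merge_part.
  rewrite (ge0_integral_distribution X mf); last first.
    by move=> x; rewrite mule_ge0 ?lee_fin ?merge_part_ge0.
  apply: eq_integral => w _ /=.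
  rewrite integral_point_measure2; last 2 first.
  - apply/measurable_funTS/measurable_EFinP; apply: measurableT_comp => //.
  - by move=> z _; rewrite lee_fin.
  rewrite /merge_part -pair_sumZ; last by move=> i j; rewrite lee_fin mulr_ge0.
  apply: eq_eseriesr => i _; apply: eq_eseriesr => j _.
  rewrite -EFinM /g/= ranked_Xi merge_count_Xi; congr EFin; ring.
rewrite {}LR /Rt {L Rt}.
have mKh : measurable_fun [set: R * R] (fun z => (K z)%:E * palm_int2 z)%E.
  by apply: emeasurable_funM; [exact/measurable_EFinP|exact: measurable_palm_int2].
transitivity (\int[correlation_measure2 X]_(z in @quadrant R) ((K z)%:E * palm_int2 z))%E; last first.
  have mid : measurable_fun [set: measurableTypeR R * measurableTypeR R] (id : _ -> R * R).
    by move=> _ A mA; rewrite setTI.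
  apply: (@ge0_integral_density_comp _ _ _ _ _ (leb \x leb)%E (correlation_measure2 X) id
    (@quadrant R) q2 (fun z => (K z)%:E * palm_int2 z)%E) => //.
  - exact: measurable_quadrant.
  - exact: measurable_funTS.
  - by move=> z _; rewrite mule_ge0// lee_fin.
apply: eq_integral => z; rewrite inE quadrantE => -[z1 z2].
rewrite /palm_int2 -ge0_integralZl//; last 3 first.
- by apply/measurable_EFinP; exact: measurable_palm_fun.
- by move=> eta _; rewrite lee_fin.
- by rewrite lee_fin.
apply: eq_integral => eta _; rewrite -EFinM /g /palm_fun /=; congr (_ * (Phi _ * Psi _))%:E.
  by apply: eq_ranked => q q0; rewrite !ray_count_add_point.
apply: eq_ranked => q q0; rewrite -merge_add2_count /merge_count /add2_count.
by rewrite !ray_count_add_point.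
Qed.

(** First-order Palm formula at s, the integral over u being part of the integrand; Tonelli brings
    it outside the Palm measure, and polar coordinates turn (s, u) into a pair. *)
Lemma split_side : (\int[distribution P X]_x ((Psi x)%:E * split_part F Phi x) =
  \int[leb \x leb]_(z in @quadrant R) ((F z * q1 (z.1 + z.2))%:E * palm_int1 z))%E.
Proof.
have [mq1 q10 q1E] := q1P.
pose h (t : (R * Nspace R) * R) : R := F (t.2 * t.1.1, (1 - t.2) * t.1.1) *
   Phi (ranked (split_count (t.2 * t.1.1) ((1 - t.2) * t.1.1) (ray_count t.1.2))).
have h0 t : 0 <= h t by rewrite mulr_ge0.
have mp1 : measurable_fun [set: (R * Nspace R) * R] (fun t => t.1.1).
  exact: (measurableT_comp measurable_fst).
have mp2 : measurable_fun [set: (R * Nspace R) * R] (fun t => t.1.2).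
  exact: (measurableT_comp measurable_snd).
have mus : measurable_fun [set: (R * Nspace R) * R] (fun t => t.2 * t.1.1) by exact: measurable_funM.
have mvs : measurable_fun [set: (R * Nspace R) * R] (fun t => (1 - t.2) * t.1.1).
  by apply: measurable_funM => //; exact: measurable_funB.
have mh : measurable_fun [set: (R * Nspace R) * R] h.
  apply: measurable_funM; first by apply: measurableT_comp => //; exact: measurable_fun_pair.
  apply: measurableT_comp => //; apply: measurable_ranked => q q0.
  by apply: measurable_split_count => //; exact: measurable_ray_count_comp.
pose I t := int01 (fun u => h (t, u)).
have I0 t : (0 <= I t)%E by apply: integral_ge0 => u _; rewrite lee_fin.
have mI : measurable_fun [set: R * Nspace R] I by exact: measurable_int01.
have Ib t : (I t <= (b * M)%:E)%E.
  apply: (@le_trans _ _ (\int[leb]_(u in `]0%R, 1%R[) (b * M)%:E)%E).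
    apply: ge0_le_integral => //.
    - by move=> u _; rewrite lee_fin.
    - by apply/measurable_EFinP; apply: measurable_funTS; exact: measurableT_comp.
    - move=> u _; rewrite lee_fin.
      have /andP[p0 pM] := PhiM (ranked (split_count (u * t.1) ((1 - u) * t.1) (ray_count t.2))).
      by rewrite ler_pM.
  by rewrite integral_cst//= lebesgue_measure_itv/= lte_fin ltr01 oppr0 adde0 mule1.
have Ifin t : I t \is a fin_num by rewrite ge0_fin_numE//; apply: le_lt_trans (Ib t) _; rewrite ltry.
(* The rate vanishes off the triangle, so only sizes s in ]0, 1] contribute; without this the factor
   s would make the integrand unbounded. *)
have Is t : ~ (0 < t.1 <= 1) -> I t = 0%E.
  move=> ts; apply: integral0_eq => u; rewrite /= in_itv/= => /andP[u0 u1].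
  rewrite /h FD ?mul0r//= => -[/= a1 a2 a3]; apply: ts.
  rewrite (pmulr_rgt0 _ u0) in a1; rewrite a1/=.
  by rewrite -mulrDl addrCA subrr addr0 mul1r in a3.
(* The Palm formula takes real-valued integrands; [fine] loses nothing because the inner integral is
   at most b M. *)
pose g (t : R * Nspace R) : R := t.1 * (fine (I t) * Psi (ranked (ray_count t.2))).
have gN t : ~ (0 < t.1 <= 1) -> g t = 0 by move=> /Is E; rewrite /g E/= mul0r mulr0.
have g0 t : 0 <= g t.
  have [/andP[s0 _]|/gN ->//] := pselect (0 < t.1 <= 1).
  by rewrite mulr_ge0// ?mulr_ge0 ?fine_ge0// ltW.
have gb t : g t <= 1 * (b * M * M).
  have bM0 : 0 <= b * M by rewrite mulr_ge0.
  have [/andP[s0 s1]|/gN ->] := pselect (0 < t.1 <= 1); last by rewrite mul1r mulr_ge0.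
  have /andP[r0 rM] := PsiM (ranked (ray_count t.2)).
  rewrite ler_pM ?mulr_ge0 ?fine_ge0 ?(ltW s0)// ler_pM ?fine_ge0//.
  by rewrite -lee_fin fineK.
have mg : measurable_fun [set: R * Nspace R] g.
  apply: measurable_funM => //; apply: measurable_funM; first exact: measurableT_comp.
  apply: measurableT_comp => //; apply: measurable_ranked => q q0.
  exact: measurable_ray_count_comp.
have := palm1 mg g0 (ex_intro _ _ gb).
set L := (X in X = _ -> _); set Rt := (X in _ = X -> _) => LR.
transitivity L.
  have mf : measurable_fun [set: Omega1 R] (fun x => (Psi x)%:E * split_part F Phi x)%E.
    apply: emeasurable_funM; first exact/measurable_EFinP.
    exact: measurable_split_part.
  have sp0 (x : Omega1 R) i : (0 <= int01 (fun u => F (u * x i, (1 - u) * x i) *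
       Phi (split (u * x i) ((1 - u) * x i) x))%R)%E.
    by apply: integral_ge0 => u _; rewrite lee_fin mulr_ge0.
  rewrite (ge0_integral_distribution X mf); last first.
    by move=> x; rewrite mule_ge0 ?lee_fin ?split_part_ge0.
  apply: eq_integral => w _ /=.
  rewrite integral_Xi; last 2 first.
  - by apply/measurable_funTS/measurable_EFinP; apply: measurableT_comp.
  - by move=> z _; rewrite lee_fin.
  rewrite /split_part /point_sum -nneseriesZl; last first.
    by move=> i _; rewrite mule_ge0// lee_fin omega1_ge0.
  apply: eq_eseriesr => i _.
  rewrite /g/= ranked_Xi !EFinM fineK// muleCA; congr (_ * _)%E.
  rewrite [RHS]muleC; congr (_ * _)%E; apply: eq_integral => u _.
  by rewrite /h/= split_count_Xi.
rewrite {}LR /Rt {L Rt}.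
have mid : measurable_fun [set: measurableTypeR R] (id : _ -> R).
  by move=> _ A mA; rewrite setTI.
have sumE (s u : R) : u * s + (1 - u) * s = s by ring.
pose W' s := (s%:E * \int[leb]_(u in `]0%R, 1%R[) ((F (u * s, (1 - u) * s)%R)%:E *
   palm_int1 (u * s, (1 - u) * s)%R))%E.
have mFp : measurable_fun [set: R * R] (fun z => (F z)%:E * palm_int1 z)%E.
  by apply: emeasurable_funM; [exact/measurable_EFinP|exact: measurable_palm_int1].
have Fp0 z : (0 <= (F z)%:E * palm_int1 z)%E by rewrite mule_ge0// lee_fin.
have mW' : measurable_fun [set: R] W'.
  apply: emeasurable_funM; first exact/measurable_EFinP.
  apply: (@measurable_int01e _ _ _ (fun t : R * R => (F (t.2 * t.1, (1 - t.2) * t.1)%R)%:E *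
    palm_int1 (t.2 * t.1, (1 - t.2) * t.1)%R)%E) => [|t]; last exact: Fp0.
  apply: (measurableT_comp mFp); exact: measurable_split_pair.
have W'0 s : halfline s -> (0 <= W' s)%E.
  rewrite halflineE => s0; rewrite mule_ge0 ?lee_fin ?(ltW s0)//.
  by apply: integral_ge0 => u _; exact: Fp0.
transitivity (\int[correlation_measure1 X]_(s in @halfline R) W' s)%E.
  apply: eq_integral => s; rewrite inE halflineE => s0.
  pose a (t : Nspace R * R) : \bar R := (F (t.2 * s, (1 - t.2) * s)%R *
    palm_fun (t.2 * s, (1 - t.2) * s)%R t.1)%:E.
  have a0 t : (0 <= a t)%E by rewrite lee_fin mulr_ge0.
  have mpair : measurable_fun [set: Nspace R * R] (fun t => (t.2 * s, (1 - t.2) * s)%R).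
    exact: measurable_split_pair.
  have ma : measurable_fun [set: Nspace R * R] a.
    apply/measurable_EFinP; apply: measurable_funM; first exact: measurableT_comp.
    exact: measurable_palm_fun.
  transitivity (\int[kernel_at P1 s]_eta (s%:E * \int[leb]_(u in `]0%R, 1%R[) a (eta, u)))%E.
    apply: eq_integral => eta _; rewrite /g/= 2!EFinM fineK//; congr (_ * _)%E.
    rewrite muleC -ge0_integralZl//; last 3 first.
    - by apply/measurable_EFinP; apply: measurable_funTS; exact: measurableT_comp.
    - by move=> u _; rewrite lee_fin.
    - by rewrite lee_fin.
    apply: eq_integral => u _; rewrite -EFinM /h /a /palm_fun/=; congr EFin.
    rewrite mulrCA; congr (_ * _); rewrite mulrC; congr (Phi _ * Psi _).
      apply: eq_ranked => q q0; rewrite -split_add1_count /split_count sumE.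
      by rewrite /add1_count ray_count_add_point.
    by apply: eq_ranked => q q0; rewrite sumE ray_count_add_point.
  rewrite ge0_integralZl//; last 3 first.
  - exact: measurable_int01e.
  - by move=> eta _; apply: integral_ge0 => u _; exact: a0.
  - by rewrite lee_fin ltW.
  rewrite tonelli_int01//; congr (_ * _)%E; apply: eq_integral => u _.
  rewrite /palm_int1/= sumE -ge0_integralZl//; last 3 first.
  - by apply/measurable_EFinP; exact: measurable_palm_fun.
  - by move=> eta _; rewrite lee_fin.
  - by rewrite lee_fin.
rewrite (@ge0_integral_density_comp _ _ _ _ _ leb (correlation_measure1 X) id
    (@halfline R) q1 W')//; last 3 first.
- exact: measurable_halfline.
- by move=> s; rewrite halflineE; exact: q10.
- exact: measurable_funTS.
(* [integral_polar] asks for an integrand that is measurable and nonnegative on the whole plane,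
   whereas [q1] is controlled on the half-line only. *)
pose q1' := q1 \_ (@halfline R).
have mq1' : measurable_fun [set: R] q1'.
  by apply: (measurable_restrictT _ _).1 => //; exact: measurable_halfline.
have q1'0 z : 0 <= q1' z.
  by rewrite /q1' patchE; case: ifPn => //; rewrite inE halflineE; exact: q10.
have q1'E z : 0 < z -> q1' z = q1 z by move=> z0; rewrite /q1' patchE mem_set// halflineE.
pose hh z := ((F z * q1' (z.1 + z.2))%:E * palm_int1 z)%E.
transitivity (\int[leb \x leb]_(z in @quadrant R) hh z)%E; last first.
  apply: eq_integral => z; rewrite inE quadrantE => -[z1 z2].
  by rewrite /hh q1'E// addr_gt0.
rewrite -integral_polar//; last 2 first.
- apply: emeasurable_funM; last exact: measurable_palm_int1.
  apply/measurable_EFinP; apply: measurable_funM => //.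
  by apply: measurableT_comp => //; exact: measurable_funD.
- by move=> z; rewrite mule_ge0// lee_fin mulr_ge0.
apply: eq_integral => s; rewrite inE => hs.
have s0 : 0 < s by rewrite -halflineE.
rewrite /W' -muleA; congr (_ * _)%E.
rewrite muleC -ge0_integralZl//; last 2 first.
- apply: measurable_funTS; apply: (measurableT_comp mFp).
  exact: measurable_split_pair.
- by rewrite lee_fin q10.
apply: eq_integral => u _; rewrite /hh/= sumE q1'E// muleA -EFinM.
by rewrite [X in X%:E]mulrC.
Qed.

(** The two integrands agree off the line z_1 + z_2 = 1: inside the triangle by the hypothesis on
    Palm measures, outside because both rates vanish. *)
Lemma detailed_balance_bounded :
  (\int[distribution P X]_x ((Phi x)%:E * merge_part K Psi x) =
   \int[distribution P X]_x ((Psi x)%:E * split_part F Phi x))%E.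
Proof.
rewrite merge_side split_side.
have [mq2 q20 _] := q2P; have [mq1 q10 _] := q1P.
have q1s0 z : quadrant z -> 0 <= q1 (z.1 + z.2).
  by rewrite quadrantE => -[z1 z2]; apply: q10; exact: addr_gt0.
have mq1s : measurable_fun (@quadrant R) (fun z => q1 (z.1 + z.2)).
  apply: (measurable_comp (F := @halfline R)) => //.
  - exact: measurable_halfline.
  - by move=> _ [z + <-]; rewrite quadrantE halflineE => -[]; exact: addr_gt0.
  - by apply: measurable_funTS; exact: measurable_funD.
apply: ge0_ae_eq_integral.
- exact: measurable_quadrant.
- apply: emeasurable_funM; last by apply/measurable_EFinP.
  apply: measurable_funTS; apply: emeasurable_funM; last exact: measurable_palm_int2.
  exact/measurable_EFinP.
- apply: emeasurable_funM; last by apply: measurable_funTS; exact: measurable_palm_int1.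
  by apply/measurable_EFinP; apply: measurable_funM => //; exact: measurable_funTS.
- by move=> z Qz; rewrite mule_ge0 ?mule_ge0 ?lee_fin ?q20.
- by move=> z Qz; rewrite mule_ge0// lee_fin mulr_ge0// q1s0.
have mline : measurable [set z : R * R | z.1 + z.2 = 1].
  rewrite (_ : [set _ | _] = (fun z : R * R => z.1 + z.2) @^-1` [set 1]) //.
  rewrite -[X in measurable X]setTI.
  exact: (measurable_funD measurable_fst measurable_snd).
have aeline : {ae (leb \x leb)%E, forall z : R * R, z.1 + z.2 != 1}.
  exists [set z | z.1 + z.2 = 1]; split => //; first exact: antidiagonal_null.
  by move=> z /= /negP; rewrite negbK => /eqP.
have E (z : R * R) :
  (Delta2o R z -> forall B : set (Nspace R), measurable B ->
          ((K z * q2 z)%:E * P2 z B =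
           (F z * q1 (z.1 + z.2))%:E * P1 (z.1 + z.2)%R B)%E) ->
  z.1 + z.2 != 1 -> quadrant z -> ((K z)%:E * palm_int2 z * (q2 z)%:E =
     (F z * q1 (z.1 + z.2))%:E * palm_int1 z)%E.
  move=> bz z1 Qz; have := Qz; rewrite quadrantE => -[z10 z20].
  have [Dz|Dz] := pselect (Delta2o R z); last first.
    have rz : ~ rate_dom R z.
      by move=> [_ _ z1']; apply: Dz; split => //; rewrite lt_neqAle z1.
    by rewrite KD// FD// !mul0r !mul0e.
  have a0 : 0 <= K z * q2 z by rewrite mulr_ge0// q20.
  have c0 : 0 <= F z * q1 (z.1 + z.2) by rewrite mulr_ge0// q1s0.
  rewrite muleAC -EFinM /palm_int2 /palm_int1.
  have mp : measurable_fun [set: Nspace R] (fun eta => (palm_fun z eta)%:E).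
    by apply/measurable_EFinP; exact: measurable_palm_fun.
  (* The scalars are absorbed into the measures: the hypothesis is an equality of scaled measures
     and then applies to any nonnegative integrand. *)
  rewrite -(@ge0_integral_mscale _ _ _ _ setT measurableT (NngNum a0))//; last first.
    by move=> eta _; rewrite lee_fin.
  rewrite -(@ge0_integral_mscale _ _ _ _ setT measurableT (NngNum c0))//; last first.
    by move=> eta _; rewrite lee_fin.
  by apply: eq_measure_integral => A mA _; exact: bz.
move: balance aeline; apply: (@filterS2 _ _ (@ae_filter_ringOfSetsType _ _ _ _)) => z bz lz; exact: E.
Qed.

End bounded_rates.

(** * Unbounded rates by layers *)

Section truncation.
Context (R : realType) (w : R * R -> R).
Hypotheses (w0 : forall z, 0 <= w z) (mw : measurable_fun [set: R * R] w).

(* Palm measures are characterized by bounded integrands only; an unbounded rate is the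
   sum of its restrictions to the sets where [w] has a given integer part. *)
Definition layer n (f : R * R -> R) (z : R * R) : R := f z * (n%:R <= w z < n.+1%:R)%R%:R.

Lemma layer_ge0 n f : (forall z, 0 <= f z) -> forall z, 0 <= layer n f z.
Proof. by move=> f0 z; rewrite mulr_ge0. Qed.

Lemma measurable_layer n f : measurable_fun [set: R * R] f ->
  measurable_fun [set: R * R] (layer n f).
Proof.
move=> mf; apply: measurable_funM => //.
rewrite (_ : (fun z => _) = \1_[set z | n%:R <= w z < n.+1%:R]).
  apply: measurable_indic; rewrite (_ : [set _ | _] = w @^-1` `[n%:R, n.+1%:R[); last first.
    by apply/seteqP; split=> z /=; rewrite in_itv.
  by rewrite -[X in measurable X]setTI; exact: mw.
by apply/funext => z; rewrite indicE; congr (_%:R); congr nat_of_bool; apply/idP/idP; rewrite inE.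
Qed.

Lemma layer_le n f : (forall z, 0 <= f z <= w z) -> forall z, layer n f z <= n.+1%:R.
Proof.
move=> fw z; have /andP[f0 fz] := fw z; rewrite /layer.
case: (boolP (_ <= _ < _)) => [/andP[_ wn]|_]; last by rewrite mulr0.
by rewrite mulr1 (le_trans fz)// ltW.
Qed.

(** Exactly one layer is nonzero at z, the one indexed by the integer part of [w z]. *)
Lemma layer_sum f (c : R) z : (forall z, 0 <= f z) -> 0 <= c ->
  (\sum_(n <oo) (layer n f z * c)%:E = (f z * c)%:E)%E.
Proof.
move=> f0 c0.
have wz := truncn_itv (w0 z).
rewrite (@nneseriesD1 _ _ (Num.truncn (w z)))//; last first.
  by move=> k _; rewrite lee_fin mulr_ge0// layer_ge0.
rewrite /layer wz mulr1 eseries0 ?adde0// => i _ /= it.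
case: (boolP (_ <= _ < _)) => [/truncn_def iE|_]; last by rewrite mulr0 mul0r.
by rewrite iE eqxx in it.
Qed.

Lemma pair_sum_layer (x : Omega1 R) f (c : nat -> nat -> R) : (forall z, 0 <= f z) ->
  (forall i j, 0 <= c i j) ->
  (\sum_(n <oo) pair_sum x (fun i j => (layer n f (x i, x j) * c i j)%:E) =
   pair_sum x (fun i j => (f (x i, x j) * c i j)%:E))%E.
Proof.
move=> f0 c0; rewrite /pair_sum nneseries_interchange; last first.
  by move=> n i; apply: nneseries_ge0 => j _ _; rewrite lee_fin mulr_ge0// layer_ge0.
apply: eq_eseriesr => i _; rewrite nneseries_interchange; last first.
  by move=> n j; rewrite lee_fin mulr_ge0// layer_ge0.
by apply: eq_eseriesr => j _; exact: layer_sum.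
Qed.

Lemma point_sum_layer (x : Omega1 R) (f : R * R -> R) (c : nat -> R -> R) : (forall z, 0 <= f z) ->
  (forall i u, 0 <= c i u) -> measurable_fun [set: R * R] f ->
  (forall i, measurable_fun [set: R] (c i)) ->
  (\sum_(n <oo) point_sum x (fun i => (x i)%:E * int01 (fun u =>
      layer n f (u * x i, (1 - u) * x i)%R * c i u)%R) =
   point_sum x (fun i => (x i)%:E * int01 (fun u => f (u * x i, (1 - u) * x i)%R * c i u)%R))%E.
Proof.
move=> f0 c0 mf mc.
have I0 n i : (0 <= int01 (fun u => layer n f (u * x i, (1 - u) * x i)%R * c i u)%R)%E.
  by apply: integral_ge0 => u _; rewrite lee_fin mulr_ge0// layer_ge0.
rewrite /point_sum.
under [LHS]eq_eseriesr => n _ do rewrite eseries_mkcond.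
rewrite nneseries_interchange; last first.
  by move=> n i; case: ifP => // _; rewrite mule_ge0// lee_fin omega1_ge0.
rewrite [RHS]eseries_mkcond; apply: eq_eseriesr => i _.
case: ifP => // _; last by rewrite eseries0.
rewrite nneseriesZl//; congr (_ * _)%E.
rewrite /int01 -integral_nneseries//; last 2 first.
- move=> n; apply/measurable_EFinP; apply: measurable_funTS; apply: measurable_funM; last exact: mc.
  apply: measurableT_comp; first exact: measurable_layer.
  exact: measurable_split_pair.
- by move=> n u _; rewrite lee_fin mulr_ge0// layer_ge0.
by apply: eq_integral => u _; rewrite layer_sum.
Qed.

End truncation.

Section detailed_balance.
Context (R : realType) (K F : R * R -> R).
Hypotheses (K0 : forall z, 0 <= K z) (F0 : forall z, 0 <= F z).
Hypotheses (mK : measurable_fun [set: R * R] K) (mF : measurable_fun [set: R * R] F).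
Hypotheses (KD : forall z, ~ rate_dom R z -> K z = 0) (FD : forall z, ~ rate_dom R z -> F z = 0).
Context d (T : measurableType d) (P : probability T R)
     (X : {RV P >-> Omega1 R}) (q1 : R -> R) (q2 : R * R -> R)
     (P1 : R.-pker R ~> Nspace R) (P2 : R.-pker (R * R) ~> Nspace R).
Hypotheses (q1P : correlation_function1 X q1) (q2P : correlation_function2 X q2).
Hypotheses (palm1 : reduced_palm1 X P1) (palm2 : reduced_palm2 X P2).
Hypothesis balance : {ae (lebesgue_measure \x lebesgue_measure)%E, forall z : R * R,
        Delta2o R z ->
        forall B : set (Nspace R), measurable B ->
          ((K z * q2 z)%:E * P2 z B =
           (F z * q1 (z.1 + z.2))%:E * P1 (z.1 + z.2)%R B)%E}.

(** One function bounds both rates, so that the layers of [K] and [F] are cut by the same indicator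
    and the balance survives in each layer. *)
Let w z := Num.max (K z) (F z).

Let w0 z : 0 <= w z. Proof. by rewrite /w le_max K0. Qed.

Let mw : measurable_fun [set: R * R] w. Proof. exact: measurable_maxr. Qed.

(** Both sides are sums over the layers by monotone convergence, and on layer n the rates are at
    most n + 1. *)
Lemma palm_detailed_balance (Phi Psi : Omega1 R -> R) (M : R) :
  measurable_fun [set: Omega1 R] Phi -> measurable_fun [set: Omega1 R] Psi ->
  (forall x, 0 <= Phi x <= M) -> (forall x, 0 <= Psi x <= M) ->
  (\int[distribution P X]_x ((Phi x)%:E * merge_part K Psi x) =
   \int[distribution P X]_x ((Psi x)%:E * split_part F Phi x))%E.
Proof.
move=> mPhi mPsi PhiM PsiM.
have Phi0 x : 0 <= Phi x by have /andP[] := PhiM x.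
have Psi0 x : 0 <= Psi x by have /andP[] := PsiM x.
have mlay f n : measurable_fun [set: R * R] f -> measurable_fun [set: R * R] (layer w n f).
  exact: measurable_layer.
have mpart0 n x : (0 <= merge_part (layer w n K) Psi x)%E.
  by apply: merge_part_ge0 => //; exact: layer_ge0.
have spart0 n x : (0 <= split_part (layer w n F) Phi x)%E.
  by apply: split_part_ge0 => //; exact: layer_ge0.
transitivity (\sum_(n <oo) \int[distribution P X]_x
    ((Phi x)%:E * merge_part (layer w n K) Psi x))%E.
  rewrite -integral_nneseries//; last 2 first.
  - move=> n; apply: emeasurable_funM; first exact/measurable_EFinP.
    by apply: measurable_merge_part => //; [exact: layer_ge0|exact: mlay].
  - by move=> n x _; rewrite mule_ge0// lee_fin.
  apply: eq_integral => x _; rewrite nneseriesZl//; congr (_ * _)%E.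
  by rewrite /merge_part pair_sum_layer.
transitivity (\sum_(n <oo) \int[distribution P X]_x
    ((Psi x)%:E * split_part (layer w n F) Phi x))%E; last first.
  rewrite -integral_nneseries//; last 2 first.
  - move=> n; apply: emeasurable_funM; first exact/measurable_EFinP.
    by apply: measurable_split_part => //; [exact: layer_ge0|exact: mlay].
  - by move=> n x _; rewrite mule_ge0// lee_fin.
  apply: eq_integral => x _; rewrite nneseriesZl//; congr (_ * _)%E.
  rewrite /split_part (@point_sum_layer _ w _ _ x F (fun i u =>
    Phi (split (u * (x : Omega1 R) i) ((1 - u) * (x : Omega1 R) i) x)))//.
  move=> i; apply: measurableT_comp => //.
  apply: measurable_split => //; first exact: measurable_funM.
  by apply: measurable_funM => //; exact: measurable_funB.
apply: eq_eseriesr => n _.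
apply: (@detailed_balance_bounded _ _ _ _ _ _ _ _ _ n.+1%:R _ _ _ _ _ _ X q1 q2 P1 P2 _ _ _ _ _ _ _ M) => //.
- exact: layer_ge0.
- exact: layer_ge0.
- exact: mlay.
- exact: mlay.
- by move=> z /KD; rewrite /layer => ->; rewrite mul0r.
- by move=> z /FD; rewrite /layer => ->; rewrite mul0r.
- by apply: layer_le => z; rewrite K0/= le_max lexx.
- by apply: layer_le => z; rewrite F0/= le_max lexx orbT.
move: balance; apply: (@filterS _ _ (@ae_filter_ringOfSetsType _ _ _ _)) => z bz Dz B mB.
rewrite /layer 2!(mulrAC _ (_%:R)) 2![in LHS]EFinM.
rewrite -muleA (muleC _ (P2 z B)) muleA -EFinM bz//.
by rewrite muleAC -EFinM.
Qed.

End detailed_balance.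

(** * Rates prescribed on the triangle *)

Section rates_on_domain.
Context (R : realType).
Implicit Types (x : Omega1 R) (K F : R * R -> R).

Lemma omega1_pair_le1 x i j : i != j -> x i + x j <= 1.
Proof.
move=> ij; rewrite -lee_fin EFinD -(omega1_sum x).
have x0 k : (0 <= (x k)%:E)%E by rewrite lee_fin omega1_ge0.
rewrite (@nneseriesD1 _ _ i)// (@nneseriesD1 _ _ j)//; last by rewrite eq_sym.
by rewrite addeA leeDl// nneseries_ge0.
Qed.

Lemma rate_dom_pair x i j : j != i -> 0 < x i * x j -> rate_dom R (x i, x j).
Proof.
move=> ji xij; split => /=; last by rewrite omega1_pair_le1// eq_sym.
  by rewrite lt_neqAle omega1_ge0 andbT; apply: contraTneq xij => <-; rewrite mul0r ltxx.
by rewrite lt_neqAle omega1_ge0 andbT; apply: contraTneq xij => <-; rewrite mulr0 ltxx.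
Qed.

Lemma omega1_le1 x i : x i <= 1.
Proof.
apply: le_trans (omega1_pair_le1 x (_ : i != i.+1)); first by rewrite lerDl omega1_ge0.
by rewrite neq_ltn ltnSn.
Qed.

Lemma rate_dom_split x i (u : R) : 0 < x i -> 0 < u < 1 -> rate_dom R (u * x i, (1 - u) * x i).
Proof.
move=> xi /andP[u0 u1]; split => /=; [exact: mulr_gt0|by rewrite mulr_gt0// subr_gt0|].
by rewrite -mulrDl addrCA subrr addr0 mul1r omega1_le1.
Qed.

(** Two different positive entries of a state have sum at most 1, so a pair sum only sees the values
    of a rate on [rate_dom]. *)
Lemma eq_pair_sum x (f g : nat -> nat -> \bar R) :
  (forall i j, rate_dom R (x i, x j) -> f i j = g i j) -> pair_sum x f = pair_sum x g.
Proof.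
move=> fg; apply: eq_eseriesr => i _; apply: eq_eseriesr => j /andP[ji xij].
by apply: fg; exact: rate_dom_pair.
Qed.

Lemma eq_point_sum_int01 x (a : nat -> \bar R) (f g : nat -> R -> R) :
  (forall i u, rate_dom R (u * x i, (1 - u) * x i) -> f i u = g i u) ->
  (point_sum x (fun i => a i * int01 (f i)) = point_sum x (fun i => a i * int01 (g i)))%E.
Proof.
move=> fg; apply: eq_eseriesr => i xi; congr (_ * _)%E.
apply: eq_integral => u; rewrite inE/= in_itv/= => u01.
by rewrite fg//; exact: rate_dom_split.
Qed.

Lemma eq_Lsharp K K' F F' : (forall z, rate_dom R z -> K z = K' z) ->
  (forall z, rate_dom R z -> F z = F' z) -> Lsharp K F = Lsharp K' F'.
Proof.
move=> KK FF; apply/funext => Phi; apply/funext => x; rewrite /Lsharp.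
congr (_ * fine _ + _ * fine _).
  by apply: eq_pair_sum => i j /KK ->.
by apply: eq_point_sum_int01 => i u /FF ->.
Qed.

Lemma measurable_rate_dom : measurable (rate_dom R).
Proof.
have -> : rate_dom R = [set z | 0 < z.1] `&` [set z | 0 < z.2] `&` [set z | z.1 + z.2 <= 1].
  by apply/seteqP; split => z [] => [z1 z2 z3|[z1 z2] z3].
have m1 : measurable_fun [set: R * R] fst by [].
have m2 : measurable_fun [set: R * R] snd by [].
apply: measurableI; first apply: measurableI.
- have := m1 measurableT `]0, +oo[%classic (measurable_itv _).
  by rewrite setTI; congr measurable; apply/seteqP; split => z /=; rewrite in_itv/= andbT.
- have := m2 measurableT `]0, +oo[%classic (measurable_itv _).
  by rewrite setTI; congr measurable; apply/seteqP; split => z /=; rewrite in_itv/= andbT.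
- have m12 : measurable_fun [set: R * R] (fun z => z.1 + z.2) by exact: measurable_funD.
  have := m12 measurableT `]-oo, 1]%classic (measurable_itv _).
  by rewrite setTI; congr measurable; apply/seteqP; split => z /=; rewrite in_itv.
Qed.

Lemma reversible_palm K1 F1 : nonneg_on (rate_dom R) K1 -> measurable_fun (rate_dom R) K1 ->
  nonneg_on (rate_dom R) F1 -> measurable_fun (rate_dom R) F1 ->
  bounded_merge_rate K1 -> bounded_split_rate F1 ->
  forall (d : measure_display) (T : measurableType d) (P : probability T R)
     (X : {RV P >-> Omega1 R}) (q1 : R -> R) (q2 : R * R -> R)
     (P1 : R.-pker R ~> Nspace R) (P2 : R.-pker (R * R) ~> Nspace R),
     correlation_function1 X q1 -> correlation_function2 X q2 ->
     reduced_palm1 X P1 -> reduced_palm2 X P2 ->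
     {ae (lebesgue_measure \x lebesgue_measure)%E, forall z : R * R,
        Delta2o R z ->
        forall B : set (Nspace R), measurable B ->
          ((K1 z * q2 z)%:E * P2 z B =
           (F1 z * q1 (z.1 + z.2))%:E * P1 (z.1 + z.2)%R B)%E} ->
  reversible (Lsharp K1 F1) (distribution P X).
Proof.
move=> K0 mK F0 mF [C Kb] [D Fb] d T P X q1 q2 P1 P2 q1P q2P palm1 palm2 balance.
(* The rates are extended by zero: the operator is unchanged, and measurability and sign become
   global. *)
pose K := K1 \_ (rate_dom R); pose F := F1 \_ (rate_dom R).
have KE z : rate_dom R z -> K1 z = K z by move=> Dz; rewrite /K patchE mem_set.
have FE z : rate_dom R z -> F1 z = F z by move=> Dz; rewrite /F patchE mem_set.
have K'0 z : 0 <= K z by rewrite /K patchE; case: ifPn => //; rewrite inE; exact: K0.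
have F'0 z : 0 <= F z by rewrite /F patchE; case: ifPn => //; rewrite inE; exact: F0.
have mD := measurable_rate_dom.
have mK' : measurable_fun [set: R * R] K by apply: (measurable_restrictT _ _).1.
have mF' : measurable_fun [set: R * R] F by apply: (measurable_restrictT _ _).1.
rewrite (eq_Lsharp KE FE); apply: (@reversible_Lsharp _ _ _ _ _ _ _ C D) => //.
- move=> x; apply: le_trans (Kb x); rewrite (@eq_pair_sum x _ (fun i j => (K1 (x i, x j))%:E))//.
  by move=> i j /KE ->.
- move=> x; apply: le_trans (Fb x).
  by rewrite (@eq_point_sum_int01 x _ _ (fun i u => F1 (u * x i, (1 - u) * x i)))// => i u /FE ->.
move=> Phi Psi M mPhi mPsi PhiM PsiM.
apply: (palm_detailed_balance _ _ _ _ _ _ q1P q2P palm1 palm2 _ mPhi mPsi PhiM PsiM) => //.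
- by move=> z Dz; rewrite /K patchE memNset.
- by move=> z Dz; rewrite /F patchE memNset.
move: balance; apply: (@filterS _ _ (@ae_filter_ringOfSetsType _ _ _ _)) => z bz Dz B mB.
have rz : rate_dom R z by case: Dz => z1 z2 /ltW z3; split.
by rewrite -KE// -FE//; exact: bz.
Qed.

End rates_on_domain.

(** * Configurations on the half-line *)

Section configurations.
Context (R : realType).
Implicit Types (y : nat -> R) (c : R -> nat).

Definition cylinder (s : seq R) c : set (R -> nat) :=
  [set c' | forall q, q \in s -> c' q = c q].

(** Prescribed counts above finitely many positive levels. Level 0 is avoided because the points
    accumulate there; the empty set is added to make the family stable under intersection. *)
Definition cylinders : set (set (R -> nat)) :=
  [set D | D = set0 \/ exists s c, all (fun q => 0 < q) s /\ D = cylinder s c].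

Definition config : Type := g_sigma_algebraType cylinders.

HB.instance Definition _ := Pointed.on config.
HB.instance Definition _ := Measurable.on config.

Definition insert_point (z : R) (c : config) : config := fun q => (c q + (q < z)%R)%N.

Definition remove_point (z : R) (c : config) : config := fun q => (c q - (q < z)%R)%N.

Lemma insert_pointK z : cancel (insert_point z) (remove_point z).
Proof. by move=> c; apply/funext => q; rewrite /insert_point /remove_point addnK. Qed.

Lemma measurable_config_eval (q : R) (k : nat) : 0 < q -> measurable [set c : config | c q = k].
Proof.
move=> q0; apply: sub_sigma_algebra; right; exists [:: q], (fun=> k); split; first by rewrite /= q0.
by apply/seteqP; split => c /= ck => [q'|]; [rewrite inE => /eqP ->|rewrite ck// mem_head].
Qed.

Lemma measurable_fun_config d (U : measurableType d) (f : U -> config) :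
  (forall q k, 0 < q -> measurable [set u | f u q = k]) -> measurable_fun [set: U] f.
Proof.
move=> mf; apply: (@measurability _ _ _ _ _ f cylinders) => //.
move=> _ [D + <-]; rewrite setTI => -[->|[s [c [s0 ->]]]]; first by rewrite preimage_set0.
elim: s s0 => [_|q s IH /= /andP[q0 s0]].
  by rewrite (_ : _ @^-1` _ = setT)//; apply/seteqP; split.
rewrite (_ : _ @^-1` _ = [set u | f u q = c q] `&` f @^-1` cylinder s c).
  by apply: measurableI; [exact: mf|exact: IH].
apply/seteqP; split => u /=.
  by move=> h; split=> [|q' q's]; apply: h; rewrite inE ?eqxx// q's orbT.
by move=> [h1 h2] q'; rewrite inE => /predU1P[->//|]; exact: h2.
Qed.

Lemma measurable_config_comp d (U : measurableType d) (f : U -> config) (q : R) (k : nat) :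
  measurable_fun [set: U] f -> 0 < q -> measurable [set u | f u q = k].
Proof.
move=> mf q0; rewrite -[X in measurable X]setTI.
exact: (mf measurableT _ (measurable_config_eval k q0)).
Qed.

Lemma measurable_config_count (q : R) : 0 < q ->
  measurable_fun [set: config] (fun c => (c q)%:R : R).
Proof.
move=> q0 _ B mB; rewrite setTI.
rewrite (_ : _ @^-1` _ = \bigcup_(k in [set k : nat | B k%:R]) [set c : config | c q = k]).
  by apply: bigcup_measurable => k _; exact: measurable_config_eval.
by apply/seteqP; split => c /= => [Bc|[k /= Bk ->]//]; exists (c q).
Qed.

Let measurable_lt d (U : measurableType d) (z : U -> R) (q : R) : measurable_fun [set: U] z ->
  measurable [set u | q < z u].
Proof.
by move=> mz; rewrite -[X in measurable X]setTI; apply: measurable_fun_ltr.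
Qed.

Lemma measurable_insert_point d (U : measurableType d) (z : U -> R) (f : U -> config) :
  measurable_fun [set: U] z -> measurable_fun [set: U] f ->
  measurable_fun [set: U] (fun u => insert_point (z u) (f u)).
Proof.
move=> mz mf; apply: measurable_fun_config => q k q0.
rewrite (_ : [set u | _] = ([set u | q < z u] `&` (if k is k'.+1 then [set u | f u q = k'] else set0))
   `|` (~` [set u | q < z u] `&` [set u | f u q = k])); last first.
  apply/seteqP; split => u /=; rewrite /insert_point; case: ltP => _ /=;
    rewrite ?addn1 ?addn0.
  - by move=> <-; left.
  - by move=> ->; right.
  - by case: k => [|k] [] [] //= _ ->.
  - by case: k => [|k] [] [].
apply: measurableU; apply: measurableI.
- exact: measurable_lt.
- by case: k => // k; exact: measurable_config_comp.
- by apply: measurableC; exact: measurable_lt.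
- exact: measurable_config_comp.
Qed.

Lemma measurable_remove_point d (U : measurableType d) (z : U -> R) (f : U -> config) :
  measurable_fun [set: U] z -> measurable_fun [set: U] f ->
  measurable_fun [set: U] (fun u => remove_point (z u) (f u)).
Proof.
move=> mz mf; apply: measurable_fun_config => q k q0.
rewrite (_ : [set u | _] = ([set u | q < z u] `&` ([set u | f u q = k.+1] `|`
     (if k is 0%N then [set u | f u q = 0%N] else set0)))
   `|` (~` [set u | q < z u] `&` [set u | f u q = k])); last first.
  apply/seteqP; split => u /=; rewrite /remove_point; case: ltP => _ /=;
    rewrite ?subn1 ?subn0.
  - case E : (f u q) => [|m] /= <-; left; split => //; [right|left]; by rewrite /= ?E.
  - by move=> ->; right.
  - by move=> [[_ []]|[]//]; [move=> ->|case: k => //= ->].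
  - by move=> [[]//|[_ ->]].
apply: measurableU; apply: measurableI.
- exact: measurable_lt.
- apply: measurableU; first exact: measurable_config_comp.
  by case: k => // ; exact: measurable_config_comp.
- by apply: measurableC; exact: measurable_lt.
- exact: measurable_config_comp.
Qed.

Let rats : nat -> rat := sval rat_enumeration.

(** The same generalized inverse as in [ranked], applied to integer counts: its supremum is the k-th
    largest point, now as a measurable function of the configuration. *)
Let lower (k : nat) (c : config) (n : nat) : \bar R :=
  if (0 < rats n) && (k < c (ratr (rats n)))%N then (ratr (rats n))%:E else 0%E.

Definition point (k : nat) (c : config) : R := fine (esups (lower k c) 0%N).

Lemma measurable_point k : measurable_fun [set: config] (point k).
Proof.
apply: measurableT_comp => //; apply: measurable_fun_esups => n.
apply: measurable_fun_ifT => //.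
have [n0|_] := boolP (0 < rats n) => //=.
have m k' : measurable [set c : config | c (ratr (rats n)) = k'].
  by apply: measurable_config_eval; rewrite ltr0q.
apply: (measurable_fun_bool true); rewrite setTI.
rewrite (_ : _ @^-1` _ = \bigcup_(k' in [set k' | (k < k')%N]) [set c : config | c (ratr (rats n)) = k']).
  exact: bigcup_measurable.
by apply/seteqP; split => c /= => [kc|[k' /= kk' ->]//]; exists (c (ratr (rats n))).
Qed.

Definition counts y (c : config) : Prop := forall q, 0 < q -> (c q)%:R%:E = cnt y q.

Lemma point_counts y c k : (forall i, y i.+1 <= y i) -> 0 <= y k -> counts y c -> point k c = y k.
Proof.
move=> yi y0 yc; rewrite /point.
have lt q : 0 < q -> (k < c q)%N = (q < y k).
  by move=> q0; rewrite -(lt_cnt_nonincreasing _ _ yi) -yc// lte_fin ltr_nat.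
suff -> : esups (lower k c) 0%N = (y k)%:E by [].
apply/eqP; rewrite eq_le; apply/andP; split.
  apply: ge_ereal_sup => _ [n _ <-]; rewrite /lower; case: ifPn => [/andP[n0]|_]; last by rewrite lee_fin.
  by rewrite lt ?ltr0q// lee_fin => /ltW.
rewrite leNgt; apply/negP => h.
have e0 : (0%R <= esups (lower k c) 0%N)%E.
  apply: (@le_trans _ _ (lower k c 0%N)).
    by rewrite /lower; case: ifPn => // /andP[n0 _]; rewrite lee_fin ltW// ltr0q.
  by apply: ereal_sup_ubound; exists 0%N.
case E : (esups _ _) h e0 => [e| |]//; rewrite lte_fin lee_fin => ey e0.
have /rat_in_itvoo[q] := ey; rewrite in_itv/= => /andP[eq qy].
have q0 : 0 < q by rewrite -(@ltr0q R); exact: le_lt_trans eq.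
have [n rn] : exists n, rats n = q by rewrite /rats; case: rat_enumeration => en he; exact: he.
have : ((ratr q)%:E <= e%:E :> \bar R)%E.
  rewrite -E; apply: ereal_sup_ubound; exists n => //.
  by rewrite /lower rn q0 lt ?qy// ltr0q.
by rewrite lee_fin leNgt eq.
Qed.

Lemma nneseries_bump (f : nat -> \bar R) i : (forall k, 0 <= f k)%E ->
  (\sum_(k <oo) f (bump i k) = \sum_(k <oo | k != i) f k)%E.
Proof.
move=> f0; rewrite nneseries_esumT; last by move=> k; exact: f0.
rewrite nneseries_esum; last by move=> k _; exact: f0.
rewrite (reindex_esum [set: nat] [set k | k != i] (bump i))//.
split=> [k _|k l _ _|k /= ki]; first by rewrite /= eq_sym neq_bump.
  exact: (can_inj (@bumpK i)).
by exists (unbump i k) => //; rewrite unbumpK.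
Qed.

Lemma permutes_sum y w (f : R -> \bar R) : (forall r, 0 <= f r)%E -> permutes y w ->
  (\sum_(k <oo) f (w k) = \sum_(k <oo) f (y k))%E.
Proof.
move=> f0 [s [s' [sK s'K wy]]].
rewrite [LHS]nneseries_esumT; last by move=> k; exact: f0.
rewrite [RHS]nneseries_esumT; last by move=> k; exact: f0.
rewrite [RHS](reindex_esum [set: nat] [set: nat] s)//; last first.
  by split=> // [k l _ _|k _]; [exact: can_inj|exists (s' k)].
by apply: eq_esum => k _; rewrite wy.
Qed.

Definition proper_seq y : Prop := nonincreasing_to0 y /\ forall k, 0 < y k.

(** The last clause serves for several f at once: indicators give the new counts, the absolute value
    gives the new total mass. *)
Lemma counts_insert y c z : proper_seq y -> counts y c -> 0 < z ->
  exists y', [/\ proper_seq y', counts y' (insert_point z c)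
    & forall f : R -> \bar R, (forall r, 0 <= f r)%E ->
        (\sum_(k <oo) f (y' k) = f z + \sum_(k <oo) f (y k))%E].
Proof.
move=> [yi y0] yc z0.
have [|w yw wi] := @insert_sorted _ (scons z y) 0 z0; first exact: yi.
have ws (f : R -> \bar R) : (forall r, 0 <= f r)%E -> (\sum_(k <oo) f (w k) = f z + \sum_(k <oo) f (y k))%E.
  move=> f0; rewrite (permutes_sum f0 yw) nneseries_recl//; congr (_ + _)%E.
  by rewrite -(nneseries_addn 1)//; apply: eq_eseriesr => i _; rewrite addn1.
exists w; split=> //.
  split=> // k; case: yw => s [_ [_ _ ->]]; case: (s k) => [|j]; [exact: z0|exact: y0].
move=> q q0; rewrite /cnt (ws (fun r => (q < r)%R%:R%:E))// -/(cnt y q) -yc//.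
by rewrite /insert_point natrD EFinD addeC.
Qed.

Lemma counts_remove y c i : proper_seq y -> counts y c ->
  proper_seq (y \o bump i) /\ counts (y \o bump i) (remove_point (y i) c).
Proof.
move=> [[yi y1] y0] yc; split.
  split=> [|k]; last exact: y0; split=> [k l kl|e e0]; first by rewrite /= yi// bump_homo.
  have [k yk] := y1 _ e0; exists k; apply: le_lt_trans yk; apply: yi; exact: leq_addl.
move=> q q0; rewrite /cnt (@nneseries_bump (fun k => (q < y k)%R%:R%:E))//.
have h := yc q q0; rewrite /cnt (@nneseriesD1 _ _ i xpredT)// in h.
rewrite /remove_point; case: (boolP (q < y i)) h => qi /=; rewrite ?add0e ?subn0//.
rewrite subn1 => h.
have c0 : (0 < c q)%N.
  rewrite lt0n; apply/eqP => cq; move: h; rewrite cq => h.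
  have := @leeDl _ 1%E (\sum_(k <oo | k != i) ((q < y k)%R%:R%:E : \bar R))%E.
  by rewrite -h lee_fin ler10 nneseries_ge0// => /(_ isT).
by rewrite -[RHS](@addeK _ 1%E)// (addeC _ 1%E) -[X in (X - _)%E]h -EFinB -[X in (_ - X)]/(1%:R) -natrB// subn1.
Qed.

End configurations.

Section tally.
Context (R : realType).
Implicit Types (y : nat -> R).

(** A proper sequence has finitely many terms above each positive level, so [fine] and the integer
    part only change the type of the count. *)
Definition tally y : config R := fun q => Num.truncn (fine (cnt y q)).

Lemma counts_tally y : proper_seq y -> counts y (tally y).
Proof.
move=> [[yi y1] y0] q q0.
have [p yp pmin] : exists2 p, y p <= q & forall k, (k < p)%N -> q < y k.
  have [k yk] := y1 _ q0.
  have /ex_minnP[p yp pmin] : exists k, y k <= q by exists k; exact: ltW.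
  by exists p => // l kp; rewrite ltNge; apply/negP => /pmin; rewrite leqNgt kp.
have E : cnt y q = p%:R%:E.
  rewrite /cnt (nneseries_split _ p)// add0n [X in (_ + X)%E]eseries0 ?adde0; last first.
    by move=> i pi _; rewrite ltNge (le_trans (yi _ _ pi) yp).
  rewrite (eq_big_nat _ _ (F2 := fun=> 1%:E)).
    by rewrite sumEFin sumr_const_nat subn0.
  by move=> i /andP[_ ip]; rewrite pmin.
by rewrite E /tally E /= (@truncn_def _ _ p)// lexx ltr_nat ltnSn.
Qed.

End tally.

(** * Grids of levels, cells and Poisson weights *)

Section increments.
Implicit Types (c : nat -> nat).

(** If [c i] counts the points above the i-th level of a decreasing grid, these are the numbers of
    points in the cells between consecutive levels. *)
Definition increment c (i : nat) : nat := if i is i'.+1 then (c i - c i')%N else c 0%N.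

Lemma sum_increment c n : (forall i, (i.+1 < n)%N -> (c i <= c i.+1)%N) ->
  forall i, (i < n)%N -> (\sum_(j < i.+1) increment c j)%N = c i.
Proof.
move=> ci; elim=> [|i IH] ii; first by rewrite big_ord1.
by rewrite big_ord_recr/= IH ?subnKC ?ci// ltnW.
Qed.

(** Counts are the partial sums of their increments. Monotonicity is essential, since subtraction of
    natural numbers is truncated. *)
Lemma eq_increment c c' n : (forall i, (i.+1 < n)%N -> (c i <= c i.+1)%N) ->
  (forall i, (i.+1 < n)%N -> (c' i <= c' i.+1)%N) ->
  (forall i, (i < n)%N -> c i = c' i) <->
  (forall i, (i < n)%N -> increment c i = increment c' i).
Proof.
move=> ci ci'; split=> h i ii; last first.
  rewrite -(sum_increment ci ii) -(sum_increment ci' ii); apply: eq_bigr => j _.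
  by apply: h; exact: leq_trans (ltn_ord j) ii.
by case: i ii => [|i] ii /=; rewrite !h// ltnW.
Qed.

(** A point in cell j raises the count at every later level, that is for k >= j, but the number of
    points of cell j only. *)
Lemma increment_step c j i : (forall i', i = i'.+1 -> (c i' <= c i)%N) ->
  increment (fun k => (c k + (j <= k))%N) i = (increment c i + (i == j))%N.
Proof.
case: i => [|i] /= ci; first by rewrite leqn0 eq_sym.
have {}ci := ci _ erefl; have [ji|ij] := leqP j i.
  by rewrite (leqW ji)/= subnDr gtn_eqF ?addn0// ltnS.
rewrite addn0 (_ : (j <= i.+1)%N = (i.+1 == j)); last by rewrite eqn_leq ij.
by case: eqP => _; rewrite ?addn0// !addn1 subSn.
Qed.

End increments.

Section poisson_weight.
Context (R : realType).

(** The source of the Mecke formula: weighting by the number of points in a cell amounts to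
    inserting one more point, with the mean mass r of the cell as weight. *)
Lemma poisson_weightS (r : R) k :
  k.+1%:R * poisson_weight r k.+1 = r * poisson_weight r k.
Proof.
rewrite /poisson_weight factS natrM exprS; field.
by rewrite -[1 + _]/(1%:R + k%:R) -natrD !pnatr_eq0 -!lt0n fact_gt0.
Qed.

Lemma poisson_weight_prod n (r : 'I_n -> R) (k : 'I_n -> nat) (j : 'I_n) :
  (0 < k j)%N ->
  (k j)%:R * \prod_(i < n) poisson_weight (r i) (k i) =
  r j * \prod_(i < n) poisson_weight (r i) (k i - (i == j))%N.
Proof.
move=> kj; rewrite (bigD1 j)//= [in RHS](bigD1 j)//= eqxx subn1 [LHS]mulrA [RHS]mulrA.
rewrite -[in LHS](prednK kj) poisson_weightS; congr (_ * _).
by apply: eq_bigr => i /negbTE ->; rewrite subn0.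
Qed.

End poisson_weight.

Section cells.
Context (R : realType) (s : seq R).
Hypotheses (s_sorted : sorted (fun x y => y < x) s) (s0 : all (fun q => 0 < q) s).
Local Notation p := (nth 0 s).

(** For a decreasing grid, the cells 0, ..., i partition the ray above the i-th level; cell 0 is
    unbounded. *)
Definition cell (i : nat) : set R :=
  if i is i'.+1 then `]p i, p i']%classic else `]p 0%N, +oo[%classic.

Lemma grid_gt0 i : (i < size s)%N -> 0 < p i.
Proof. by move=> si; apply: (allP s0); exact: mem_nth. Qed.

Lemma grid_decr i j : (i < j)%N -> (j < size s)%N -> p j < p i.
Proof.
move=> ij js; apply: (sorted_ltn_nth _ _ s_sorted) => //; last by rewrite inE (ltn_trans ij).
by move=> a b c ab bc; exact: lt_trans bc ab.
Qed.

Lemma measurable_cell i : measurable (cell i).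
Proof. by case: i => [|i]; exact: measurable_itv. Qed.

Lemma cellP i y : (i < size s)%N ->
  cell i y <-> p i < y /\ forall i', i = i'.+1 -> y <= p i'.
Proof.
case: i => [|i] si; rewrite /cell/= in_itv/= ?andbT; first by split=> [|[]].
by split=> [/andP[h1 h2]|[-> h]]; [split=> // _ [<-]|rewrite h].
Qed.

Lemma cell_ray i j y : (i < size s)%N -> (j < size s)%N -> cell j y -> (p i < y) = (j <= i)%N.
Proof.
move=> si sj /(cellP _ sj)[h1 h2]; apply/idP/idP => [py|].
  rewrite leqNgt; apply/negP => ij; case: j sj h1 h2 ij => // j sj h1 h2 ij.
  have := lt_le_trans py (h2 _ erefl); rewrite ltNge => /negP; apply.
  by move: ij; rewrite ltnS leq_eqVlt => /predU1P[->//|ij]; apply/ltW/grid_decr => //; exact: ltnW.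
by rewrite leq_eqVlt => /predU1P[<-//|ji]; apply: lt_trans h1; exact: grid_decr.
Qed.

Lemma cell_gt0 i : (i < size s)%N -> cell i `<=` `]0, +oo[.
Proof.
move=> si y /(cellP _ si)[py _]; rewrite /= in_itv/= andbT.
by apply: lt_trans py; exact: grid_gt0.
Qed.

Lemma trivIset_cell : trivIset [set: 'I_(size s)] (fun i => cell i).
Proof.
move=> i j _ _ [y [ci cj]]; apply: val_inj; apply: anti_leq.
rewrite -(cell_ray (ltn_ord j) (ltn_ord i) ci) -(cell_ray (ltn_ord i) (ltn_ord j) cj).
have /(cellP _ (ltn_ord i))[-> _] := ci.
by have /(cellP _ (ltn_ord j))[-> _] := cj.
Qed.

Lemma rayS i : (i.+1 < size s)%N ->
  `]p i.+1, +oo[%classic = `]p i, +oo[%classic `|` cell i.+1.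
Proof.
move=> si; have pp := grid_decr (ltnSn i) si.
apply/seteqP; split => y /=; rewrite !in_itv/= !andbT.
  by move=> h; case: ltP => yp; [left|right; rewrite h].
by move=> [|/andP[]//]; exact: lt_trans.
Qed.

Lemma ray_cell_disj i : [disjoint `]p i, +oo[%classic & cell i.+1].
Proof.
apply/disj_setPS => y /=; rewrite !in_itv/= andbT => -[yp /andP[_]].
by rewrite leNgt yp.
Qed.

End cells.

Section gamma.
Context (R : realType).
Local Notation leb := (@lebesgue_measure R).

Lemma measurable_fun_inv_ge0 d (U : measurableType d) (f : U -> R) : measurable_fun [set: U] f ->
  (forall u, 0 <= f u) -> measurable_fun [set: U] (fun u => (f u)^-1).
Proof.
move=> mf f0; rewrite (_ : (fun u => _) = (fun u => f u `^ (-1))).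
  exact: (measurableT_comp (measurable_powR _) mf).
by apply/funext => u; rewrite powR_inv1.
Qed.

Context (theta : R).
Hypothesis theta0 : 0 < theta.

(* Since [0^-1 = 0], this vanishes outside the open half-line. *)
Definition gamma_density (y : R) : R := theta * (Num.max y 0)^-1 * expR (- y).

Lemma gamma_density_ge0 y : 0 <= gamma_density y.
Proof. by rewrite !mulr_ge0 ?expR_ge0 ?invr_ge0 ?le_max ?lexx ?orbT// ltW. Qed.

Lemma gamma_densityE y : 0 < y -> gamma_density y = theta * y^-1 * expR (- y).
Proof. by move=> y0; rewrite /gamma_density max_l// ltW. Qed.

Lemma gamma_density_le0 y : y <= 0 -> gamma_density y = 0.
Proof. by move=> y0; rewrite /gamma_density max_r// invr0 mulr0 mul0r. Qed.

Lemma measurable_gamma_density : measurable_fun [set: R] gamma_density.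
Proof.
apply: measurable_funM; last by apply: measurableT_comp => //.
apply: measurable_funM => //; apply: measurable_fun_inv_ge0.
  exact: measurable_maxr.
by move=> y; rewrite le_max lexx orbT.
Qed.

Lemma gamma_intensityE (B : set R) : B `<=` `]0, +oo[ ->
  gamma_intensity theta B = (\int[leb]_(y in B) (gamma_density y)%:E)%E.
Proof.
move=> B0; apply: eq_integral => y; rewrite inE => /B0; rewrite /= in_itv/= andbT => y0.
by rewrite gamma_densityE.
Qed.

(** Above p the density is at most theta / p times the exponential density. The singularity at 0 is
    why only rays starting at positive levels are used. *)
Lemma gamma_density_ray (p : R) : 0 < p ->
  (\int[leb]_(y in `]p, +oo[) (gamma_density y)%:E < +oo)%E.
Proof.
move=> p0; apply: (@le_lt_trans _ _ (\int[leb]_y ((theta / p) * exponential_pdf 1 y)%:E)%E).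
  rewrite integral_mkcond; apply: ge0_le_integral => //.
  - by move=> y _; rewrite patchE; case: ifP => // _; rewrite lee_fin gamma_density_ge0.
  - apply: (measurable_restrictT _ _).1 => //.
    by apply: measurable_funTS; apply/measurable_EFinP; exact: measurable_gamma_density.
  - apply/measurable_EFinP; apply: measurable_funM => //; exact: measurable_exponential_pdf.
  move=> y _; rewrite patchE; case: ifPn => [|_]; last first.
    by rewrite lee_fin mulr_ge0 ?exponential_pdf_ge0// divr_ge0// ltW.
  rewrite inE/= in_itv/= andbT => py; have y0 := lt_trans p0 py.
  rewrite lee_fin gamma_densityE// exponential_pdfE; last exact: ltW.
  rewrite mul1r mulN1r.
  by rewrite ler_wpM2r ?expR_ge0// ler_pM2l// lef_pV2// ?posrE// ltW.
under eq_integral do rewrite EFinM.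
rewrite ge0_integralZl//; last 3 first.
- by apply/measurable_EFinP; exact: measurable_exponential_pdf.
- by move=> y _; rewrite lee_fin exponential_pdf_ge0.
- by rewrite lee_fin divr_ge0// ltW.
by rewrite integral_exponential_pdf// mule1 ltry.
Qed.

End gamma.

(** * The Mecke formula *)

Lemma ae_eq_probability d (T : measurableType d) (R : realType) (P : probability T R)
    (A B : set T) : measurable A -> measurable B -> {ae P, forall w, A w <-> B w} -> P A = P B.
Proof.
move=> mA mB AB.
have E C : measurable C -> P C = (\int[P]_w (\1_C w)%:E)%E by move=> mC; rewrite integral_indic// setIT.
rewrite !E//; apply: ge0_ae_eq_integral => //.
- by apply/measurable_EFinP; exact: measurable_indic.
- by apply/measurable_EFinP; exact: measurable_indic.
move: AB; apply: filterS => w AB _; rewrite !indicE; congr (nat_of_bool _)%:R%:E.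
by apply/idP/idP; rewrite !inE => /AB.
Qed.

Section random_tally.
Context (R : realType) d (T : measurableType d) (P : probability T R) (Y : nat -> {RV P >-> R}).

Definition random_tally (w : T) : config R := tally (fun i => Y i w).

Lemma measurable_random_tally : measurable_fun [set: T] random_tally.
Proof.
apply: measurable_fun_config => q k q0.
pose f w := fine (cnt (fun i => Y i w) q).
have f0 w : 0 <= f w by rewrite fine_ge0// cnt_ge0.
have mf : measurable_fun [set: T] f.
  apply: measurableT_comp => //; apply: ge0_emeasurable_sum => // i _.
  by apply: measurable_ind.
rewrite (_ : [set w | _] = f @^-1` `[k%:R, k.+1%:R[).
  by rewrite -[X in measurable X]setTI; exact: mf.
apply/seteqP; split => w /=; rewrite in_itv /random_tally /tally -/(f w) => /=.
  by move=> <-; exact: truncn_itv.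
exact: truncn_def.
Qed.

Lemma measurable_point_measure (B : set R) : measurable B ->
  measurable_fun [set: T] (fun w => point_measure (fun i => Y i w) B).
Proof.
move=> mB; under eq_fun do rewrite point_measureE.
apply: ge0_emeasurable_sum => // i _; apply/measurable_EFinP.
rewrite (_ : (fun w => _) = \1_(B `&` `]0, +oo[) \o Y i).
  by apply: measurableT_comp => //; apply: measurable_indic; exact: measurableI.
apply/funext => w; rewrite /= indicE in_setI andbC; congr (nat_of_bool (_ && _))%:R.
by apply/idP/idP; rewrite inE/= in_itv/= andbT.
Qed.

End random_tally.

Section grid_identity.
Context (R : realType) (theta : R) d (T : measurableType d) (P : probability T R)
  (Y : nat -> {RV P >-> R}).
Hypothesis theta0 : 0 < theta.
Hypothesis poisson :
  poisson_process P (fun w => point_measure (fun i => Y i w)) (gamma_intensity theta).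
Hypothesis proper : {ae P, forall w, proper_seq (fun i => Y i w)}.
Local Notation leb := (@lebesgue_measure R).
Local Notation kappa := (random_tally Y).

Context (s : seq R) (c : R -> nat).
Hypotheses (s_sorted : sorted (fun x y => y < x) s) (s0 : all (fun q => 0 < q) s).
Local Notation p := (nth 0 s).
Local Notation n := (size s).

Let ray_point_measure y (a : R) : 0 <= a -> point_measure y `]a, +oo[%classic = cnt y a.
Proof.
move=> a0; rewrite point_measureE.
apply: eq_eseriesr => i _; congr (_%:R%:E).
rewrite (_ : (y i \in `]a, +oo[%classic) = (a < y i)); last first.
  by apply/idP/idP; rewrite inE/= in_itv/= andbT.
by congr nat_of_bool; apply/andP/idP => [[]//|ax]; split=> //; exact: le_lt_trans ax.
Qed.

Let cell_count y (c' : config R) i : (i < n)%N -> counts y c' ->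
  (forall i', i = i'.+1 -> (c' (p i') <= c' (p i))%N) /\
  point_measure y (cell s i) = (increment (fun k => c' (p k)) i)%:R%:E.
Proof.
move=> si yc; have pc i' : (i' < n)%N -> point_measure y `]p i', +oo[%classic = (c' (p i'))%:R%:E.
  by move=> i'n; have p0 := grid_gt0 s0 i'n; rewrite ray_point_measure ?yc// ltW.
case: i si => [|i] si; first by split=> //; exact: pc.
have i'n := ltnW si.
have : (point_measure y `]p i.+1, +oo[%classic = point_measure y `]p i, +oo[%classic + point_measure y (cell s i.+1))%E.
  rewrite (rayS s_sorted si) measureU//; first exact: measurable_cell.
  by apply/disj_set2P/ray_cell_disj.
rewrite !pc// => h.
have le : (c' (p i) <= c' (p i.+1))%N.
  by rewrite -(ler_nat R) -lee_fin h leeDl.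
split => [_ [<-]//|] /=.
by rewrite -[LHS](@addeK _ (c' (p i))%:R%:E)// [X in (X - _)%E]addeC -h -EFinB -natrB.
Qed.

Let m i : R := fine (gamma_intensity theta (cell s i)).
Let C i : nat := c (p i).
Let weight (k : nat -> nat) : R := \prod_(i < n) poisson_weight (m i) (k i).
Let cells_event (k : nat -> nat) : set T :=
  [set w | forall i : 'I_n, point_measure (fun i => Y i w) (cell s i) = (k i)%:R%:E].

Let cell_fin i : (i < n)%N -> (gamma_intensity theta (cell s i) < +oo)%E.
Proof.
move=> si; rewrite gamma_intensityE; last exact: cell_gt0.
apply: le_lt_trans (gamma_density_ray theta0 (grid_gt0 s0 si)).
apply: ge0_subset_integral => //.
- exact: measurable_cell.
- by apply/measurable_EFinP; apply: measurable_funTS; exact: measurable_gamma_density.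
- by move=> y _; rewrite lee_fin gamma_density_ge0.
by move=> y /(cellP _ si)[py _]; rewrite /= in_itv/= andbT.
Qed.

Let prob_cells k : P (cells_event k) = (weight k)%:E.
Proof.
apply: (@poisson n (fun i => cell s i) (fun i => k i)).
- by move=> i; exact: measurable_cell.
- by move=> i; exact: cell_gt0.
- exact: trivIset_cell.
- by move=> i; exact: cell_fin.
Qed.

Let measurable_cells_event k : measurable (cells_event k).
Proof.
rewrite (_ : cells_event k = \bigcap_(i in [set: 'I_n])
   ((fun w => point_measure (fun i => Y i w) (cell s i)) @^-1` [set (k i)%:R%:E])); last first.
  by apply/seteqP; split => w /= h i; [move=> _; exact: h|exact: h].
apply: fin_bigcap_measurable => [|i _]; first exact: finite_finset.
rewrite -[X in measurable X]setTI; apply: measurable_point_measure => //.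
exact: measurable_cell.
Qed.

Let cylinderP (c' : config R) : cylinder s c c' <-> forall i, (i < n)%N -> c' (p i) = C i.
Proof.
split=> [h i si|h q /(nthP 0)[i si <-]]; last exact: h.
by apply: h; exact: mem_nth.
Qed.

Let measurable_cylinder : measurable (cylinder s c : set (config R)).
Proof. by apply: sub_sigma_algebra; right; exists s, c. Qed.

Let measurable_kappa_cylinder (f : config R -> config R) :
  measurable_fun [set: T] (f \o kappa) -> measurable [set w | cylinder s c (f (kappa w))].
Proof. by move=> mf; rewrite -[X in measurable X]setTI; exact: mf. Qed.

Definition insert_prob (y : R) : \bar R := P [set w | cylinder s c (insert_point y (kappa w))].

Lemma measurable_insert_prob : measurable_fun [set: R] insert_prob.
Proof.
pose A := [set t : R * T | cylinder s c (insert_point t.1 (kappa t.2))].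
have mA : measurable A.
  have mi : measurable_fun [set: R * T] (fun t => insert_point t.1 (kappa t.2)).
    apply: measurable_insert_point => //.
    by apply: (measurableT_comp (measurable_random_tally _)).
  by rewrite -[X in measurable X]setTI; exact: mi.
rewrite (_ : insert_prob = P \o xsection A); first exact: measurable_fun_xsection.
apply/funext => y; rewrite /insert_prob/=; congr (P _).
by apply/seteqP; split=> w; rewrite /xsection/= inE.
Qed.

Section monotone_cylinder.
Hypothesis C_mono : forall i, (i.+1 < n)%N -> (C i <= C i.+1)%N.

(** Prescribing the counts at the levels is the same as prescribing the numbers of points in the
    cells, which are disjoint sets of finite mean measure. *)
Lemma cylinder_prob : P [set w | cylinder s c (kappa w)] = (weight (increment C))%:E.
Proof.
rewrite -prob_cells; apply: ae_eq_probability => //.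
  by apply: (@measurable_kappa_cylinder id); exact: measurable_random_tally.
move: proper; apply: filterS => w /counts_tally yc /=.
rewrite cylinderP (@eq_increment (fun i => kappa w (p i)) C) //; last first.
  by move=> i si; have [/(_ _ erefl)] := cell_count si yc.
split=> [h i|h i si].
  by have [_ ->] := cell_count (ltn_ord i) yc; rewrite h.
have := h (Ordinal si); have [_ ->] /= := cell_count si yc.
by move=> [/eqP]; rewrite eqr_nat => /eqP.
Qed.

(** The inserted point is one of the points prescribed in cell j, which must then hold one fewer of
    its own; the event is null if cell j is prescribed to be empty. The value depends on y through
    its cell only. *)
Lemma cylinder_prob_insert j y : (j < n)%N -> cell s j y ->
  P [set w | cylinder s c (insert_point y (kappa w))] =
  (if (0 < increment C j)%N then weight (fun i => increment C i - (i == j))%N else 0)%:E.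
Proof.
move=> jn jy.
have mins : measurable [set w | cylinder s c (insert_point y (kappa w))].
  apply: measurable_kappa_cylinder; apply: measurable_insert_point => //.
  exact: measurable_random_tally.
have key : {ae P, forall w, cylinder s c (insert_point y (kappa w)) <->
   forall i, (i < n)%N -> (increment (fun k => kappa w (p k)) i + (i == j))%N = increment C i}.
  move: proper; apply: filterS => w /counts_tally yc /=.
  have mono i : (i < n)%N -> forall i', i = i'.+1 -> (kappa w (p i') <= kappa w (p i))%N.
    by move=> si; have [] := cell_count si yc.
  rewrite cylinderP.
  have E i : (i < n)%N -> insert_point y (kappa w) (p i) = (kappa w (p i) + (j <= i))%N.
    by move=> si; rewrite /insert_point (cell_ray s_sorted si jn jy).
  have -> : (forall i, (i < n)%N -> insert_point y (kappa w) (p i) = C i) <->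
            (forall i, (i < n)%N -> (kappa w (p i) + (j <= i))%N = C i).
    by split=> h i si; have := h i si; rewrite E.
  rewrite (@eq_increment (fun i => (kappa w (p i) + (j <= i))%N) C)//; last first.
    move=> i si; rewrite leq_add ?(mono _ si)//.
    by case: (leqP j i) => // ji; rewrite leqW.
  by split=> h i si; rewrite -h// increment_step// => i' ii'; apply: mono.
case: ifPn => Cj; last first.
  rewrite (_ : 0%:E = P set0); last by rewrite measure0.
  apply: ae_eq_probability => //; move: key; apply: filterS => w /= ->; split=> //.
  by move=> /(_ _ jn); rewrite eqxx addn1 => E; rewrite -E in Cj.
rewrite -prob_cells; apply: ae_eq_probability => //; move: key proper; apply: filterS2.
move=> w /= -> /counts_tally yc /=; split=> [h i|h i si].
  by have [_ ->] := cell_count (ltn_ord i) yc; rewrite -h// addnK.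
have := h (Ordinal si); have [_ ->] /= := cell_count si yc.
move=> [/eqP]; rewrite eqr_nat => /eqP ->; case: eqP => [->|_]; last by rewrite subn0 addn0.
by rewrite subn1 addn1 prednK.
Qed.

(** The probability is constant on the cell, so the integral is the mean mass of the cell times a
    product of weights with one point fewer; [poisson_weight_prod] restores the point. *)
Let integral_cell j : (j < n)%N -> (\int[leb]_(y in cell s j) ((gamma_density theta y)%:E * insert_prob y) =
  ((increment C j)%:R * weight (increment C))%:E)%E.
Proof.
move=> jn; pose V := (if (0 < increment C j)%N then weight (fun i => increment C i - (i == j))%N else 0).
have mg : measurable_fun (cell s j) (fun y => (gamma_density theta y)%:E).
  by apply/measurable_EFinP; apply: measurable_funTS; exact: measurable_gamma_density.
have g0 y : cell s j y -> (0 <= (gamma_density theta y)%:E)%E by rewrite lee_fin gamma_density_ge0.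
have w0 k : 0 <= weight k by rewrite -lee_fin -prob_cells.
have V0 : 0 <= V by rewrite /V; case: ifP.
transitivity (\int[leb]_(y in cell s j) (V%:E * (gamma_density theta y)%:E))%E.
  apply: eq_integral => y; rewrite inE => jy.
  by rewrite /insert_prob (cylinder_prob_insert jn jy) muleC.
rewrite ge0_integralZl//; last exact: measurable_cell.
rewrite -gamma_intensityE; last exact: cell_gt0.
have gf : gamma_intensity theta (cell s j) = (m j)%:E.
  rewrite fineK// ge0_fin_numE ?cell_fin// gamma_intensityE; last exact: cell_gt0.
  exact: integral_ge0.
rewrite gf -EFinM; congr EFin; rewrite /V; case: ifPn => Cj; last first.
  by move: Cj; rewrite -leqNgt leqn0 => /eqP ->; rewrite !mul0r.
by rewrite mulrC; apply/esym; exact: (poisson_weight_prod (fun i => m i) (k := fun i => increment C i) (j := Ordinal jn)).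
Qed.

Let integral_ray i : (i < n)%N ->
  (\int[leb]_(y in `]p i, +oo[) ((gamma_density theta y)%:E * insert_prob y) =
  ((\sum_(j < i.+1) increment C j)%:R * weight (increment C))%:E)%E.
Proof.
elim: i => [|i IH] si; first by rewrite big_ord1 -integral_cell.
have mu : measurable_fun [set: R] (fun y => (gamma_density theta y)%:E * insert_prob y)%E.
  apply: emeasurable_funM; last exact: measurable_insert_prob.
  by apply/measurable_EFinP; exact: measurable_gamma_density.
rewrite (rayS s_sorted si) ge0_integral_setU//; last 4 first.
- exact: measurable_cell.
- exact: measurable_funTS.
- by move=> y _; rewrite mule_ge0// lee_fin gamma_density_ge0.
- exact: ray_cell_disj.
by rewrite IH 1?ltnW// integral_cell// [in RHS]big_ord_recr/= natrD mulrDl EFinD.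
Qed.

(** The cells 0, ..., i make up the ray, and their prescribed numbers of points add up to the count
    prescribed at its level. *)
Lemma monotone_cylinder_mecke i : (i < n)%N ->
  (\int[P]_w ((kappa w (p i))%:R * \1_(cylinder s c : set (config R)) (kappa w))%:E =
   \int[leb]_(y in `]p i, +oo[) ((gamma_density theta y)%:E * insert_prob y))%E.
Proof.
move=> si; rewrite integral_ray// (sum_increment C_mono si) EFinM -cylinder_prob.
transitivity (\int[P]_w ((C i)%:R%:E * (\1_([set w | cylinder s c (kappa w)]) w)%:E))%E.
  apply: eq_integral => w _; rewrite -EFinM !indicE.
  rewrite (_ : (w \in [set w | cylinder s c (kappa w)]) = (kappa w \in cylinder s c)); last first.
    by apply/idP/idP; rewrite !inE.
  case: (boolP (_ \in _)) => [|_]; last by rewrite !mulr0.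
  by rewrite inE => /cylinderP ->.
have mk : measurable [set w | cylinder s c (kappa w)].
  by apply: (@measurable_kappa_cylinder id); exact: measurable_random_tally.
rewrite ge0_integralZl//; last by apply/measurable_EFinP; exact: measurable_indic.
by rewrite integral_indic// setIT.
Qed.

End monotone_cylinder.

(** Prescribed counts that decrease somewhere along the grid are impossible, with or without an
    inserted point, and both sides vanish. *)
Lemma grid_mecke i : (i < n)%N ->
  (\int[P]_w ((kappa w (p i))%:R * \1_(cylinder s c : set (config R)) (kappa w))%:E =
   \int[leb]_(y in `]p i, +oo[) ((gamma_density theta y)%:E * insert_prob y))%E.
Proof.
move=> si; have [/monotone_cylinder_mecke|] := pselect (forall i, (i.+1 < n)%N -> (C i <= C i.+1)%N).
  exact.
move=> /existsNP[j /not_implyP[sj /negP]]; rewrite -ltnNge => Cj.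
have mono w : proper_seq (fun i => Y i w) -> (kappa w (p j) <= kappa w (p j.+1))%N.
  by move=> /counts_tally yc; have [/(_ _ erefl)] := cell_count sj yc.
have ins0 y : insert_prob y = 0%E.
  rewrite /insert_prob -(measure0 P); apply: ae_eq_probability => //.
    apply: measurable_kappa_cylinder; apply: measurable_insert_point => //.
    exact: measurable_random_tally.
  move: proper; apply: filterS => w /mono mw; split=> // /cylinderP h.
  move: Cj; rewrite -(h _ sj) -(h _ (ltnW sj)) ltnNge => /negP; apply; rewrite leq_add//.
  have [py|] := boolP (p j < y) => //.
  by rewrite (lt_trans (grid_decr s_sorted (ltnSn j) sj) py).
rewrite [RHS]integral0_eq; last by move=> y _; rewrite ins0 mule0.
rewrite -(integral0 P [set: T]); apply: ge0_ae_eq_integral => //.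
- apply/measurable_EFinP; apply: measurable_funM; last first.
    apply: (measurableT_comp (measurable_indic measurable_cylinder)).
    exact: measurable_random_tally.
  apply: (measurableT_comp (measurable_config_count _)); first exact: grid_gt0.
  exact: measurable_random_tally.
move: proper; apply: filterS => w /mono mw _; rewrite indicE.
case: (boolP (_ \in _)) => [|_]; last by rewrite mulr0.
rewrite inE => /cylinderP h.
by move: Cj; rewrite -(h _ sj) -(h _ (ltnW sj)) ltnNge mw.
Qed.

End grid_identity.

(** * Generators of a product, density and image measures *)

Section product_generator.
Context d1 d2 (T1 : measurableType d1) (T2 : measurableType d2).
Context (G1 : set (set T1)) (G2 : set (set T2)) (g1 : nat -> set T1) (g2 : nat -> set T2).
Hypotheses (mG1 : measurable `<=` <<s G1 >>) (mG2 : measurable `<=` <<s G2 >>).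
Hypotheses (Gg1 : forall n, G1 (g1 n)) (Gg2 : forall n, G2 (g2 n)).
Hypotheses (cover1 : \bigcup_n g1 n = setT) (cover2 : \bigcup_n g2 n = setT).
Local Notation S := <<s [set A `*` B | A in G1 & B in G2] >>.

Let sigmaS : sigma_algebra setT S. Proof. exact: smallest_sigma_algebra. Qed.

Let S_bigcup (A : nat -> set (T1 * T2)) : (forall n, S (A n)) -> S (\bigcup_n A n).
Proof. have [_ _] := sigmaS; exact. Qed.

Let S_setD (A B : set (T1 * T2)) : S A -> S B -> S (A `\` B).
Proof.
exact: (@measurableD _ (g_sigma_algebraType [set A `*` B | A in G1 & B in G2])).
Qed.

Let bigcup_setXl (F : nat -> set T1) (B : set T2) :
  (\bigcup_n F n) `*` B = \bigcup_n (F n `*` B).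
Proof. by apply/seteqP; split => [[x y] [[n _ Fx] By]|[x y] [n _ [Fx By]]]; [exists n|split=> //; exists n]. Qed.

Let bigcup_setXr (A : set T1) (F : nat -> set T2) :
  A `*` (\bigcup_n F n) = \bigcup_n (A `*` F n).
Proof. by apply/seteqP; split => [[x y] [Ax [n _ Fy]]|[x y] [n _ [Ax Fy]]]; [exists n|split=> //; exists n]. Qed.

Let step1 A B : <<s G1 >> A -> G2 B -> S (A `*` B).
Proof.
move=> + GB; move: A.
have GS A : G1 A -> S (A `*` B) by move=> GA; apply: sub_sigma_algebra; exists A => //; exists B.
apply: (@smallest_sub _ _ _ [set A | S (A `*` B)]) => //; split => /=.
- by rewrite set0X; have [] := sigmaS.
- move=> A SA; rewrite (_ : (setT `\` A) `*` B = (setT `*` B) `\` (A `*` B)); last first.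
    apply/seteqP; split => -[x y] /=; first by move=> [[_ nA] By]; split=> // -[].
    by move=> [[_ By] nA]; do 2 split=> //; move=> Ax; apply: nA.
  apply: S_setD => //; rewrite -cover1 bigcup_setXl.
  by apply: S_bigcup => n; exact: GS.
- by move=> F SF; rewrite bigcup_setXl; exact: S_bigcup.
Qed.

Let step2 A B : <<s G1 >> A -> <<s G2 >> B -> S (A `*` B).
Proof.
move=> sA; move: B; apply: (@smallest_sub _ _ _ [set B | S (A `*` B)]).
  split => /=; first by rewrite setX0; have [] := sigmaS.
  - move=> B SB; rewrite (_ : A `*` (setT `\` B) = (A `*` setT) `\` (A `*` B)); last first.
      apply/seteqP; split => -[x y] /=; first by move=> [Ax [_ nB]]; split=> // -[].
      by move=> [[Ax _] nB]; do 2 split=> //; move=> By; apply: nB.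
    apply: S_setD => //; rewrite -cover2 bigcup_setXr.
    by apply: S_bigcup => n; exact: step1.
  - by move=> F SF; rewrite bigcup_setXr; exact: S_bigcup.
by move=> B GB; exact: step1.
Qed.

(** The countable covers by generators handle complements: (setT minus A) x B is the union of the g1
    n x B, minus A x B. One factor is extended at a time. *)
Lemma measurable_prod_generated : measurable `<=` S.
Proof.
rewrite measurable_prod_measurableType; apply: smallest_sub => //.
by move=> _ [A mA [B mB <-]]; apply: step2; [exact: mG1|exact: mG2].
Qed.

End product_generator.

Section density_measure.
Context d (U : measurableType d) (R : realType) (mu : {measure set U -> \bar R}) (f : U -> R).
Hypotheses (f0 : forall u, 0 <= f u) (mf : measurable_fun [set: U] f).

Definition density_measure (_ : forall u, 0 <= f u) (_ : measurable_fun [set: U] f)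
  (A : set U) : \bar R := (\int[mu]_(u in A) (f u)%:E)%E.

Local Notation rho := (density_measure f0 mf).

Let rho0 : rho set0 = 0%E. Proof. exact: integral_set0. Qed.

Let rho_ge0 A : (0 <= rho A)%E. Proof. by apply: integral_ge0 => u _; rewrite lee_fin. Qed.

Let rho_sigma_additive : semi_sigma_additive rho.
Proof.
move=> /= F mF tF mUF; rewrite /density_measure; apply: cvg_toP.
  apply: ereal_nondecreasing_is_cvgn => m n mn.
  by apply: lee_sum_nneg_natr => // k _ _; exact: rho_ge0.
rewrite ge0_integral_bigcup//=; last by move=> x _; rewrite lee_fin.
by apply/measurable_funTS/measurable_EFinP.
Qed.

HB.instance Definition _ := isMeasure.Build _ _ _ rho rho0 rho_ge0 rho_sigma_additive.

Lemma integral_density_measure (h : U -> \bar R) : measurable_fun [set: U] h ->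
  (forall u, 0 <= h u)%E -> (\int[rho]_u h u = \int[mu]_u (h u * (f u)%:E))%E.
Proof. by move=> mh h0; apply: ge0_integral_density. Qed.

End density_measure.

Section image_measure.
Context d1 d2 (T1 : measurableType d1) (T2 : measurableType d2) (R : realType)
  (mu : {measure set T1 -> \bar R}) (phi : T1 -> T2).
Hypothesis mphi : measurable_fun [set: T1] phi.

(* As [pushforward], but the measurability proof is an argument, so that the measure
   structure can be inferred. *)
Definition image_measure (_ : measurable_fun [set: T1] phi) (A : set T2) : \bar R :=
  mu (phi @^-1` A).

Local Notation nu := (image_measure mphi).

Let nu0 : nu set0 = 0%E. Proof. exact: measure0. Qed.

Let nu_ge0 A : (0 <= nu A)%E. Proof. exact: measure_ge0. Qed.

Let nu_sigma_additive : semi_sigma_additive nu.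
Proof. exact: (@measure_semi_sigma_additive _ _ _ (pushforward mu phi)). Qed.

HB.instance Definition _ := isMeasure.Build _ _ _ nu nu0 nu_ge0 nu_sigma_additive.

Lemma integral_image_measure (h : T2 -> \bar R) : measurable_fun [set: T2] h ->
  (forall x, 0 <= h x)%E -> (\int[nu]_x h x = \int[mu]_u h (phi u))%E.
Proof.
move=> mh h0.
have := @ge0_integral_pushforward _ _ _ _ _ _ mphi mu setT h measurableT mh (fun x _ => h0 x).
by rewrite preimage_setT => <-.
Qed.

End image_measure.

(** If two cylinders share a configuration, their intersection is the cylinder that prescribes its
    counts on both lists of levels. *)
Lemma setI_closed_cylinders (R : realType) : setI_closed (@cylinders R).
Proof.
move=> D D' [->|[s [c [s0 ->]]]]; first by rewrite set0I; left.
move=> [->|[s' [c' [s'0 ->]]]]; first by rewrite setI0; left.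
have [->|/set0P[c'' [h h']]] := eqVneq (cylinder s c `&` cylinder s' c') set0; first by left.
right; exists (s ++ s'), c''; split; first by rewrite all_cat s0.
apply/seteqP; split => b.
  by move=> [b1 b2] q; rewrite mem_cat => /orP[qs|qs]; [rewrite b1// h|rewrite b2// h'].
by move=> bq; split => q qs; rewrite bq ?mem_cat ?qs ?orbT//; [exact: h|exact: h'].
Qed.

Section mecke.
Context (R : realType) (theta : R) d (T : measurableType d) (P : probability T R)
  (Y : nat -> {RV P >-> R}).
Hypothesis theta0 : 0 < theta.
Hypothesis poisson :
  poisson_process P (fun w => point_measure (fun i => Y i w)) (gamma_intensity theta).
Hypothesis proper : {ae P, forall w, proper_seq (fun i => Y i w)}.
Local Notation leb := (@lebesgue_measure R).
Local Notation kappa := (random_tally Y).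

Let mkappa : measurable_fun [set: T] kappa. Proof. exact: measurable_random_tally. Qed.

(** A cylinder depends only on the set of its levels, which may be sorted decreasingly without
    repetition. *)
Lemma cylinder_mecke (s : seq R) (c : R -> nat) (r : R) : all (fun q => 0 < q) s -> r \in s ->
  (\int[P]_w ((kappa w r)%:R * \1_(cylinder s c : set (config R)) (kappa w))%:E =
   \int[leb]_(y in `]r, +oo[) ((gamma_density theta y)%:E *
     P [set w | cylinder s c (insert_point y (kappa w))]))%E.
Proof.
move=> s0 rs; pose t := rev (sort <=%O (undup s)).
have ts : t =i s by move=> q; rewrite mem_rev mem_sort mem_undup.
have -> : cylinder s c = cylinder t c.
  by apply/seteqP; split=> c' h q qs; apply: h; rewrite ?ts// -ts.
have t_sorted : sorted (fun x y => y < x) t.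
  rewrite rev_sorted lt_sorted_uniq_le sort_uniq undup_uniq/=.
  by apply: sort_sorted; exact: le_total.
have t0 : all (fun q => 0 < q) t by rewrite (eq_all_r ts).
have := rs; rewrite -ts => /(nthP 0)[i si <-].
exact: (grid_mecke theta0 poisson proper c t_sorted t0 si).
Qed.

(* In logarithmic coordinates, countably many of the rays, each of finite mass for the
   two measures compared below, cover the whole line. *)
Let left_map i (w : T) : R * config R := (ln (Y i w), kappa w).

Let right_map (u : R * T) : R * config R := (ln u.1, insert_point u.1 (kappa u.2)).

Let mleft i : measurable_fun [set: T] (left_map i).
Proof. by apply: measurable_fun_pair => //; apply: measurableT_comp. Qed.

Let mright : measurable_fun [set: measurableTypeR R * T] right_map.
Proof.
apply: measurable_fun_pair.
  by apply: measurableT_comp; [exact: measurable_ln|exact: measurable_fst].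
apply: measurable_insert_point; first exact: measurable_fst.
exact: (measurableT_comp mkappa measurable_snd).
Qed.

Let dens (u : measurableTypeR R * T) : R := gamma_density theta u.1.

Let dens0 u : 0 <= dens u. Proof. exact: gamma_density_ge0. Qed.

Let mdens : measurable_fun [set: measurableTypeR R * T] dens.
Proof. exact: (measurableT_comp (measurable_gamma_density _) measurable_fst). Qed.

Let left_measure : {measure set (R * config R) -> \bar R} :=
  mseries (fun i => image_measure P (mleft i)) 0.

Let right_measure : {measure set (R * config R) -> \bar R} :=
  image_measure (density_measure (leb \x P)%E dens0 mdens) mright.

Let integral_left (h : R * config R -> \bar R) : measurable_fun [set: R * config R] h ->
  (forall x, 0 <= h x)%E ->
  (\int[left_measure]_x h x = \sum_(i <oo) \int[P]_w h (ln (Y i w), kappa w))%E.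
Proof.
move=> mh h0; rewrite ge0_integral_measure_series//; apply: eq_eseriesr => i _.
exact: integral_image_measure.
Qed.

Let integral_right (h : R * config R -> \bar R) : measurable_fun [set: R * config R] h ->
  (forall x, 0 <= h x)%E ->
  (\int[right_measure]_x h x = \int[leb]_y \int[P]_w
     (h (ln y, insert_point y (kappa w)) * (gamma_density theta y)%:E))%E.
Proof.
move=> mh h0; rewrite integral_image_measure// integral_density_measure//; last first.
  exact: (measurableT_comp mh mright).
rewrite fubini_tonelli1//.
- apply: emeasurable_funM; first exact: (measurableT_comp mh mright).
  exact/measurable_EFinP.
- by move=> u; rewrite mule_ge0// lee_fin.
Qed.

Let lt_lnE (t y : R) : 0 < y -> (t < ln y) = (expR t < y).
Proof. by move=> y0; rewrite -ltr_expR lnK. Qed.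

Let box (t : R) (D : set (config R)) : set (R * config R) := `]t, +oo[%classic `*` D.

Let indic_box t D (x : R * config R) : \1_(box t D) x = (t < x.1)%R%:R * \1_D x.2 :> R.
Proof.
rewrite !indicE in_setX (_ : (x.1 \in `]t, +oo[%classic) = (t < x.1)); last first.
  by apply/idP/idP; rewrite inE/= in_itv/= andbT.
by rewrite -natrM mulnb.
Qed.

Let measurable_box t D : measurable D -> measurable (box t D).
Proof. by move=> mD; apply: measurableX => //; exact: measurable_itv. Qed.

(** The number of points whose logarithm exceeds t is the count of the configuration at the level
    e^t. *)
Let left_box t D : measurable D -> left_measure (box t D) =
  (\int[P]_w ((kappa w (expR t))%:R * \1_D (kappa w))%:E)%E.
Proof.
move=> mD; have mb := measurable_box t mD.
transitivity (\int[left_measure]_x (\1_(box t D) x)%:E)%E; first by rewrite integral_indic// setIT.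
rewrite integral_left//; last first.
  by apply/measurable_EFinP; exact: measurable_indic.
have mB i : measurable_fun [set: T] (fun w => (\1_(box t D) (ln (Y i w), kappa w))%:E : \bar R).
  apply/measurable_EFinP; apply: (measurableT_comp (measurable_indic mb)).
  exact: mleft.
rewrite -integral_nneseries//.
apply: ge0_ae_eq_integral => //.
- by apply: ge0_emeasurable_sum => // i _; rewrite lee_fin.
- apply/measurable_EFinP; apply: measurable_funM.
    by apply: (measurableT_comp (measurable_config_count _)) => //; exact: expR_gt0.
  exact: (measurableT_comp (measurable_indic mD)).
- by move=> w _; apply: nneseries_ge0 => i _ _; rewrite lee_fin.
move: proper; apply: filterS => w Pw _.
have [_ Y0] := Pw; have yc := counts_tally Pw.
under eq_eseriesr => i _ do rewrite indic_box/= lt_lnE// mulrC EFinM.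
rewrite nneseriesZl//.
rewrite -/(cnt (fun i => Y i w) (expR t)) -yc ?expR_gt0//.
by rewrite mulrC EFinM.
Qed.

Let right_box t D : measurable D -> right_measure (box t D) =
  (\int[leb]_(y in `]expR t, +oo[) ((gamma_density theta y)%:E *
     P [set w | D (insert_point y (kappa w))]))%E.
Proof.
move=> mD; have mb := measurable_box t mD.
transitivity (\int[right_measure]_x (\1_(box t D) x)%:E)%E; first by rewrite integral_indic// setIT.
rewrite integral_right//; last first.
  by apply/measurable_EFinP; exact: measurable_indic.
rewrite [RHS]integral_mkcond; apply: eq_integral => y _; rewrite patchE.
have mDy : measurable [set w | D (insert_point y (kappa w))].
  rewrite -[X in measurable X]setTI; apply: (measurable_insert_point (z := fun=> y)) => //.
have [y0|y0] := leP y 0.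
  rewrite integral0_eq ?gamma_density_le0// => [|w _]; last by rewrite mule0.
  by case: ifP => _; rewrite ?mul0e.
rewrite (_ : (y \in `]expR t, +oo[%classic) = (t < ln y)); last first.
  by rewrite lt_lnE//; apply/idP/idP; rewrite inE/= in_itv/= andbT.
transitivity (\int[P]_w (((gamma_density theta y) * (t < ln y)%R%:R)%:E *
    (\1_[set w | D (insert_point y (kappa w))] w)%:E))%E.
  apply: eq_integral => w _; rewrite indic_box/= -!EFinM; congr EFin.
  by rewrite mulrC mulrA; congr (_ * _); rewrite !indicE; congr (nat_of_bool _)%:R.
rewrite ge0_integralZl//; last 2 first.
- by apply/measurable_EFinP; exact: measurable_indic.
- by rewrite lee_fin mulr_ge0// gamma_density_ge0.
rewrite integral_indic// setIT; case: ifP => _; first by rewrite mulr1.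
by rewrite mulr0 mul0e.
Qed.

Let cyl_measurable (s : seq R) c : all (fun q => 0 < q) s -> measurable (cylinder s c : set (config R)).
Proof. by move=> s0; apply: sub_sigma_algebra; right; exists s, c. Qed.

Let agree_cylinder t (s : seq R) (c : R -> nat) : all (fun q => 0 < q) s -> expR t \in s ->
  left_measure (box t (cylinder s c)) = right_measure (box t (cylinder s c)).
Proof.
move=> s0 ts; have mD := cyl_measurable c s0.
by rewrite left_box// right_box// (cylinder_mecke c s0 ts).
Qed.

(** The formula on a grid needs e^t among the levels. If it is missing, the cylinder is cut into
    countably many according to the count at that level. *)
Let agree t (D : set (config R)) : cylinders D ->
  left_measure (box t D) = right_measure (box t D).
Proof.
move=> [->|[s [c [s0 ->]]]]; first by rewrite /box setX0 !measure0.
pose r := expR t; have [rs|rs] := boolP (r \in s); first exact: agree_cylinder.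
pose ck k q := if q == r then k else c q.
have rs0 : all (fun q => 0 < q) (r :: s) by rewrite /= expR_gt0.
have -> : box t (cylinder s c) = \bigcup_k box t (cylinder (r :: s) (ck k)).
  apply/seteqP; split => [[x c'] [tx cc]|[x c'] [k _ [tx cc]]].
    exists (c' r) => //; split=> //= q; rewrite inE /ck => /predU1P[->|qs]; first by rewrite eqxx.
    by case: eqP => [qr|_]; [rewrite -qr|exact: cc].
  split=> //= q qs; have := cc q; rewrite inE qs orbT /ck => /(_ isT) /= ->.
  by case: eqP => // qr; move: rs; rewrite -qr qs.
have mb k : measurable (box t (cylinder (r :: s) (ck k))).
  by apply: measurable_box; exact: cyl_measurable.
have tb : trivIset [set: nat] (fun k => box t (cylinder (r :: s) (ck k))).
  move=> k l _ _ [[x c'] [[_ h1] [_ h2]]].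
  have := h1 r; have := h2 r; rewrite /= mem_head /ck eqxx => /(_ isT) <- /(_ isT) <-.
  by [].
rewrite !measure_semi_bigcup//; last 2 first.
- exact: bigcup_measurable.
- exact: bigcup_measurable.
by apply: eq_eseriesr => k _; apply: agree_cylinder => //; exact: mem_head.
Qed.

(** Boxes over cylinders form a generating family stable under intersection, and the boxes above -n
    exhaust the space with finite mass, by [gamma_density_ray]. *)
Let agree_measurable (A : set (R * config R)) : measurable A -> left_measure A = right_measure A.
Proof.
move=> mA.
pose G1 := @RGenOInfty.G R; pose G2 := @cylinders R.
pose G : set (set (R * config R)) := [set A1 `*` A2 | A1 in G1 & A2 in G2].
have cT : cylinders [set: config R].
  by right; exists [::], (fun=> 0%N); split=> //; apply/seteqP; split.
have cov1 : \bigcup_n `](- n%:R : R), +oo[%classic = [set: R].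
  apply/seteqP; split=> // x _; exists (Num.truncn `|x|).+1 => //=.
  rewrite in_itv/= andbT ltrNl; apply: le_lt_trans (ler_norm _) _; rewrite normrN.
  by have /andP[] := truncn_itv (normr_ge0 x).
have GA : <<s G >> A.
  apply: (@measurable_prod_generated _ _ _ (config R) G1 G2 (fun n => `](- n%:R), +oo[%classic) (fun=> setT) _ _ _ _ _ _ A) => //.
  - move=> B mB; have : (@ocitv R).-sigma.-measurable B by [].
    by rewrite RGenOInfty.measurableE.
  - by move=> n; exists (- n%:R).
  - by apply/seteqP; split=> // c' _; exists 0%N.
have Gm : G `<=` (@measurable _ (R * config R)%type).
  move=> _ [B1 [t ->] [B2 B2c <-]]; apply: measurable_box.
  exact: sub_sigma_algebra.
apply: (@g_sigma_algebra_measure_unique _ _ (R * config R)%type G Gm (fun n => box (- n%:R) [set: config R])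
  _ _ left_measure right_measure _ _ _ A GA).
- by move=> n; exists `](- n%:R), +oo[%classic; [exists (- n%:R)|exists setT].
- apply/seteqP; split=> // -[x c'] _.
  have : [set: R] x by [].
  by rewrite -cov1 => -[n _ xn]; exists n.
- move=> _ _ [_ [t ->] [B2 B2c <-]] [_ [t' ->] [B2' B2'c <-]].
  exists `]Num.max t t', +oo[%classic; first by exists (Num.max t t').
  exists (B2 `&` B2'); first exact: setI_closed_cylinders.
  apply/seteqP; split => -[x c'] /=; rewrite !in_itv/= !andbT gt_max.
    by move=> [/andP[-> ->] []].
  by move=> [[-> ?] [-> ?]].
- by move=> _ [B1 [t ->] [B2 B2c <-]]; exact: agree.
move=> n; rewrite [X in (X < _)%E]agree// right_box//.
rewrite [X in (X < _)%E](_ : _ = \int[leb]_(y in `]expR (- n%:R), +oo[) (gamma_density theta y)%:E)%E.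
  by apply: gamma_density_ray => //; exact: expR_gt0.
apply: eq_integral => y _; rewrite (_ : [set w | _] = setT) ?probability_setT ?mule1//.
Qed.

(** Equality of the two measures, taken back from logarithms to points. Nonpositive y, where the
    logarithm is not inverted by the exponential, carry zero density, and the points are almost
    surely positive. *)
Lemma mecke (h : R * config R -> \bar R) : measurable_fun [set: R * config R] h ->
  (forall x, 0 <= h x)%E ->
  (\sum_(i <oo) \int[P]_w h (Y i w, kappa w) =
   \int[leb]_y ((gamma_density theta y)%:E * \int[P]_w h (y, insert_point y (kappa w))))%E.
Proof.
move=> mh h0; pose h' (x : R * config R) := h (expR x.1, x.2).
have mh' : measurable_fun [set: R * config R] h'.
  apply: (measurableT_comp mh); apply: measurable_fun_pair => //.
  by apply: (measurableT_comp (@measurable_expR R)).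
have h'0 x : (0 <= h' x)%E by exact: h0.
have hL : (\int[left_measure]_x h' x = \int[right_measure]_x h' x)%E.
  by apply: eq_measure_integral => A mA _; exact: agree_measurable.
rewrite integral_left// integral_right// in hL.
transitivity (\sum_(i <oo) \int[P]_w h' (ln (Y i w), kappa w))%E.
  apply: eq_eseriesr => i _; apply: ge0_ae_eq_integral => //.
  - by apply: (measurableT_comp mh); exact: measurable_fun_pair.
  - exact: (measurableT_comp mh' (mleft i)).
  move: proper; apply: filterS => w [_ Y0] _.
  by rewrite /h'/= lnK ?posrE.
rewrite hL; apply: eq_integral => y _.
have [y0|y0] := leP y 0.
  rewrite gamma_density_le0// mul0e; apply: integral0_eq => w _.
  by rewrite mule0.
rewrite -ge0_integralZl//; last 2 first.
- apply: (measurableT_comp mh); apply: measurable_fun_pair => //.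
  exact: measurable_insert_point.
- by rewrite lee_fin gamma_density_ge0.
by apply: eq_integral => w _; rewrite muleC /h'/= lnK ?posrE.
Qed.

End mecke.

Section mecke_pairs.
Context (R : realType) (theta : R) d (T : measurableType d) (P : probability T R)
  (Y : nat -> {RV P >-> R}).
Hypothesis theta0 : 0 < theta.
Hypothesis poisson :
  poisson_process P (fun w => point_measure (fun i => Y i w)) (gamma_intensity theta).
Hypothesis proper : {ae P, forall w, proper_seq (fun i => Y i w)}.
Local Notation leb := (@lebesgue_measure R).
Local Notation kappa := (random_tally Y).

Let mkappa : measurable_fun [set: T] kappa. Proof. exact: measurable_random_tally. Qed.

Lemma proper_nonincreasing (y : nat -> R) : proper_seq y -> forall i, y i.+1 <= y i.
Proof. by move=> [[yi _] _] i; exact: yi. Qed.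

(* The points other than [z] are recovered from the configuration as the points of
   [remove_point z c]; this turns a sum over pairs into a sum over points. *)
Lemma mecke_pairs (h : (R * R) * config R -> \bar R) :
  measurable_fun [set: (R * R) * config R] h -> (forall x, 0 <= h x)%E ->
  (\sum_(i <oo) \sum_(j <oo | j != i) \int[P]_w h ((Y i w, Y j w), kappa w) =
   \int[leb]_y ((gamma_density theta y)%:E * \int[leb]_z ((gamma_density theta z)%:E *
     \int[P]_w h ((y, z), insert_point y (insert_point z (kappa w))))))%E.
Proof.
move=> mh h0.
(* A function of one point and the configuration only: the inner sum runs over the points left once
   the given one is removed. *)
pose H (x : R * config R) := (\sum_(k <oo) h ((x.1, point k (remove_point x.1 x.2)), x.2))%E.
have m1 : measurable_fun [set: R * config R] (fun x => x.1) by exact: measurable_fst.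
have m2 : measurable_fun [set: R * config R] (fun x => x.2) by exact: measurable_snd.
have mH : measurable_fun [set: R * config R] H.
  apply: ge0_emeasurable_sum => // k _; apply: (measurableT_comp mh).
  apply: measurable_fun_pair => //; apply: measurable_fun_pair => //.
  by apply: (measurableT_comp (measurable_point k)); exact: measurable_remove_point.
have H0 x : (0 <= H x)%E by exact: nneseries_ge0.
have mhY (y : T -> R) (z : T -> R) (c : T -> config R) : measurable_fun [set: T] y ->
    measurable_fun [set: T] z -> measurable_fun [set: T] c ->
    measurable_fun [set: T] (fun w => h ((y w, z w), c w)).
  move=> my mz mc; apply: (measurableT_comp mh).
  by apply: measurable_fun_pair => //; exact: measurable_fun_pair.
have := mecke theta0 poisson proper mH H0.
set L := (X in X = _ -> _); set Rt := (X in _ = X -> _) => LR.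
transitivity L.
  apply: eq_eseriesr => i _.
  transitivity (\int[P]_w (\sum_(j <oo | j != i) h ((Y i w, Y j w), kappa w)))%E.
    rewrite [LHS]eseries_mkcond.
    under [in RHS]eq_integral do rewrite eseries_mkcond.
    rewrite [RHS]integral_nneseries//; last 2 first.
    - by move=> j; case: (j != i); [exact: mhY|exact: measurable_cst].
    - by move=> j w _; case: ifP.
    by apply: eq_eseriesr => j _; case: (j != i); rewrite ?integral0.
  apply: ge0_ae_eq_integral => //.
  - apply: ge0_emeasurable_sum => // j _; exact: mhY.
  - by apply: (measurableT_comp mH); exact: measurable_fun_pair.
  - by move=> w _; exact: nneseries_ge0.
  move: proper; apply: filterS => w pw _.
  rewrite -(@nneseries_bump _ (fun j => h ((Y i w, Y j w), kappa w)))// /H/=.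
  have [pb cb] := counts_remove i pw (counts_tally pw).
  apply: eq_eseriesr => k _; rewrite (point_counts _ _ cb)//.
    exact: proper_nonincreasing.
  by case: pb => _ /(_ k)/ltW.
rewrite {}LR {}/Rt; apply: eq_integral => y _; congr (_ * _)%E.
(* Removing y after inserting it gives back the original configuration, so the inner sum is again
   over the Poisson points and the Mecke formula applies a second time, at fixed y. *)
pose hy (x : R * config R) := h ((y, x.1), insert_point y x.2).
have mhy : measurable_fun [set: R * config R] hy.
  apply: (measurableT_comp mh); apply: measurable_fun_pair; first exact: measurable_fun_pair.
  exact: measurable_insert_point.
transitivity (\sum_(k <oo) \int[P]_w hy (Y k w, kappa w))%E; last first.
  exact: (mecke theta0 poisson proper mhy (fun x => h0 _)).
have mhyk k : measurable_fun [set: T] (fun w => hy (Y k w, kappa w)).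
  by apply: (measurableT_comp mhy); exact: measurable_fun_pair.
have hy0 x : (0 <= hy x)%E by exact: h0.
rewrite -(integral_nneseries _ measurableT mhyk); last by move=> k w _; exact: hy0.
apply: ge0_ae_eq_integral => //.
- apply: (measurableT_comp mH); apply: measurable_fun_pair => //.
  exact: measurable_insert_point.
- exact: ge0_emeasurable_sum.
- by move=> w _; exact: nneseries_ge0.
move: proper; apply: filterS => w pw _; apply: eq_eseriesr => k _ /=.
rewrite insert_pointK (point_counts _ _ (counts_tally pw))//.
  exact: proper_nonincreasing.
by case: pw => _ /(_ k)/ltW.
Qed.

End mecke_pairs.

(** * The Poisson-Dirichlet distribution *)

(** Writing 1/f as f / f^2 reduces to the inverse of a nonnegative function, and is also correct
    where f = 0 by the convention that 0 has inverse 0. *)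
Lemma measurable_fun_inv d (U : measurableType d) (R : realType) (f : U -> R) :
  measurable_fun [set: U] f -> measurable_fun [set: U] (fun u => (f u)^-1).
Proof.
move=> mf; rewrite (_ : (fun u => _) = (fun u => f u * (f u * f u)^-1)).
  apply: measurable_funM => //; apply: measurable_fun_inv_ge0; first exact: measurable_funM.
  by move=> u; rewrite -expr2 sqr_ge0.
apply/funext => u; have [->|f0] := eqVneq (f u) 0; first by rewrite !mul0r invr0.
by field.
Qed.

Section configuration_functionals.
Context (R : realType).
Implicit Types (y : nat -> R) (c : config R) (s a z : R).

(** The absolute values make the sum meaningful and measurable for every configuration; on regular
    ones it is the sum of the points. *)
Definition total c : R := fine (\sum_(k <oo) `|point k c|%:E)%E.

Definition config_cnt c a : \bar R := cnt (fun k => point k c) a.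

(** For s > 0, the counts of the points divided by s, since a < y / s means a s < y. *)
Definition normalized_cnt s c a : \bar R := config_cnt c (a * s).

(** Holds almost surely for the Poisson points and is stable under insertion, so total mass and
    counts can be computed after applying the Mecke formula. *)
Definition regular s c : Prop :=
  exists y, [/\ proper_seq y, counts y c & (\sum_(k <oo) `|y k|%:E = s%:E)%E].

Let pointE y c : proper_seq y -> counts y c -> (fun k => point k c) = y.
Proof.
move=> yp yc; apply/funext => k; apply: (point_counts _ _ yc).
  exact: proper_nonincreasing.
by case: yp => _ /(_ k)/ltW.
Qed.

Lemma config_cntE y c a : proper_seq y -> counts y c -> config_cnt c a = cnt y a.
Proof. by move=> yp yc; rewrite /config_cnt (pointE yp yc). Qed.

Lemma regular_total s c : regular s c -> total c = s.
Proof.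
move=> [y [yp yc ys]]; rewrite /total -[RHS]/(fine s%:E) -ys; congr fine.
by apply: eq_eseriesr => k _; rewrite -(pointE yp yc).
Qed.

Lemma regular_insert s c z : regular s c -> 0 < z ->
  regular (s + z) (insert_point z c) /\
  forall a, config_cnt (insert_point z c) a = (config_cnt c a + ind a z)%E.
Proof.
move=> [y [yp yc ys]] z0; have [y' [yp' yc' yE]] := counts_insert yp yc z0; split.
  exists y'; split=> //; rewrite (yE (fun r => `|r|%:E))// ys gtr0_norm//.
  by rewrite addeC -EFinD.
move=> a; rewrite (config_cntE _ yp' yc') (config_cntE _ yp yc).
by rewrite /cnt (yE (fun r => (a < r)%R%:R%:E))// addeC.
Qed.

Lemma ind_scale s a z : 0 < s -> ind (a * s) z = ind a (z / s).
Proof. by move=> s0; rewrite /ind ltr_pdivlMr. Qed.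

Section measurability.
Context d (U : measurableType d) (f : U -> config R).
Hypothesis mf : measurable_fun [set: U] f.

Lemma measurable_total : measurable_fun [set: U] (fun u => total (f u)).
Proof.
apply: (@measurableT_comp _ _ _ _ _ _ fine) => //; apply: ge0_emeasurable_sum => // k _.
apply/measurable_EFinP; apply: measurableT_comp => //.
exact: (measurableT_comp (measurable_point k)).
Qed.

Lemma measurable_normalized_cnt (s : U -> R) a : measurable_fun [set: U] s ->
  measurable_fun [set: U] (fun u => normalized_cnt (s u) (f u) a).
Proof.
move=> ms; apply: ge0_emeasurable_sum => // k _.
apply: measurable_ind; first exact: measurable_funM.
exact: (measurableT_comp (measurable_point k)).
Qed.

End measurability.

End configuration_functionals.

Section pd_balance.
Context (R : realType) (theta : R) d (T : measurableType d) (P : probability T R)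
  (Y : nat -> {RV P >-> R}) (Z : {RV P >-> Omega1 R}).
Hypothesis theta0 : 0 < theta.
Hypothesis poisson :
  poisson_process P (fun w => point_measure (fun i => Y i w)) (gamma_intensity theta).
Local Notation leb := (@lebesgue_measure R).
Local Notation kappa := (random_tally Y).

Hypothesis normalized : {ae P, forall w, exists s, [/\ 0 < s,
  proper_seq (fun i => Y i w), (\sum_(i <oo) `|Y i w|%:E = s%:E)%E
  & forall i, (Z w : Omega1 R) i = Y i w / s]}.

Context (K F Q : R * R -> R).
Hypotheses (K0 : forall z, 0 <= K z) (F0 : forall z, 0 <= F z) (Q0 : forall z, 0 <= Q z).
Hypotheses (mK : measurable_fun [set: R * R] K) (mF : measurable_fun [set: R * R] F)
  (mQ : measurable_fun [set: R * R] Q).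
Hypothesis KE : forall z, 0 < z.1 -> 0 < z.2 -> K z = z.1 * z.2 * Q z.
Hypothesis FE : forall z, 0 < z.1 -> 0 < z.2 -> F z = theta * (z.1 + z.2) * Q z.
Context (Phi Psi : Omega1 R -> R).
Hypotheses (mPhi : measurable_fun [set: Omega1 R] Phi) (mPsi : measurable_fun [set: Omega1 R] Psi).
Hypotheses (Phi0 : forall x, 0 <= Phi x) (Psi0 : forall x, 0 <= Psi x).

Let proper : {ae P, forall w, proper_seq (fun i => Y i w)}.
Proof. by move: normalized; apply: filterS => w [s []]. Qed.

Let mkappa : measurable_fun [set: T] kappa. Proof. exact: measurable_random_tally. Qed.

Let regular_kappa : {ae P, forall w, exists s, [/\ 0 < s, regular s (kappa w),
  forall i, 0 < Y i w, forall i, (Z w : Omega1 R) i = Y i w / s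
  & normalized_cnt s (kappa w) = cnt (Z w : Omega1 R)]}.
Proof.
move: normalized; apply: filterS => w [s [s0 yp ys zE]]; exists s; split=> //.
- by exists (fun i => Y i w); split=> //; exact: counts_tally.
- by case: yp.
apply/funext => a; rewrite /normalized_cnt (config_cntE _ yp (counts_tally yp)).
by apply: eq_eseriesr => i _; rewrite zE ltr_pdivlMr.
Qed.

(* Both sides of the balance reduce to the integral of this weight: [t.1.1] and [t.1.2] are
   the points added by the Mecke formula and [s] is the total mass after adding them. *)
Definition pd_weight (t : (R * R) * T) : R :=
  let s := total (kappa t.2) + (t.1.1 + t.1.2) in
  s ^- 2 * Q (t.1.1 / s, t.1.2 / s) *
  (Phi (ranked (add2_count (t.1.1 / s) (t.1.2 / s) (normalized_cnt s (kappa t.2)))) *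
   Psi (ranked (add1_count ((t.1.1 + t.1.2) / s) (normalized_cnt s (kappa t.2))))).

Lemma pd_weight_ge0 t : 0 <= pd_weight t.
Proof. by rewrite /pd_weight !mulr_ge0// invr_ge0 sqr_ge0. Qed.

Lemma measurable_pd_weight : measurable_fun [set: (R * R) * T] pd_weight.
Proof.
have m1 : measurable_fun [set: (R * R) * T] (fun t => t.1.1).
  exact: (measurableT_comp measurable_fst).
have m2 : measurable_fun [set: (R * R) * T] (fun t => t.1.2).
  exact: (measurableT_comp measurable_snd).
have mk : measurable_fun [set: (R * R) * T] (fun t => kappa t.2).
  by apply: (measurableT_comp mkappa); exact: measurable_snd.
pose s (t : (R * R) * T) := total (kappa t.2) + (t.1.1 + t.1.2).
have ms : measurable_fun [set: (R * R) * T] s.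
  by apply: measurable_funD; [exact: measurable_total|exact: measurable_funD].
have msV := measurable_fun_inv ms.
have d1 : measurable_fun [set: (R * R) * T] (fun t => t.1.1 / s t) by exact: measurable_funM.
have d2 : measurable_fun [set: (R * R) * T] (fun t => t.1.2 / s t) by exact: measurable_funM.
apply: measurable_funM; first apply: measurable_funM.
- by apply: measurable_fun_inv; apply: measurable_funX.
- by apply: (measurableT_comp mQ); exact: measurable_fun_pair.
apply: measurable_funM; [apply: (measurableT_comp mPhi)|apply: (measurableT_comp mPsi)];
  apply: measurable_ranked => q q0.
  apply: emeasurable_funD; last exact: measurable_ind.
  apply: emeasurable_funD; last exact: measurable_ind.
  exact: measurable_normalized_cnt.
apply: emeasurable_funD; first exact: measurable_normalized_cnt.
apply: measurable_ind => //; apply: measurable_funM => //; exact: measurable_funD.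
Qed.

Definition pd_integral (z : R * R) : \bar R := (\int[P]_w (pd_weight (z, w))%:E)%E.

Lemma pd_integral_ge0 z : (0 <= pd_integral z)%E.
Proof. by apply: integral_ge0 => w _; rewrite lee_fin pd_weight_ge0. Qed.

Lemma measurable_pd_integral : measurable_fun [set: R * R] pd_integral.
Proof.
apply: (@measurable_fun_fubini_tonelli_F _ _ _ _ _ P (fun t => (pd_weight t)%:E)) => //.
  by apply/measurable_EFinP; exact: measurable_pd_weight.
by move=> t; rewrite lee_fin pd_weight_ge0.
Qed.

Let merge_integrand (t : (R * R) * config R) : R :=
  K (t.1.1 / total t.2, t.1.2 / total t.2) *
  (Phi (ranked (normalized_cnt (total t.2) t.2)) *
   Psi (ranked (merge_count (t.1.1 / total t.2) (t.1.2 / total t.2)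
     (normalized_cnt (total t.2) t.2)))).

Let merge_integrand0 t : 0 <= merge_integrand t. Proof. by rewrite !mulr_ge0. Qed.

Let measurable_merge_integrand : measurable_fun [set: (R * R) * config R] merge_integrand.
Proof.
have m1 : measurable_fun [set: (R * R) * config R] (fun t => t.1.1).
  exact: (measurableT_comp measurable_fst).
have m2 : measurable_fun [set: (R * R) * config R] (fun t => t.1.2).
  exact: (measurableT_comp measurable_snd).
have mc : measurable_fun [set: (R * R) * config R] (fun t => t.2) by exact: measurable_snd.
have ms := measurable_total mc; have msV := measurable_fun_inv ms.
have d1 : measurable_fun [set: (R * R) * config R] (fun t => t.1.1 / total t.2) by exact: measurable_funM.
have d2 : measurable_fun [set: (R * R) * config R] (fun t => t.1.2 / total t.2) by exact: measurable_funM.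
have mn q := measurable_normalized_cnt mc q ms.
apply: measurable_funM; first by apply: (measurableT_comp mK); exact: measurable_fun_pair.
apply: measurable_funM; [apply: (measurableT_comp mPhi)|apply: (measurableT_comp mPsi)];
  apply: measurable_ranked => q q0; first exact: mn.
by apply: measurable_merge_count => //; exact: mn.
Qed.

(** The sizes divided by the new total s contribute y z / s^2 to the rate; the factor y z taken out
    here cancels the 1/y and 1/z of the two densities, and s^{-2} stays in [pd_weight]. *)
Let merge_integrand_insert y z : 0 < y -> 0 < z ->
  (\int[P]_w (merge_integrand ((y, z), insert_point y (insert_point z (kappa w))))%:E =
   (y * z)%:E * pd_integral (y, z))%E.
Proof.
move=> y0 z0; rewrite /pd_integral -ge0_integralZl//; last 3 first.
- apply/measurable_EFinP; apply: (measurableT_comp measurable_pd_weight).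
  exact: measurable_fun_pair.
- by move=> w _; rewrite lee_fin pd_weight_ge0.
- by rewrite lee_fin mulr_ge0// ltW.
apply: (ge0_ae_eq_integral measurableT).
- apply/measurable_EFinP; apply: (measurableT_comp measurable_merge_integrand).
  apply: measurable_fun_pair => //.
  by apply: measurable_insert_point => //; exact: measurable_insert_point.
- apply: emeasurable_funM => //; apply/measurable_EFinP.
  by apply: (measurableT_comp measurable_pd_weight); exact: measurable_fun_pair.
- by move=> w _; rewrite lee_fin.
- by move=> w _; rewrite mule_ge0// lee_fin ?pd_weight_ge0// mulr_ge0// ltW.
move: regular_kappa; apply: filterS => w [s [s0 rk _ _ _]] _.
have [rz cz] := regular_insert rk z0; have [ry cy] := regular_insert rz y0.
have S0 : 0 < s + (y + z) by rewrite !addr_gt0.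
have tE : total (insert_point y (insert_point z (kappa w))) = s + (y + z).
  by rewrite (regular_total ry) -addrA (addrC z).
rewrite -EFinM /merge_integrand /pd_weight/= tE (regular_total rk) KE/= ?divr_gt0//.
have -> : ranked (normalized_cnt (s + (y + z)) (insert_point y (insert_point z (kappa w)))) =
   ranked (add2_count (y / (s + (y + z))) (z / (s + (y + z))) (normalized_cnt (s + (y + z)) (kappa w))).
  apply: eq_ranked => q q0; rewrite /normalized_cnt /add2_count cy cz !(ind_scale _ _ S0).
  by rewrite addeAC.
have -> : ranked (merge_count (y / (s + (y + z))) (z / (s + (y + z)))
    (normalized_cnt (s + (y + z)) (insert_point y (insert_point z (kappa w))))) =
   ranked (add1_count ((y + z) / (s + (y + z))) (normalized_cnt (s + (y + z)) (kappa w))).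
  apply: eq_ranked => q q0; rewrite mulrDl -merge_add2_count /merge_count; congr (_ - _ - _ + _)%E.
  by rewrite /normalized_cnt /add2_count cy cz !(ind_scale _ _ S0) addeAC.
congr EFin; move: (Phi _ * Psi _) => G.
by rewrite !mulrA; congr (_ * _ * _); field; rewrite gt_eqF.
Qed.

(** Merging sums over ordered pairs of Poisson points; the Mecke formula for pairs brings the
    product density theta^2 e^{-(y+z)} / (y z). *)
Lemma pd_merge_side : (\int[distribution P Z]_x ((Phi x)%:E * merge_part K Psi x) =
  \int[leb \x leb]_(z in @quadrant R)
    ((theta ^+ 2 * expR (- (z.1 + z.2)))%:E * pd_integral z))%E.
Proof.
have mZ : measurable_fun [set: T] Z by [].
have mf : measurable_fun [set: Omega1 R] (fun x => (Phi x)%:E * merge_part K Psi x)%E.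
  apply: emeasurable_funM; first exact/measurable_EFinP.
  exact: measurable_merge_part.
have f0 x : (0 <= (Phi x)%:E * merge_part K Psi x)%E by rewrite mule_ge0 ?lee_fin ?merge_part_ge0.
rewrite (ge0_integral_distribution Z mf)//.
have mmY i j : measurable_fun [set: T] (fun w => (merge_integrand ((Y i w, Y j w), kappa w))%:E).
  apply/measurable_EFinP; apply: (measurableT_comp measurable_merge_integrand).
  by apply: measurable_fun_pair => //; exact: measurable_fun_pair.
transitivity (\int[P]_w \sum_(i <oo) \sum_(j <oo | j != i) (merge_integrand ((Y i w, Y j w), kappa w))%:E)%E.
  apply: (ge0_ae_eq_integral measurableT).
  - exact: (measurableT_comp mf).
  - apply: ge0_emeasurable_sum => [i w _ _|i _]; first by apply: nneseries_ge0 => j _ _; rewrite lee_fin.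
    by apply: ge0_emeasurable_sum => [j w _ _|j _//]; rewrite lee_fin.
  - by move=> w _; exact: f0.
  - by move=> w _; apply: nneseries_ge0 => i _ _; apply: nneseries_ge0 => j _ _; rewrite lee_fin.
  move: regular_kappa; apply: filterS => w [s [s0 rk Y0 ZE rZ]] _.
  have Z0 i : 0 < (Z w : Omega1 R) i by rewrite ZE divr_gt0.
  rewrite /comp /merge_part -pair_sumZ; last by move=> i j; rewrite lee_fin mulr_ge0.
  apply: eq_eseriesr => i _; under eq_eseriesl => j do rewrite mulr_gt0// andbT.
  apply: eq_eseriesr => j _; rewrite -EFinM /merge_integrand/= (regular_total rk) -!ZE rZ ranked_cnt.
  by rewrite mulrCA.
rewrite integral_nneseries//; last 2 first.
- by move=> i; apply: ge0_emeasurable_sum => [j w _ _|j _//]; rewrite lee_fin.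
- by move=> i w _; apply: nneseries_ge0 => j _ _; rewrite lee_fin.
transitivity (\sum_(i <oo) \sum_(j <oo | j != i) \int[P]_w (merge_integrand ((Y i w, Y j w), kappa w))%:E)%E.
  apply: eq_eseriesr => i _; under eq_integral do rewrite eseries_mkcond.
  rewrite integral_nneseries//; last 2 first.
  - by move=> j; case: (j != i) => //; exact: measurable_cst.
  - by move=> j w _; case: (j != i); rewrite ?lee_fin.
  by rewrite [RHS]eseries_mkcond; apply: eq_eseriesr => j _; case: (j != i); rewrite ?integral0.
have mmf : measurable_fun [set: (R * R) * config R] (fun t => (merge_integrand t)%:E) by exact/measurable_EFinP.
have mf0 t : (0 <= (merge_integrand t)%:E)%E by rewrite lee_fin.
rewrite (mecke_pairs theta0 poisson proper mmf mf0) [RHS]integral_mkcond.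
rewrite fubini_tonelli1//; last 2 first.
- apply: (measurable_restrictT _ _).1; first exact: measurable_quadrant.
  apply: measurable_funTS; apply: emeasurable_funM; last exact: measurable_pd_integral.
  apply/measurable_EFinP; apply: measurable_funM => //; apply: measurableT_comp => //.
  by apply: measurableT_comp => //; exact: measurable_funD.
- move=> z; rewrite patchE; case: ifP => // _.
  by rewrite mule_ge0 ?pd_integral_ge0// lee_fin mulr_ge0 ?expR_ge0// sqr_ge0.
apply: eq_integral => y _; rewrite /fubini_F.
have [y0|y0] := leP y 0.
  rewrite gamma_density_le0// mul0e integral0_eq// => z _.
  rewrite patchE memNset// quadrantE /= => -[y0' _].
  by move: y0; rewrite leNgt y0'.
rewrite -ge0_integralZl//; last 3 first.
- apply: emeasurable_funM; first by apply/measurable_EFinP; exact: measurable_gamma_density.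
  apply: (@measurable_fun_fubini_tonelli_F _ _ _ _ _ P
    (fun t : R * T => (merge_integrand ((y, t.1), insert_point y (insert_point t.1 (kappa t.2))))%:E)) => //.
    apply: (measurableT_comp mmf).
    apply: measurable_fun_pair; first exact: measurable_fun_pair.
    apply: measurable_insert_point => //; apply: measurable_insert_point => //.
    by apply: (measurableT_comp mkappa); exact: measurable_snd.
- move=> z _; rewrite mule_ge0// ?lee_fin ?gamma_density_ge0//.
  by apply: integral_ge0 => w _; exact: mf0.
- by rewrite lee_fin gamma_density_ge0.
apply: eq_integral => z _; have [z0|z0] := leP z 0.
  rewrite (gamma_density_le0 theta z0) mul0e mule0 patchE memNset// quadrantE /= => -[_ z0'].
  by move: z0; rewrite leNgt z0'.
rewrite merge_integrand_insert// patchE mem_set; last by rewrite quadrantE.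
rewrite !gamma_densityE// !muleA -!EFinM; congr (_%:E * _)%E.
rewrite opprD expRD /=; field.
by rewrite !gt_eqF.
Qed.

Let split_integrand (t : (R * config R) * R) : R :=
  F (t.2 * (t.1.1 / total t.1.2), (1 - t.2) * (t.1.1 / total t.1.2)) *
  Phi (ranked (split_count (t.2 * (t.1.1 / total t.1.2)) ((1 - t.2) * (t.1.1 / total t.1.2))
     (normalized_cnt (total t.1.2) t.1.2))).

(** The absolute value changes nothing for positive points and makes the function nonnegative
    everywhere, as [mecke] demands. *)
Let split_summand (t : R * config R) : \bar R :=
  (`|t.1 / total t.2|%:E * int01 (fun u => split_integrand (t, u)) *
    (Psi (ranked (normalized_cnt (total t.2) t.2)))%:E)%E.

Let split_integrand0 t : 0 <= split_integrand t. Proof. by rewrite mulr_ge0. Qed.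

Let int01_split0 t : (0 <= int01 (fun u => split_integrand (t, u)))%E.
Proof. by apply: integral_ge0 => u _; rewrite lee_fin. Qed.

Let split_summand0 t : (0 <= split_summand t)%E. Proof. by rewrite !mule_ge0// lee_fin. Qed.

Let measurable_split_integrand : measurable_fun [set: (R * config R) * R] split_integrand.
Proof.
have m1 : measurable_fun [set: (R * config R) * R] (fun t => t.1.1).
  exact: (measurableT_comp measurable_fst).
have mc : measurable_fun [set: (R * config R) * R] (fun t => t.1.2).
  exact: (measurableT_comp measurable_snd).
have mu : measurable_fun [set: (R * config R) * R] (fun t => t.2) by exact: measurable_snd.
have ms := measurable_total mc; have msV := measurable_fun_inv ms.
have d1 : measurable_fun [set: (R * config R) * R] (fun t => t.1.1 / total t.1.2) by exact: measurable_funM.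
have u1 : measurable_fun [set: (R * config R) * R] (fun t => t.2 * (t.1.1 / total t.1.2)).
  exact: measurable_funM.
have u2 : measurable_fun [set: (R * config R) * R] (fun t => (1 - t.2) * (t.1.1 / total t.1.2)).
  by apply: measurable_funM => //; exact: measurable_funB.
apply: measurable_funM; first by apply: (measurableT_comp mF); exact: measurable_fun_pair.
apply: (measurableT_comp mPhi); apply: measurable_ranked => q q0.
by apply: measurable_split_count => //; exact: measurable_normalized_cnt.
Qed.

Let measurable_split_summand : measurable_fun [set: R * config R] split_summand.
Proof.
have mc : measurable_fun [set: R * config R] (fun t => t.2) by exact: measurable_snd.
have ms := measurable_total mc; have msV := measurable_fun_inv ms.
apply: emeasurable_funM; first apply: emeasurable_funM.
- apply/measurable_EFinP; apply: measurableT_comp => //.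
  by apply: measurable_funM => //; exact: measurable_fst.
- exact: measurable_int01.
apply/measurable_EFinP; apply: (measurableT_comp mPsi); apply: measurable_ranked => q q0.
exact: measurable_normalized_cnt.
Qed.

Let measurable_pd_weight_polar y : measurable_fun [set: T * R]
  (fun t => (pd_weight ((t.2 * y, (1 - t.2) * y), t.1))%:E).
Proof.
apply/measurable_EFinP; apply: (measurableT_comp measurable_pd_weight).
have mu : measurable_fun [set: T * R] (fun t => t.2) by exact: measurable_snd.
apply: measurable_fun_pair; last exact: measurable_fst.
exact: measurable_split_pair.
Qed.

Let measurable_pd_weight_polar1 y w : measurable_fun [set: R]
  (fun u => (pd_weight ((u * y, (1 - u) * y), w))%:E).
Proof.
apply/measurable_EFinP; apply: (measurableT_comp measurable_pd_weight).
apply: measurable_fun_pair => //.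
exact: measurable_split_pair.
Qed.

Let measurable_split_integrand1 y c : measurable_fun [set: R] (fun u => (split_integrand ((y, c), u))%:E).
Proof.
apply/measurable_EFinP; apply: (measurableT_comp measurable_split_integrand).
exact: measurable_fun_pair.
Qed.

(** The weight y / s and the rate theta (y / s) Q yield theta y^2 / s^2. Against the density theta
    e^{-y} / y one factor y remains, the Jacobian of the polar coordinates, and both sides get
    theta^2. *)
Let split_summand_insert y : 0 < y ->
  (\int[P]_w split_summand (y, insert_point y (kappa w)) =
   (theta * y ^+ 2)%:E * \int[leb]_(u in `]0%R, 1%R[) pd_integral (u * y, (1 - u) * y)%R)%E.
Proof.
move=> y0; have mw := @measurable_pd_weight_polar y.
have w0 t : (0 <= (pd_weight ((t.2 * y, (1 - t.2) * y), t.1))%:E)%E by rewrite lee_fin pd_weight_ge0.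
rewrite /pd_integral -(tonelli_int01 P mw w0) -ge0_integralZl//; last 3 first.
- exact: (measurable_int01e mw).
- by move=> w _; apply: integral_ge0 => u _; exact: (w0 (w, u)).
- by rewrite lee_fin mulr_ge0 ?sqr_ge0// ltW.
apply: (ge0_ae_eq_integral measurableT).
- apply: (measurableT_comp measurable_split_summand); apply: measurable_fun_pair => //.
  exact: measurable_insert_point.
- by apply: emeasurable_funM => //; exact: (measurable_int01e mw).
- by move=> w _; exact: split_summand0.
- move=> w _; apply: mule_ge0; first by rewrite lee_fin mulr_ge0 ?sqr_ge0// ltW.
  by apply: integral_ge0 => u _; exact: (w0 (w, u)).
move: regular_kappa; apply: filterS => w [s [s0 rk _ _ _]] _.
have [ry cy] := regular_insert rk y0.
have S0 : 0 < s + y by exact: addr_gt0.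
rewrite /split_summand/= (regular_total ry) gtr0_norm ?divr_gt0//.
rewrite muleAC -EFinM /int01.
have c10 : 0 <= y / (s + y) * Psi (ranked (normalized_cnt (s + y) (insert_point y (kappa w)))).
  by rewrite mulr_ge0// divr_ge0// ltW.
have c20 : 0 <= theta * y ^+ 2 by rewrite mulr_ge0 ?sqr_ge0// ltW.
rewrite -(@ge0_integralZl _ _ _ leb _ (measurable_itv _) _
  (measurable_funTS (measurable_split_integrand1 y (insert_point y (kappa w)))))//; last first.
  by move=> u _; rewrite lee_fin split_integrand0.
rewrite -(@ge0_integralZl _ _ _ leb _ (measurable_itv _) _
  (measurable_funTS (measurable_pd_weight_polar1 y w)))//; last first.
  by move=> u _; rewrite lee_fin pd_weight_ge0.
apply: eq_integral => u; rewrite inE/= in_itv/= => /andP[u0 u1].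
have v0 : 0 < 1 - u by rewrite subr_gt0.
have yE : u * y + (1 - u) * y = y by ring.
rewrite -!EFinM /split_integrand /pd_weight/= (regular_total ry) (regular_total rk) yE.
rewrite !mulrA FE/= ?divr_gt0 ?mulr_gt0// -mulrDl yE.
have -> : ranked (normalized_cnt (s + y) (insert_point y (kappa w))) =
   ranked (add1_count (y / (s + y)) (normalized_cnt (s + y) (kappa w))).
  by apply: eq_ranked => q q0; rewrite /normalized_cnt /add1_count cy (ind_scale _ _ S0).
have -> : ranked (split_count (u * y / (s + y)) ((1 - u) * y / (s + y))
    (normalized_cnt (s + y) (insert_point y (kappa w)))) =
   ranked (add2_count (u * y / (s + y)) ((1 - u) * y / (s + y)) (normalized_cnt (s + y) (kappa w))).
  apply: eq_ranked => q q0; rewrite -split_add1_count /split_count -mulrDl yE.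
  congr (_ - _ + _ + _)%E.
  by rewrite /normalized_cnt /add1_count cy (ind_scale _ _ S0).
congr EFin; move: (Phi _) (Psi _) (Q _) => G1 G2 G3.
by field; rewrite gt_eqF.
Qed.

Lemma pd_split_side : (\int[distribution P Z]_x ((Psi x)%:E * split_part F Phi x) =
  \int[leb \x leb]_(z in @quadrant R)
    ((theta ^+ 2 * expR (- (z.1 + z.2)))%:E * pd_integral z))%E.
Proof.
have mf : measurable_fun [set: Omega1 R] (fun x => (Psi x)%:E * split_part F Phi x)%E.
  apply: emeasurable_funM; first exact/measurable_EFinP.
  exact: measurable_split_part.
have f0 x : (0 <= (Psi x)%:E * split_part F Phi x)%E by rewrite mule_ge0 ?lee_fin ?split_part_ge0.
rewrite (ge0_integral_distribution Z mf)//.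
have msY i : measurable_fun [set: T] (fun w => split_summand (Y i w, kappa w)).
  by apply: (measurableT_comp measurable_split_summand); exact: measurable_fun_pair.
transitivity (\int[P]_w \sum_(i <oo) split_summand (Y i w, kappa w))%E.
  apply: (ge0_ae_eq_integral measurableT).
  - exact: (measurableT_comp mf).
  - by apply: ge0_emeasurable_sum => [i w _ _|i _]; [exact: split_summand0|exact: msY].
  - by move=> w _; exact: f0.
  - by move=> w _; apply: nneseries_ge0 => i _ _; exact: split_summand0.
  move: regular_kappa; apply: filterS => w [s [s0 rk Y0 ZE rZ]] _.
  have Z0 i : 0 < (Z w : Omega1 R) i by rewrite ZE divr_gt0.
  rewrite /comp /split_part /point_sum -nneseriesZl; last first.
    move=> i _; rewrite mule_ge0 ?lee_fin ?omega1_ge0//.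
    by apply: integral_ge0 => u _; rewrite lee_fin mulr_ge0.
  under eq_eseriesl => i do rewrite Z0.
  apply: eq_eseriesr => i _; rewrite /split_summand/= (regular_total rk) -ZE rZ ranked_cnt.
  rewrite gtr0_norm// muleC; congr (_ * _ * _)%E; apply: eq_integral => u _.
  by rewrite /split_integrand/= (regular_total rk) -ZE rZ.
rewrite (integral_nneseries _ measurableT msY); last by move=> i w _; exact: split_summand0.
rewrite (mecke theta0 poisson proper measurable_split_summand split_summand0).
pose h z := ((theta ^+ 2 * expR (- (z.1 + z.2)))%:E * pd_integral z)%E.
have mh : measurable_fun [set: R * R] h.
  apply: emeasurable_funM; last exact: measurable_pd_integral.
  apply/measurable_EFinP; apply: measurable_funM => //; apply: measurableT_comp => //.
  by apply: measurableT_comp => //; exact: measurable_funD.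
have h0 z : (0 <= h z)%E.
  by rewrite mule_ge0 ?pd_integral_ge0// lee_fin mulr_ge0 ?expR_ge0// sqr_ge0.
rewrite -(integral_polar mh h0) [RHS]integral_mkcond; apply: eq_integral => y _.
rewrite patchE; have [y0|y0] := leP y 0.
  rewrite gamma_density_le0// mul0e ifF//; apply/negP; rewrite inE /halfline/= in_itv/= andbT.
  by rewrite ltNge y0.
rewrite mem_set; last by rewrite halflineE.
rewrite split_summand_insert// muleA -EFinM /h.
transitivity (y%:E * ((theta ^+ 2 * expR (- y))%:E *
    \int[leb]_(u in `]0%R, 1%R[) pd_integral (u * y, (1 - u) * y)%R))%E.
  rewrite muleA -EFinM; congr (_%:E * _)%E; rewrite gamma_densityE//; field.
  by rewrite gt_eqF.
congr (_ * _)%E.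
have mp : measurable_fun [set: R] (fun u => pd_integral (u * y, (1 - u) * y)).
  apply: (measurableT_comp measurable_pd_integral).
  exact: measurable_split_pair.
rewrite -(@ge0_integralZl _ _ _ leb _ (measurable_itv _) _ (measurable_funTS mp)); last 2 first.
- by move=> u _; exact: pd_integral_ge0.
- by rewrite lee_fin mulr_ge0 ?expR_ge0// sqr_ge0.
apply: eq_integral => u _ /=; congr (_%:E * _)%E; congr (_ * expR (- _)); ring.
Qed.

Lemma pd_detailed_balance :
  (\int[distribution P Z]_x ((Phi x)%:E * merge_part K Psi x) =
   \int[distribution P Z]_x ((Psi x)%:E * split_part F Phi x))%E.
Proof. by rewrite pd_merge_side pd_split_side. Qed.

End pd_balance.

(** The terms have no sign, so the series may diverge; then both limits are the default value 0,
    since r can be divided out again. *)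
Lemma eseriesZl_real (R : realType) (P : pred nat) (a : nat -> R) (r : R) : r != 0 ->
  (\sum_(i <oo | P i) (r * a i)%:E = r%:E * \sum_(i <oo | P i) (a i)%:E)%E.
Proof.
move=> r0; pose s n := (\sum_(0 <= i < n | P i) (a i)%:E)%E.
have sE n : (\sum_(0 <= i < n | P i) (r * a i)%:E = r%:E * s n)%E.
  by rewrite /s !sumEFin -EFinM mulr_sumr.
rewrite (_ : (fun n => \sum_(0 <= i < n | P i) (r * a i)%:E)%E = (fun n => r%:E * s n)%E); last first.
  exact/funext.
have [cs|ns] := pselect (cvgn s); first by rewrite limeMl.
rewrite (dvgP ns) dvgP ?mule0// => crs; apply: ns.
rewrite (_ : s = (fun n => (r^-1)%:E * (r%:E * s n))%E); first exact: is_cvgeZl.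
by apply/funext => n; rewrite muleA -EFinM mulVf// mul1e.
Qed.

Lemma int01Z (R : realType) (f : R -> R) (M c : R) : measurable_fun [set: R] f ->
  (forall u, `|f u| <= M) ->
  int01 f \is a fin_num /\ int01 (fun u => c * f u) = (c%:E * int01 f)%E.
Proof.
move=> mf fM.
have fi : (@lebesgue_measure R).-integrable `]0%R, 1%R[ (fun u => (f u)%:E).
  apply: measurable_bounded_integrable => //.
  - by rewrite /= lebesgue_measure_itv/= lte_fin ltr01 oppr0 adde0 ltry.
  - exact: measurable_funTS.
  - by exists M; split; [exact: num_real|move=> N MN u _; exact: le_trans (fM u) (ltW MN)].
by split; [exact: integrable_fin_num|rewrite /int01 -integralZl].
Qed.

(** A generated process is tested on bounded Borel functions only; these are stable under the
    operator, so all terms of the exponential series coincide. *)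
Lemma reversible_ext (R : realType) (A A' : (Omega1 R -> R) -> (Omega1 R -> R))
    (nu : probability (Omega1 R) R) :
  (forall Phi, bounded_borel Phi -> A Phi = A' Phi) ->
  (forall Phi, bounded_borel Phi -> bounded_borel (A' Phi)) ->
  reversible A' nu -> reversible A nu.
Proof.
move=> AA bA rev d T P X [mX jX gX] sX; apply: rev => //; split=> //.
move=> s t Phi Psi E s0 st bP ePsi; apply: gX => //.
have it k : iter k A Phi = iter k A' Phi /\ bounded_borel (iter k A' Phi).
  by elim: k => [|k [IH bk]] //=; rewrite IH AA//; split=> //; exact: bA.
rewrite /is_expop (_ : (fun n x => _) =
  (fun n x => \sum_(k < n) (t - s) ^+ k / k`!%:R * iter k A' Phi x))//.
apply/funext => n; apply/funext => x; apply: eq_bigr => k _.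
by have [-> _] := it k.
Qed.

(** Summability comes from the target: l <= 0 would make all entries of [x] nonpositive, against
    their sum 1; hence y = l x has sum l and tends to 0 like [x]. *)
Lemma normalized_proper (R : realType) (y : nat -> R) (x : Omega1 R) (l : R) :
  (forall i, 0 < y i.+1 <= y i) -> (forall i, x i = y i / l) ->
  [/\ 0 < l, proper_seq y & (\sum_(i <oo) `|y i|%:E = l%:E)%E].
Proof.
move=> ypos xE.
have y0 i : 0 < y i.
  case: i => [|i]; last by have /andP[] := ypos i.
  by have /andP[y1 y10] := ypos 0%N; exact: lt_le_trans y10.
have l0 : 0 < l.
  rewrite ltNge; apply/negP => l0.
  have x0 i : x i = 0.
    apply/eqP; rewrite eq_le omega1_ge0 andbT xE.
    by rewrite mulr_ge0_le0 ?invr_le0// ltW.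
  have := omega1_sum x; rewrite eseries0; last by move=> i _ _; rewrite x0.
  by move=> /eqP; rewrite eqe eq_sym oner_eq0.
have yE i : y i = l * x i by rewrite xE mulrCA divff ?mulr1// gt_eqF.
split=> //; last first.
  under eq_eseriesr => i _ do rewrite gtr0_norm// yE EFinM.
  rewrite (@nneseriesZl _ (fun i => (x i)%:E) xpredT); last by move=> i _; rewrite lee_fin omega1_ge0.
  by rewrite omega1_sum mule1.
split=> //; split=> [k m km|e e0].
  by move: k m km; apply/nonincreasing_seqP => i; have /andP[] := ypos i.
have [_ /(_ (e / l) (divr_gt0 e0 l0))[k xk]] := omega1_nonincreasing_to0 x.
by exists k; rewrite yE mulrC -ltr_pdivlMr.
Qed.

Section poisson_dirichlet_reversible.
Context (R : realType) (theta : R) (Q : R * R -> R) (C : R).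
Hypotheses (theta0 : 0 < theta) (QC : forall z, rate_dom R z -> `|Q z| <= C) (C0 : 0 <= C).
Hypotheses (Q_ge0 : nonneg_on (rate_dom R) Q) (mQ : measurable_fun (rate_dom R) Q).

Let q := Q \_ (rate_dom R).

Let qE z : rate_dom R z -> q z = Q z. Proof. by move=> Dz; rewrite /q patchE mem_set. Qed.

Let qN z : ~ rate_dom R z -> q z = 0. Proof. by move=> Dz; rewrite /q patchE memNset. Qed.

Let q0 z : 0 <= q z.
Proof. by have [Dz|/qN ->//] := pselect (rate_dom R z); rewrite qE// Q_ge0. Qed.

Let q_le z : q z <= C.
Proof.
have [Dz|/qN ->//] := pselect (rate_dom R z).
by rewrite qE//; apply: le_trans (ler_norm _) (QC Dz).
Qed.

Let mq : measurable_fun [set: R * R] q.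
Proof. by apply: (measurable_restrictT _ _).1 => //; exact: measurable_rate_dom. Qed.

Let K (z : R * R) : R := z.1 * z.2 * q z.

(** The splitting rate theta x_i^2 Q is written as x_i times F, since the two fragments add up to
    x_i. *)
Let F (z : R * R) : R := theta * (z.1 + z.2) * q z.

Let K0 z : 0 <= K z.
Proof.
rewrite /K; have [[z1 z2 _]|/qN ->] := pselect (rate_dom R z); last by rewrite mulr0.
by rewrite !mulr_ge0// ltW.
Qed.

Let F0 z : 0 <= F z.
Proof.
rewrite /F; have [[z1 z2 _]|/qN ->] := pselect (rate_dom R z); last by rewrite mulr0.
by rewrite !mulr_ge0 ?addr_ge0// ltW.
Qed.

Let mK : measurable_fun [set: R * R] K.
Proof. by apply: measurable_funM => //; apply: measurable_funM. Qed.

Let mF : measurable_fun [set: R * R] F.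
Proof.
apply: measurable_funM => //; apply: measurable_funM => //.
by apply: measurable_funD.
Qed.

Let K_bounded (x : Omega1 R) : (pair_sum x (fun i j => (K (x i, x j))%:E) <= C%:E)%E.
Proof.
have x0 := omega1_ge0 x.
apply: (@le_trans _ _ (\sum_(i <oo) \sum_(j <oo) (C%:E * (x i)%:E) * (x j)%:E)%E).
  apply: lee_nneseries => [i _ _|i _]; first by apply: nneseries_ge0 => j _ _; rewrite lee_fin.
  rewrite eseries_mkcond; apply: lee_nneseries => [j _ _|j _].
    by case: ifP => // _; rewrite lee_fin.
  case: ifP => _; last by rewrite -!EFinM lee_fin !mulr_ge0.
  by rewrite -!EFinM lee_fin /K/= [leLHS]mulrC -[leRHS]mulrA ler_wpM2r// mulr_ge0.
under eq_eseriesr => i _.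
  rewrite nneseriesZl; last by move=> j _; rewrite lee_fin.
  rewrite omega1_sum mule1; over.
rewrite (@nneseriesZl _ (fun i => (x i)%:E) xpredT); last by move=> j _; rewrite lee_fin.
by rewrite omega1_sum mule1.
Qed.

Let F_bounded (x : Omega1 R) : (point_sum x (fun i =>
  (x i)%:E * int01 (fun u => F (u * x i, (1 - u) * x i)%R)) <= (theta * C)%:E)%E.
Proof.
have x0 := omega1_ge0 x.
have tC : 0 <= theta * C by rewrite mulr_ge0// ltW.
have I0 i : (0 <= int01 (fun u => F (u * x i, (1 - u) * x i)%R))%E.
  by apply: integral_ge0 => u _; rewrite lee_fin.
apply: (@le_trans _ _ (\sum_(i <oo) ((theta * C)%:E * (x i)%:E))%E).
  rewrite /point_sum eseries_mkcond; apply: lee_nneseries => [i _ _|i _].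
    by case: ifP => // _; rewrite mule_ge0// lee_fin.
  case: ifP => _; last by rewrite -EFinM lee_fin mulr_ge0.
  rewrite muleC lee_wpmul2r ?lee_fin//.
  apply: (@le_trans _ _ (\int[lebesgue_measure]_(u in `]0%R, 1%R[) (theta * C)%:E)%E).
    apply: ge0_le_integral => //.
    - by move=> u _; rewrite lee_fin.
    - apply/measurable_EFinP; apply: measurable_funTS; apply: (measurableT_comp mF).
      exact: measurable_split_pair.
    move=> u _; rewrite lee_fin /F/= -mulrDl addrCA subrr addr0 mul1r -mulrA ler_pM2l//.
    by rewrite -[leRHS]mul1r ler_pM// omega1_le1.
  by rewrite integral_cst//= lebesgue_measure_itv/= lte_fin ltr01 oppr0 adde0 mule1.
rewrite nneseriesZl; last by move=> j _; rewrite lee_fin.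
by rewrite omega1_sum mule1.
Qed.

(** The constant theta x_i moves through the integral over u, which is finite because [Phi] is
    bounded, and theta through the series. Should the series be infinite, [fine] gives 0 on both
    sides. *)
Let LQE Phi : bounded_borel Phi -> LQtheta Q theta Phi = Lsharp K F Phi.
Proof.
move=> [mPhi [M PhiM]]; apply/funext => x; rewrite /LQtheta /Lsharp; congr (_ * fine _ + _).
  by apply: eq_pair_sum => i j Dij; rewrite /K qE.
pose f i u := q (u * x i, (1 - u) * x i) *
  (Phi (split (u * x i) ((1 - u) * x i) x) - Phi x).
have mf i : measurable_fun [set: R] (f i).
  have mu1 : measurable_fun [set: R] (fun u => u * x i) by exact: measurable_funM.
  have mu2 : measurable_fun [set: R] (fun u => (1 - u) * x i).
    by apply: measurable_funM => //; exact: measurable_funB.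
  apply: measurable_funM; first by apply: (measurableT_comp mq); exact: measurable_fun_pair.
  apply: measurable_funB => //; apply: (measurableT_comp mPhi).
  exact: measurable_split.
have fb i u : `|f i u| <= C * (M + M).
  rewrite normrM ler_pM// ?(ger0_norm (q0 _))//.
  by apply: le_trans (ler_normB _ _) _; rewrite lerD.
pose a i := (x i ^+ 2) * fine (int01 (f i)).
have aE i : ((a i)%:E = (x i ^+ 2)%:E * int01 (f i))%E.
  by rewrite EFinM fineK//; have [] := int01Z 0 (mf i) (fb i).
have fE i : 0 < x i -> forall u, 0 < u < 1 ->
    f i u = Q (u * x i, (1 - u) * x i) * (Phi (Siu i u x) - Phi x).
  move=> xi u u01; have /andP[u0 u1] := u01.
  by rewrite /f qE ?Siu_ranked//; exact: rate_dom_split.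
rewrite (_ : point_sum x _ = \sum_(i <oo | (0 < x i)%R) (a i)%:E)%E; last first.
  apply: eq_eseriesr => i xi; rewrite aE; congr (_ * _)%E; apply: eq_integral => u.
  by rewrite inE/= in_itv/= => u01; rewrite fE.
rewrite [in RHS](_ : point_sum x _ = \sum_(i <oo | (0 < x i)%R) (theta * a i)%:E)%E; last first.
  apply: eq_eseriesr => i xi; rewrite EFinM aE.
  rewrite (_ : int01 _ = int01 (fun u => (theta * x i) * f i u)).
    have [_ ->] := int01Z (theta * x i) (mf i) (fb i).
    by rewrite !muleA -!EFinM; congr (_%:E * _)%E; ring.
  apply: eq_integral => u; rewrite inE/= in_itv/= => u01; rewrite fE//.
  rewrite /F/= -mulrDl addrCA subrr addr0 mul1r qE; last exact: rate_dom_split.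
  by rewrite -!mulrA.
rewrite eseriesZl_real ?gt_eqF//.
case: (\sum_(i <oo | _) _)%E => [r| |] /=.
- by rewrite -mulrA mulrCA.
- by rewrite gt0_muley ?lte_fin//= !mulr0.
- by rewrite gt0_muleNy ?lte_fin//= !mulr0.
Qed.

Lemma reversible_PD (mu : probability (Omega1 R) R) : is_PD theta mu ->
  reversible (LQtheta Q theta) mu.
Proof.
move=> [d [T [P [Y [Z [Ypos poisson ZE muE]]]]]].
apply: (reversible_ext LQE) => [Phi /bounded_borelP[M bM]|].
  by apply/bounded_borelP; eexists; apply: (Lsharp_bounded (C := C) (D := theta * C) _ _ _ _ _ _ bM).
apply: (@reversible_Lsharp _ _ _ _ _ _ _ C (theta * C)) => //.
move=> Phi Psi M mPhi mPsi PhiM PsiM.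
have mE (f : Omega1 R -> \bar R) : (\int[mu]_x f x = \int[distribution P Z]_x f x)%E.
  by apply: eq_measure_integral => A mA _; exact: muE.
rewrite !mE; apply: (@pd_detailed_balance _ _ _ _ _ Y Z theta0 poisson _ _ _ q) => //.
- move: Ypos ZE; apply: filterS2 => w Yw Zw.
  exists (limn (series (fun j => Y j w))).
  by have [l0 yp ys] := normalized_proper Yw Zw; split.
- by move=> x; have /andP[] := PhiM x.
- by move=> x; have /andP[] := PsiM x.
Qed.

End poisson_dirichlet_reversible.

Theorem theorem2p3 (R : realType) :
  (forall K1 F1 : R * R -> R,
     symmetric_on (rate_dom R) K1 -> nonneg_on (rate_dom R) K1 ->
     measurable_fun (rate_dom R) K1 ->
     symmetric_on (rate_dom R) F1 -> nonneg_on (rate_dom R) F1 ->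
     measurable_fun (rate_dom R) F1 ->
     bounded_merge_rate K1 -> bounded_split_rate F1 ->
   forall (d : measure_display) (T : measurableType d) (P : probability T R)
     (X : {RV P >-> Omega1 R}) (q1 : R -> R) (q2 : R * R -> R)
     (P1 : R.-pker R ~> Nspace R) (P2 : R.-pker (R * R) ~> Nspace R),
     correlation_function1 X q1 -> correlation_function2 X q2 ->
     reduced_palm1 X P1 -> reduced_palm2 X P2 ->
     {ae (lebesgue_measure \x lebesgue_measure)%E, forall z : R * R,
        Delta2o R z ->
        forall B : set (Nspace R), measurable B ->
          ((K1 z * q2 z)%:E * P2 z B =
           (F1 z * q1 (z.1 + z.2))%:E * P1 (z.1 + z.2)%R B)%E} ->
   reversible (Lsharp K1 F1) (distribution P X))
  /\
  (forall (theta : R) (Q : R * R -> R),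
     0 < theta ->
     (exists2 z, rate_dom R z & Q z != 0) ->
     (exists C : R, forall z, rate_dom R z -> `|Q z| <= C) ->
     symmetric_on (rate_dom R) Q -> nonneg_on (rate_dom R) Q ->
     measurable_fun (rate_dom R) Q ->
   forall mu : probability (Omega1 R) R,
     is_PD theta mu -> reversible (LQtheta Q theta) mu).
Proof.
split=> [K1 F1 _ K0 mK _ F0 mF Kb Fb d T P X q1 q2 P1 P2|theta Q theta0 _ [C QC] _ Q0 mQ mu].
  exact: reversible_palm.
(* The maximum with 0 makes the bound valid also for the extension of [Q] by zero. *)
apply: (@reversible_PD _ _ _ (Num.max C 0)) => //; last by rewrite le_max lexx orbT.
by move=> z /QC h; rewrite le_max h.
Qed.
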